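(* Let $G\subseteq\mathrm{GL}(V)$ define the linear free divisor $D$ with basic relative invariants $f_1,\ldots,f_r$ and corresponding characters $\chi_1,\ldots,\chi_r$. Choose $X_1,\ldots,X_r\in\mathfrak{g}\subseteq\mathfrak{gl}(V)$ such that $d(\chi_i)_{(e)}(X_j)=\delta_{ij}$ for all $i,j$, or equivalently, $\xi_{X_i}(f_j)=\delta_{ij}f_j$ for all $i,j$. Let $I$ denote the identity endomorphism in both $G\subseteq\mathrm{GL}(V)$ and $\mathfrak{g}\subseteq\mathfrak{gl}(V)$, so that $\xi_I$ is the Euler vector field. Let the module $A\subseteq\mathrm{Der}_V$ consist of the vector fields annihilating all $f_i$. Then for all $i=1,\ldots,r$: $$\xi_I(f_i)=\deg(f_i)f_i,$$ $$d(\chi_i)_{(e)}(I)=\deg(f_i),$$ $$\chi_i(\lambda\cdot I)=\lambda^{\deg(f_i)}\quad\text{for all }\lambda\in\mathbb{C}^*,$$ and moreover $$I=\sum_{j=1}^r\deg(f_j)X_j\bmod{[\mathfrak{g},\mathfrak{g}]},\qquad\xi_I=\sum_{j=1}^r\deg(f_j)\xi_{X_j}\bmod{A}.$$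
   Context: $\mathfrak{g}$ is the Lie algebra of $G$. For $X\in\mathfrak{g}$, $\xi_X$ is the vector field on $V$ given by $\xi_X(v)=\frac{d}{dt}\big(\exp(tX)(v)\big)\big|_{t=0}$. $\mathrm{Der}_V$ is the module of holomorphic vector fields on $V$, and $\delta_{ij}$ is the Kronecker delta. For a nonempty reduced analytic subset $D\subsetneq V$ of a finite-dimensional complex vector space $V$, $\mathrm{Der}_V(-\log D)$ is the module (sheaf) of germs of holomorphic vector fields $\eta$ on $V$ with $\eta(I(D))\subseteq I(D)$, where $I(D)$ is the ideal of germs vanishing on $D$. $D$ is a linear free divisor if $\mathrm{Der}_V(-\log D)$ has a free basis consisting of linear vector fields (coefficients are homogeneous linear forms); such a $D$ is a hypersurface. One says a complex linear algebraic group $G\subseteq\mathrm{GL}(V)$ defines the linear free divisor $D$ if $G$ is connected, $\dim G=\dim V$, and $V\setminus D$ is a (Zariski open) orbit of $G$; then $G$ contains all nonzero scalar multiples of the identity. The basic relative invariants $f_1,\ldots,f_r$ are the irreducible polynomials defining the irreducible components of $D$; the corresponding rational characters $\chi_i:G\to\mathrm{GL}_1(\mathbb{C})$ satisfy $f_i(gv)=\chi_i(g)f_i(v)$. *)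

(* Defs.v *)
From HB Require Import structures.
From mathcomp Require Import all_boot all_order all_algebra.
From mathcomp Require Import all_classical all_reals all_analysis.
From mathcomp Require Export complex.
(* The notations of mpoly clash with those of analysis. *)
From mathcomp Require Import -(notations) mpoly.

Set Implicit Arguments.
Unset Strict Implicit.
Unset Printing Implicit Defensive.

Import Order.TTheory GRing.Theory Num.Theory.
Import numFieldNormedType.Exports.

Local Open Scope classical_set_scope.
Local Open Scope ring_scope.

(* The field of complex numbers, with the norm topology. *)
Notation Cplx R := (complex R : numClosedFieldType).

Notation poly_in k K := (mpoly.mpoly k K).

Section Zariski.
Context {C : numClosedFieldType}.

(* total degree; mmeasure mdeg p is 1 + the total degree of p != 0 *)
Definition tdeg k (p : poly_in k C) : nat := (mmeasure mdeg p).-1.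

Definition irreducible_mpoly k (p : poly_in k C) : Prop :=
  [/\ p != 0, p \isn't a GRing.unit &
      forall q s : poly_in k C, p = q * s ->
        q \is a GRing.unit \/ s \is a GRing.unit].

(* The Zariski topology on an affine space T with linear coordinates x. *)
Context {T : Type} {k : nat} (x : T -> 'I_k -> C).

Definition zero_locus (S : set (poly_in k C)) : set T :=
  [set v | forall p, S p -> mpoly.meval (x v) p = 0].

Definition zariski_closed (A : set T) : Prop := exists S, A = zero_locus S.

Definition zariski_connected (A : set T) : Prop :=
  forall B1 B2, zariski_closed B1 -> zariski_closed B2 ->
    A `<=` B1 `|` B2 -> A `&` B1 `&` B2 = set0 ->
    A `<=` B1 \/ A `<=` B2.

Definition zariski_irreducible (A : set T) : Prop :=
  A !=set0 /\
  forall B1 B2, zariski_closed B1 -> zariski_closed B2 ->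
    A `<=` B1 `|` B2 -> A `<=` B1 \/ A `<=` B2.

Definition irreducible_component (A Z : set T) : Prop :=
  [/\ zariski_closed Z, zariski_irreducible Z, Z `<=` A &
      forall Z', zariski_closed Z' -> zariski_irreducible Z' ->
        Z `<=` Z' -> Z' `<=` A -> Z' = Z].

End Zariski.

Definition vec_coord {C : numClosedFieldType} n (v : 'cV[C]_n) (i : 'I_n) : C :=
  v i 0.

Definition mx_coord {C : numClosedFieldType} n (g : 'M[C]_n) (i : 'I_(n * n)) : C :=
  mxvec g 0 i.

Definition poly_fun {C : numClosedFieldType} n (p : poly_in n C) (v : 'cV[C]_n) : C :=
  mpoly.meval (vec_coord v) p.

Section Holomorphic.
Context {C : numClosedFieldType}.

(* Germs at p are represented by functions defined everywhere, of which only
   the values near p matter. *)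
Definition holomorphic_at {V W : normedModType C} (h : V -> W) (p : V) : Prop :=
  \forall v \near p, differentiable h v.

(* eta(h), for a vector field eta and a function h *)
Definition vf_apply {V : normedModType C} (eta : V -> V) (h : V -> C) (v : V) : C :=
  'D_(eta v) h v.

Definition analytic_set {V : normedModType C} (D : set V) : Prop :=
  forall p, exists (k : nat) (h : 'I_k -> V -> C),
    (forall j, holomorphic_at (h j) p) /\
    \forall v \near p, D v <-> forall j, h j v = 0.

(* the stalk at p of the ideal I(D) *)
Definition ideal_at {V : normedModType C} (D : set V) (p : V) (h : V -> C) : Prop :=
  holomorphic_at h p /\ \forall v \near p, D v -> h v = 0.

(* the stalk at p of Der_V(-log D); eta(h) is holomorphic because eta and h
   are, so that eta(h) belongs to I(D) as soon as it vanishes on D *)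
Definition log_vf_at {V : normedModType C} (D : set V) (p : V) (eta : V -> V) : Prop :=
  holomorphic_at eta p /\
  forall h, ideal_at D p h -> \forall v \near p, D v -> vf_apply eta h v = 0.

End Holomorphic.

(* V is C^(n.+1), written as column vectors; a nonempty proper subset D of V
   forces dim V > 0. *)
Section LinearFreeDivisor.
Context {C : numClosedFieldType} {n : nat}.
Local Notation V := 'cV[C]_n.+1.
Local Notation gl := 'M[C]_n.+1.

(* The linear vector fields v |-> B i *m v freely generate every stalk of
   Der_V(-log D). *)
Definition linear_log_basis (D : set V) (m : nat) (B : 'I_m -> gl) : Prop :=
  forall p : V,
  [/\ forall i, log_vf_at D p (fun v => B i *m v),
      forall eta, log_vf_at D p eta ->
        exists a : 'I_m -> V -> C, (forall i, holomorphic_at (a i) p) /\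
          \forall v \near p, eta v = \sum_i a i v *: (B i *m v) &
      forall a : 'I_m -> V -> C, (forall i, holomorphic_at (a i) p) ->
        (\forall v \near p, \sum_i a i v *: (B i *m v) = 0) ->
        forall i, \forall v \near p, a i v = 0].

Definition linear_free_divisor (D : set V) : Prop :=
  [/\ D !=set0, D != setT, analytic_set D &
      exists m (B : 'I_m -> gl), linear_log_basis D B].

(* Zariski closed subgroups of GL(V) *)
Record linear_algebraic_group (G : set gl) : Prop := LinearAlgebraicGroup {
  lag_unit : forall g, G g -> g \in unitmx;
  lag_one : G 1%:M;
  lag_mul : forall g h, G g -> G h -> G (g *m h);
  lag_inv : forall g, G g -> G (invmx g);
  lag_closed : exists A, zariski_closed (@mx_coord C n.+1) A /\
                 G = A `&` [set g | g \in unitmx] }.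

(* S is an embedded complex submanifold of gl of dimension d: near each of its
   points, a biholomorphic chart phi (with inverse psi) straightens S to a
   linear subspace L of dimension d. *)
Definition complex_submanifold (d : nat) (S : set gl) : Prop :=
  forall p, S p ->
  exists (U W : set gl) (phi psi : gl -> gl) (L : {vspace gl}),
  [/\ [/\ open U, open W & U p],
      forall g, U g -> W (phi g) /\ psi (phi g) = g,
      forall g, W g -> U (psi g) /\ phi (psi g) = g,
      (forall g, U g -> differentiable phi g) /\
      (forall g, W g -> differentiable psi g) &
      \dim L = d /\ forall g, U g -> (S g <-> phi g \in L)].

Record defines_linear_free_divisor (G : set gl) (D : set V) : Prop :=
  DefinesLFD {
    dlfd_lfd : linear_free_divisor D;
    dlfd_group : linear_algebraic_group G;
    dlfd_connected : zariski_connected (@mx_coord C n.+1) G;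
    dlfd_dim : complex_submanifold n.+1 G;
    dlfd_open : zariski_closed (@vec_coord C n.+1) D;
    dlfd_orbit : exists v0, ~` D = [set g *m v0 | g in G] }.

(* f lists, without repetition, irreducible equations of the irreducible
   components of D. *)
Definition basic_relative_invariants (D : set V) (r : nat)
    (f : 'I_r -> poly_in n.+1 C) : Prop :=
  let hyp i : set V := [set v | poly_fun (f i) v = 0] in
  [/\ forall i, irreducible_mpoly (f i),
      injective hyp &
      forall Z, irreducible_component (@vec_coord C n.+1) D Z <->
        exists i, Z = hyp i].

(* Characters G -> GL_1(C) that are regular functions on G, i.e. restrictions
   of elements of C[x_ij, 1/det]; only the values of chi on G matter. *)
Definition rational_character (G : set gl) (chi : gl -> C) : Prop :=
  [/\ forall g, G g -> chi g != 0,
      forall g h, G g -> G h -> chi (g *m h) = chi g * chi h &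
      exists (p : poly_in (n.+1 * n.+1) C) (k : nat), forall g, G g ->
        chi g = mpoly.meval (mx_coord g) p / \det g ^+ k].

Definition expmx (X : gl) : gl :=
  lim (series (fun k => (k`!%:R : C)^-1 *: X ^+ k) @ \oo).

(* the Lie algebra of a complex Lie subgroup of GL(V) *)
Definition lie_algebra (G : set gl) : set gl :=
  [set X | forall t : C, G (expmx (t *: X))].

(* [g, g], the linear span of the brackets of elements of g *)
Definition derived_algebra (g : set gl) : set gl :=
  [set Z | exists m (c : 'I_m -> C) (X Y : 'I_m -> gl),
     (forall k, g (X k) /\ g (Y k)) /\
     Z = \sum_k c k *: (X k *m Y k - Y k *m X k)].

(* d(chi)_(e), evaluated at X by means of the curve t |-> exp(tX) *)
Definition dchar (chi : gl -> C) (X : gl) : C :=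
  derive1 (fun t : C => chi (expmx (t *: X))) 0.

(* the vector field xi_X : v |-> d/dt (exp(tX) v) at t = 0 *)
Definition xi (X : gl) (v : V) : V :=
  derive1 (fun t : C => expmx (t *: X) *m v) 0.

(* the module A of holomorphic vector fields on V annihilating all f i *)
Definition annihilating_vf (r : nat) (f : 'I_r -> poly_in n.+1 C) :
    set (V -> V) :=
  [set eta | (forall p, holomorphic_at eta p) /\
     forall i v, vf_apply eta (poly_fun (f i)) v = 0].

End LinearFreeDivisor.

(* Main.v *)
(* The Lie algebra g of G is the set of velocities at I of curves in G. A linear
   field is logarithmic as soon as it is tangent to curves contained in D, so g
   lies in the span of the linear logarithmic basis B, and by dimension g is this
   span. Hence D is the zero set of Delta = det (B_1 v, ..., B_N v), which is
   homogeneous of degree N = dim V; the Euler field is logarithmic because D is a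
   cone, so I lies in g, and C^* I lies in G because a polynomial in lambda that
   vanishes at all exp(t) is zero.

   The main point is that the differentials of the characters span the linear
   forms on g that vanish on [g, g]. Read in the coframe dual to B, such a form phi
   becomes a rational one-form eta / Delta on V, which is closed by the
   Maurer-Cartan equation, and the coefficients of eta have degree less than N.
   Delta is reduced (Saito): near a generic point of an irreducible q = 0 the
   fields tangent to q = 0 have determinant q up to a unit, while they are
   logarithmic, hence combinations of B. So the poles of eta / Delta are simple
   along the f_i; their residues are constant, and subtracting c_i df_i / f_i for
   all i leaves a polynomial form of negative degree, i.e. zero. Evaluation on B
   gives phi = sum c_i d(chi_i).

   As d(chi_i) vanishes on Z = I - sum deg(f_j) X_j for all i, so does every such
   phi, and Z lies in [g, g]. *)
Require Import Defs.
From HB Require Import structures.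
From mathcomp Require Import all_boot all_order all_algebra.
From mathcomp Require Import all_classical all_reals all_analysis.
From mathcomp Require Import complex ring zify.
From mathcomp Require Import -(notations) mpoly.

Import Order.TTheory GRing.Theory Num.Theory.
Import numFieldNormedType.Exports.
Local Open Scope classical_set_scope.
Local Open Scope ring_scope.

Set Implicit Arguments.
Unset Strict Implicit.
Unset Printing Implicit Defensive.

(** * Unique factorization in polynomial rings *)

Section Divisibility.
Context {A : idomainType}.
Implicit Types a b c p : A.

(** Analysis enters only to first order. Tangency to D and membership in the Lie algebra are both
    tested on curves differentiable at t = 0: a germ vanishing on D is constant along a curve in D,
    and Euler's limit g(1/k)^k -> exp(X) recovers a one-parameter subgroup from a single velocity.
    Such curves can be built from products in G and from small roots of polynomials in one variable.
    Poles are handled by polynomial algebra: forms are multiplied by Delta, and the constancy of a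
    residue along f = 0 becomes a divisibility by f. Unique factorization serves twice. It makes
    irreducibles prime, and through a Bezout identity free of one variable it gives the
    Nullstellensatz for one irreducible polynomial and carries constancy from a point to all of f =
    0. Reducedness of Delta turns divisibility by every f_i into divisibility by Delta; poles of
    higher order could carry exact forms that no combination of the df_i / f_i captures. *)

Definition dvdr a b := exists c, b = c * a.

Definition irred p : Prop :=
  [/\ p != 0, p \isn't a GRing.unit &
      forall q s, p = q * s -> q \is a GRing.unit \/ s \is a GRing.unit].

Lemma dvdrr a : dvdr a a.
Proof. by exists 1; rewrite mul1r. Qed.

Lemma dvdr0 a : dvdr a 0.
Proof. by exists 0; rewrite mul0r. Qed.

Lemma dvdr_mull c a b : dvdr a b -> dvdr a (c * b).
Proof. by case=> d ->; exists (c * d); rewrite mulrA. Qed.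

Lemma dvdr_mulr c a b : dvdr a b -> dvdr a (b * c).
Proof. by rewrite mulrC; apply: dvdr_mull. Qed.

Lemma dvdrD a b c : dvdr a b -> dvdr a c -> dvdr a (b + c).
Proof. by move=> [d ->] [e ->]; exists (d + e); rewrite mulrDl. Qed.

Lemma dvdrN a b : dvdr a b -> dvdr a (- b).
Proof. by move=> [d ->]; exists (- d); rewrite mulNr. Qed.

Lemma dvdrB a b c : dvdr a b -> dvdr a c -> dvdr a (b - c).
Proof. by move=> ab ac; apply: dvdrD => //; apply: dvdrN. Qed.

Lemma dvdr_sum (I : Type) (s : seq I) (P : pred I) (F : I -> A) a :
  (forall i, P i -> dvdr a (F i)) -> dvdr a (\sum_(i <- s | P i) F i).
Proof. by move=> aF; elim/big_ind: _ => //; [exact: dvdr0|move=> *; exact: dvdrD]. Qed.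

Lemma dvdr_trans b a c : dvdr a b -> dvdr b c -> dvdr a c.
Proof. by move=> [d ->] [e ->]; exists (e * d); rewrite mulrA. Qed.

Lemma dvdr_unit a b : dvdr a b -> b \is a GRing.unit -> a \is a GRing.unit.
Proof. by move=> [c ->]; rewrite unitrM => /andP[]. Qed.

Lemma irred_dvdr p q : irred p -> irred q -> dvdr p q -> dvdr q p.
Proof.
move=> [_ pU _] [_ _ q_irr] [c qE]; have [cU|/(negP pU)//] := q_irr _ _ qE.
by exists c^-1; rewrite qE mulKr.
Qed.

(** Existence of factorizations is encoded by an additive size that is positive on nonunits,
    uniqueness by the primality of irreducibles. This form passes easily from a ring to its
    polynomial ring. *)
Definition ufd : Prop :=
  (exists2 sz : A -> nat,
     (forall a b, a != 0 -> b != 0 -> sz (a * b) = (sz a + sz b)%N) &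
     forall a, a != 0 -> sz a = 0%N -> a \is a GRing.unit) /\
  forall p, irred p -> forall a b, dvdr p (a * b) -> dvdr p a \/ dvdr p b.

(** A proper factor of a nonunit has smaller size, so a nonunit of least size among the factors is
    irreducible; splitting it off lowers the size again. *)
Lemma ufd_ind : ufd -> forall P : A -> Prop,
  (forall a, a \is a GRing.unit -> P a) ->
  (forall p a, irred p -> a != 0 -> P a -> P (p * a)) ->
  forall a, a != 0 -> P a.
Proof.
move=> [[sz szM sz0] _] P P1 PM a.
have sz_gt0 b : b != 0 -> b \isn't a GRing.unit -> (0 < sz b)%N.
  by move=> b0 bU; rewrite lt0n; apply: contraNneq bU => /(sz0 _ b0).
have factor n : forall b, (sz b <= n)%N -> b != 0 -> b \isn't a GRing.unit ->
    exists2 p, irred p & dvdr p b.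
  elim: n => [|n IHn] b bn b0 bU.
    by have := sz_gt0 b b0 bU; rewrite ltnNge bn.
  have [b_irr|b_red] := pselect (irred b); first by exists b => //; exact: dvdrr.
  have [c [d [bE cU dU]]] : exists c d, [/\ b = c * d,
      c \isn't a GRing.unit & d \isn't a GRing.unit].
    apply: contrapT => nex; apply: b_red; split=> // c d bE.
    have [cU|cU] := boolP (c \is a GRing.unit); first by left.
    have [dU|dU] := boolP (d \is a GRing.unit); first by right.
    by case: nex; exists c, d.
  have /andP[c0 d0] : (c != 0) && (d != 0) by rewrite -negb_or -mulf_eq0 -bE.
  have [|p p_irr pc] := IHn c _ c0 cU.
    rewrite -ltnS (leq_trans _ bn) // bE szM // -[ltnLHS]addn0 ltn_add2l.
    exact: sz_gt0.
  by exists p => //; rewrite bE; apply: dvdr_mulr.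
have [n] := ubnP (sz a); elim: n a => // n IHn a an a0.
have [/P1//|aU] := boolP (a \is a GRing.unit).
have [p p_irr [b aE]] := factor _ a (leqnn _) a0 aU.
have p0 : p != 0 by case: p_irr.
have b0 : b != 0 by apply: contraNneq a0 => b0; rewrite aE b0 mul0r.
rewrite aE mulrC; apply: PM => //; apply: IHn => //.
rewrite (leq_trans _ (an : (sz a <= n)%N)) // aE szM // -[ltnLHS]addn0 ltn_add2l.
by apply: sz_gt0 => //; case: p_irr.
Qed.

(** Irreducible factors p of a are cancelled from a and b together. A further factor q of a / p
    cannot divide p, since q * q would then divide a; hence q still divides b / p. *)
Lemma squarefree_dvdr a b : ufd -> a != 0 ->
  (forall p, irred p -> dvdr p a -> ~ dvdr (p * p) a) ->
  (forall p, irred p -> dvdr p a -> dvdr p b) -> dvdr a b.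
Proof.
move=> ufdA a0; elim/(ufd_ind ufdA): a / a0 b => [a aU b _ _|].
  by exists (b * a^-1); rewrite mulrVK.
move=> p a p_irr a0 IHa b sqf pb.
have [c bE] : dvdr p b by apply: pb => //; apply: dvdr_mulr; exact: dvdrr.
have {}IHa : dvdr a c.
  apply: IHa => [q q_irr qa qqa|q q_irr qa].
    by apply: (sqf q q_irr); apply: dvdr_mull.
  have /(ufdA.2 q q_irr)[//|qp] : dvdr q (c * p).
    by rewrite -bE; apply: pb => //; apply: dvdr_mull.
  case: (sqf q q_irr (dvdr_mull _ qa)).
  by case: qp => d ->; case: qa => e ->; exists (d * e); rewrite mulrACA.
by rewrite bE; case: IHa => e ->; exists e; ring.
Qed.

End Divisibility.
Arguments ufd : clear implicits.

(* Unbundled, since inferring these morphisms between polynomial rings as ring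
   morphisms of integral domains is very slow. *)
Definition multiplicative0 (A B : idomainType) (f : A -> B) :=
  [/\ f 0 = 0, f 1 = 1 & {morph f : x y / x * y}].

Lemma dvdr_morph (A B : idomainType) (f : A -> B) a b :
  multiplicative0 f -> dvdr a b -> dvdr (f a) (f b).
Proof. by move=> [_ _ fM] [c ->]; exists (f c); rewrite fM. Qed.

Lemma unit_morph (A B : idomainType) (f : A -> B) a :
  multiplicative0 f -> a \is a GRing.unit -> f a \is a GRing.unit.
Proof.
move=> [_ f1 fM] aU; apply/unitrPr; exists (f a^-1).
by rewrite -fM divrr.
Qed.

Lemma irred_iso (A B : idomainType) (f : A -> B) (g : B -> A) :
  multiplicative0 f -> multiplicative0 g -> cancel f g -> cancel g f ->
  forall p, irred p -> irred (f p).
Proof.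
move=> fM gM fK gK p [p0 pU p_irr]; have [g0 _ gM'] := gM; split.
- by apply: contraNneq p0 => /(congr1 g); rewrite fK g0 => ->.
- by apply: contra pU => /(unit_morph gM); rewrite fK.
- move=> q s /(congr1 g); rewrite fK gM' => /p_irr[] /(unit_morph fM);
  rewrite gK; tauto.
Qed.

Lemma ufd_iso (A B : idomainType) (f : A -> B) (g : B -> A) :
  multiplicative0 f -> multiplicative0 g -> cancel f g -> cancel g f ->
  ufd B -> ufd A.
Proof.
move=> fM gM fK gK [[sz szM sz0] primeB].
have [g0 _ _] := gM; have [_ _ fM'] := fM; split.
  have f0 a : a != 0 -> f a != 0.
    by apply: contraNneq => /(congr1 g); rewrite fK g0 => ->.
  exists (sz \o f) => [a b a0 b0|a a0 /= fa0] /=.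
    by rewrite fM' szM // f0.
  by rewrite -[a]fK; apply: unit_morph => //; apply: sz0 => //; exact: f0.
move=> p /(irred_iso fM gM fK gK) fp a b /(dvdr_morph fM).
by rewrite fM' => /(primeB _ fp)[] /(dvdr_morph gM); rewrite !fK; tauto.
Qed.

(** * Gauss's lemma and factoriality of polynomials over a factorial ring *)

Section Gauss.
Context {A : idomainType}.
Hypothesis ufdA : ufd A.
Implicit Types (a c p : A) (f g d s t : {poly A}).

Definition primitive f := forall p, irred p -> ~ dvdr p%:P f.

Lemma dvdr_polyCP a f : dvdr a%:P f <-> forall i, dvdr a f`_i.
Proof.
split=> [[g ->] i|af]; first by rewrite coefMC; exists g`_i.
have {af}af i : {c | f`_i = c * a} := cid (af i).
exists (\poly_(i < size f) sval (af i)); apply/polyP => i.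
rewrite coefMC coef_poly; case: ltnP => [_|/(nth_default 0)->].
  exact: svalP (af i).
by rewrite mul0r.
Qed.

Lemma irred_polyC_prime p : irred p ->
  forall f g, dvdr p%:P (f * g) -> dvdr p%:P f \/ dvdr p%:P g.
Proof.
move=> p_irr f g pfg; apply: contrapT => /not_orP[pf pg].
have ex f' : ~ dvdr p%:P f' -> exists i, `[< ~ dvdr p f'`_i >].
  move=> pf'; apply: contrapT => /forallNP nf; apply: pf'.
  by apply/dvdr_polyCP => i; apply: contrapT => pfi; apply: (nf i); apply/asboolP.
have [i /asboolP pfi mini] := ex_minnP (ex _ pf).
have [j /asboolP pgj minj] := ex_minnP (ex _ pg).
have /(ufdA.2 _ p_irr)[//|//] : dvdr p (f`_i * g`_j).
(* With i and j the first indices whose coefficients escape p, every other term of the coefficient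
   of index i + j has a factor of smaller index, which p divides. *)
have -> : f`_i * g`_j = (f * g)`_(i + j) -
    \sum_(k < (i + j).+1 | k != inord i :> 'I_(i + j).+1) f`_k * g`_(i + j - k).
  rewrite coefM (bigD1 (inord i)) //= inordK ?ltnS ?leq_addr //.
  by rewrite addKn addrK.
apply: dvdrB; first by move/dvdr_polyCP: pfg; apply.
apply: dvdr_sum => k ki.
have [k_lt|k_ge] := ltnP k i.
  apply: dvdr_mulr; apply: contrapT => pk.
  by have := mini k (asboolT pk); rewrite leqNgt k_lt.
apply: dvdr_mull; apply: contrapT => pk.
have := minj _ (asboolT pk); have := ltn_ord k.
have : (k : nat) != i   by apply: contraNneq ki => kE; apply/eqP/val_inj; rewrite /= inordK ?kE ?ltnS ?leq_addr.
lia.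
Qed.

(** Each irreducible factor of a divides f * t but not the primitive f, so it divides t. This clears
    the denominators of a divisibility over the fraction field. *)
Lemma primitive_cancel a : a != 0 -> forall f s t, primitive f ->
  a%:P * s = f * t -> exists t', t = a%:P * t'.
Proof.
move=> a0; elim/(ufd_ind ufdA): a / a0 => [a aU f s t _ _|p a p_irr _ IHa f s t fP].
  by exists (a^-1%:P * t); rewrite mulrA -polyCM divrr // mul1r.
move=> E; have [|/(fP _ p_irr)//|[t1 tE]] := irred_polyC_prime p_irr (f := f) (g := t).
  by rewrite -E polyCM -mulrA; apply: dvdr_mulr; exact: dvdrr.
have p0 : p%:P != 0 by rewrite polyC_eq0; case: p_irr.
have [t' t1E] : exists t', t1 = a%:P * t'.
  apply: (IHa f s) => //; apply: (mulfI p0).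
  by rewrite mulrA -polyCM E tE; ring.
by exists t'; rewrite tE t1E polyCM; ring.
Qed.

(** Extracting a constant irreducible factor lowers the size of the leading coefficient, so the
    extraction stops. *)
Lemma primitive_part d : d != 0 ->
  exists c d', [/\ c != 0, d = c%:P * d' & primitive d'].
Proof.
have [[sz szM sz0] _] := ufdA.
have [n] := ubnP (sz (lead_coef d)); elim: n d => // n IHn d dn d0.
have [dP|/existsNP[p /not_implyP[p_irr /contrapT[e dE]]]] := pselect (primitive d).
  by exists 1, d; rewrite oner_neq0 mul1r.
have [p0 pU _] := p_irr.
have e0 : e != 0 by apply: contraNneq d0 => e0; rewrite dE e0 mul0r.
have [|c [d' [c0 eE d'P]]] := IHn e _ e0.
  rewrite (leq_trans _ (dn : (_ <= n)%N)) // dE lead_coefM lead_coefC.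
  rewrite szM ?lead_coef_eq0 // -[ltnLHS]addn0 ltn_add2l lt0n.
  by apply: contraNneq pU => /(sz0 _ p0).
exists (p * c), d'; split=> //; first by rewrite mulf_neq0.
by rewrite dE eE polyCM; ring.
Qed.

Lemma irred_primitive f : irred f -> (1 < size f)%N -> primitive f.
Proof.
move=> [f0 fU f_irr] sf p [p0 pU _] [g fE].
have [gU|] := f_irr _ _ fE; last by rewrite poly_unitE coefC => /andP[_ /(negP pU)].
move: sf; rewrite fE mulrC mul_polyC size_scale // ltnNge; case/negP.
by move: gU; rewrite poly_unitE => /andP[/eqP->].
Qed.

(** This is coprimality over the fraction field with denominators cleared. Euclid's algorithm in the
    ideal (f, g) ends at a nonzero constant or at some d dividing constant multiples of f and g; in
    the second case the primitive part of d divides both. *)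
Lemma irred_bezout f g : irred f -> (1 < size f)%N -> ~ dvdr f g ->
  exists2 c : A, c != 0 & exists a b : {poly A}, c%:P = a * f + b * g.
Proof.
move=> f_irr sf fg.
pose I d := exists a b : {poly A}, d = a * f + b * g.
have If : I f by exists 1, 0; ring.
have Ig : I g by exists 0, 1; ring.
suff main n d : (size d < n)%N -> d != 0 -> I d ->
    exists2 c : A, c != 0 & I c%:P.
  by apply: (main _ f (ltnSn _)) => //; case: f_irr.
elim: n d => // n IHn d dn d0 Id.
(* Pseudo-division of h by d: a nonzero remainder is a smaller element of the ideal, covered by
   induction, and a zero remainder makes d divide a constant multiple of h. *)
have step h : I h -> (exists2 c : A, c != 0 & I c%:P) \/
    exists2 c : A, c != 0 & exists q, c%:P * h = q * d.
  move=> Ih; have := Pdiv.Idomain.divp_eq h d; set l := lead_coef d ^+ _ => hE.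
  have [r0|r0] := eqVneq (h %% d) 0.
    right; exists l; first by rewrite expf_neq0 // lead_coef_eq0.
    by exists (h %/ d); rewrite mul_polyC hE r0 addr0.
  left; apply: (IHn (h %% d)) => //.
    by rewrite (leq_trans _ (dn : (_ <= n)%N)) // ltn_modp.
  have [a [b dE]] := Id; have [a' [b' hE']] := Ih.
  exists (l%:P * a' - (h %/ d) * a), (l%:P * b' - (h %/ d) * b).
  have -> : h %% d = l%:P * h - h %/ d * d by rewrite mul_polyC hE addrC addKr.
  by move: (h %/ d) => q; rewrite hE' dE; ring.
have [//|[l l0 [q lfE]]] := step f If.
have [//|[m m0 [q' mgE]]] := step g Ig.
have [c [d' [c0 dE d'P]]] := primitive_part d0.
have [u fE] : dvdr d' f.
  have [|t' qE] := @primitive_cancel l l0 d' f (c%:P * q) d'P.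
    by rewrite lfE dE; ring.
  exists t'; apply: (@mulfI _ l%:P); first by rewrite polyC_eq0.
  by rewrite mulrA -qE lfE [d in LHS]dE; ring.
have [w gE] : dvdr d' g.
  have [|t' qE] := @primitive_cancel m m0 d' g (c%:P * q') d'P.
    by rewrite mgE dE; ring.
  exists t'; apply: (@mulfI _ m%:P); first by rewrite polyC_eq0.
  by rewrite mulrA -qE mgE [d in LHS]dE; ring.
(* The common divisor d' is either associated to f, which would make f divide g, or a unit; then d
   is itself a constant. *)
have [_ _ f_irr'] := f_irr.
have [uU|] := f_irr' _ _ fE.
  by case: fg; exists (w * u^-1); rewrite fE mulrA mulrVK.
rewrite poly_unitE => /andP[/eqP d'1 _].
have d'E : d' = (d'`_0)%:P by apply: size1_polyC; rewrite d'1.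
exists (c * d'`_0); last by rewrite polyCM -d'E -dE.
rewrite mulf_neq0 //; apply/eqP => z; move: d'1.
by rewrite d'E z size_poly0.
Qed.

(** The size adds the degree to the size of the leading coefficient. If f has positive degree and
    does not divide g, the identity c = a f + b g times h shows that f divides c h, and c cancels
    because f is primitive. In degree 0 primality is Gauss's lemma. *)
Lemma poly_ufd : ufd {poly A}.
Proof.
have [[sz szM sz0] primeA] := ufdA.
split.
  exists (fun f => sz (lead_coef f) + (size f).-1)%N => [f g f0 g0|f f0 /eqP].
    rewrite lead_coefM szM ?lead_coef_eq0 // size_mul //.
    by move: f0 g0; rewrite -!size_poly_gt0; lia.
  rewrite addn_eq0 => /andP[/eqP l0 /eqP s0].
  have s1 : size f = 1%N by rewrite (polySpred f0) s0.
  have fl : f`_0 = lead_coef f by rewrite lead_coefE s1.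
  by rewrite poly_unitE s1 fl; apply: sz0; rewrite // lead_coef_eq0.
move=> f f_irr; have [sf|sf] := ltnP 1 (size f).
  move=> g h fgh; have [fg|/(irred_bezout f_irr sf)] := pselect (dvdr f g).
    by left.
  move=> [c c0 [a [b cE]]]; right; have [k ghE] := fgh.
  have [|t' tE] := @primitive_cancel c c0 f h (a * h + b * k) (irred_primitive f_irr sf).
    rewrite cE; have -> : (a * f + b * g) * h = a * f * h + b * (g * h) by ring.
    by rewrite ghE; ring.
  exists t'; apply: (@mulfI _ c%:P); first by rewrite polyC_eq0.
  rewrite mulrA -tE cE; have -> : (a * f + b * g) * h = a * f * h + b * (g * h) by ring.
  by rewrite ghE; ring.
have [f0 fU f_irr'] := f_irr.
have fE := size1_polyC sf; rewrite fE; apply: irred_polyC_prime; split.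
- by apply: contraNneq f0 => f0; rewrite fE f0.
- apply: contra fU => fU; rewrite poly_unitE fU andbT eqn_leq sf.
  by rewrite size_poly_gt0.
- move=> a b abE; have := f_irr' a%:P b%:P.
  by rewrite -polyCM -abE => /(_ fE)[]; rewrite poly_unitE coefC => /andP[_]; tauto.
Qed.

End Gauss.

Lemma irred_bezout_iso (A B : idomainType) (f : B -> {poly A}) (g : {poly A} -> B) :
  multiplicative0 f -> multiplicative0 g -> {morph g : x y / x + y} ->
  cancel f g -> cancel g f -> ufd A ->
  forall a b, irred a -> (1 < size (f a))%N -> ~ dvdr a b ->
  exists2 c, c != 0 & exists u v, g c%:P = u * a + v * b.
Proof.
move=> fM gM gD fK gK ufdA a b a_irr sz ab.
have fab : ~ dvdr (f a) (f b) by move=> /(dvdr_morph gM); rewrite !fK.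
have [c c0 [u [v cE]]] :=
  irred_bezout ufdA (irred_iso fM gM fK gK a_irr) sz fab.
exists c => //; exists (g u), (g v); have [_ _ gM'] := gM.
by rewrite cE gD !gM' !fK.
Qed.

Local Notation mX i := (mpolyX _ (mnm1 i)).

Section MPolyGeneral.
Context {n : nat} {C : comNzRingType}.

Lemma mpoly_rmorph_ext (S : comNzRingType) (f g : {rmorphism poly_in n C -> S}) :
  (forall c, f (mpolyC n c) = g (mpolyC n c)) ->
  (forall i, f (mX i) = g (mX i)) -> f =1 g.
Proof.
move=> fgC fgX p; rewrite (mpolyE p) !rmorph_sum; apply: eq_bigr => m _.
rewrite -mul_mpolyC !rmorphM /= fgC; congr (_ * _).
rewrite mpolyXE_id !rmorph_prod /=; apply: eq_bigr => i _.
by rewrite !rmorphXn /= fgX.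
Qed.

End MPolyGeneral.

Section MPoly.
Context {C : numClosedFieldType}.

(** Characteristic zero: the coefficient at a monomial m with m i > 0 reappears in the i-th
    derivative times m i. *)
Lemma mderiv_eq0_const n (p : poly_in n C) :
  (forall i, mderiv i p = 0) -> p = mpolyC n (mcoeff mnm0 p).
Proof.
move=> dp; apply/mpolyP => m; rewrite mcoeffC.
have [->|m0] := eqVneq m mnm0; first by rewrite mulr1.
rewrite mulr0.
have [i mi] : exists i, m i != 0%N.
  apply: contrapT => /forallNP nm; case/eqP: m0; apply/mnmP => i.
  by rewrite mnm0E; have /negP := nm i; rewrite negbK => /eqP.
have := congr1 (mcoeff (mnm_sub m (mnm1 i))) (dp i).
rewrite mcoeff_mderiv mcoeff0 submK; last by rewrite lep1mP.
by move/eqP; rewrite mulrn_eq0 /= => /eqP.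
Qed.

Lemma mpoly_unitP n (p : poly_in n C) :
  reflect (exists2 c, c != 0 & p = mpolyC n c) (p \is a GRing.unit).
Proof.
apply: (iffP andP) => [[/eqP pE U]|[c c0 ->]].
  by exists (mcoeff mnm0 p) => //; rewrite -unitfE.
by rewrite mcoeffC eqxx mulr1 eqxx unitfE.
Qed.

(** * Polynomials viewed as polynomials in one chosen variable *)

Section LastVariable.
Context {n : nat} (y : 'I_n.+1).
Implicit Types (p : poly_in n.+1 C) (c : poly_in n C).

Definition split_var (i : 'I_n.+1) : {poly poly_in n C} :=
  if unlift y i is Some j then (mX j)%:P else 'X.

Definition to_poly : poly_in n.+1 C -> {poly poly_in n C} :=
  mmap (polyC \o @mpolyC n C) split_var.
HB.instance Definition _ := GRing.RMorphism.on to_poly.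

Definition widen_var : poly_in n C -> poly_in n.+1 C :=
  mmap (@mpolyC n.+1 C) (fun j => mX (lift y j)).
HB.instance Definition _ := GRing.RMorphism.on widen_var.

Definition of_poly : {poly poly_in n C} -> poly_in n.+1 C :=
  horner_eval (mX y) \o map_poly widen_var.
HB.instance Definition _ := GRing.RMorphism.on of_poly.

Lemma to_polyC a : to_poly (mpolyC _ a) = (mpolyC _ a)%:P.
Proof. by rewrite /to_poly mmapC. Qed.

Lemma to_polyX i : to_poly (mX i) = split_var i.
Proof. by rewrite /to_poly mmapX mmap1U. Qed.

Lemma widen_varC a : widen_var (mpolyC _ a) = mpolyC _ a.
Proof. by rewrite /widen_var mmapC. Qed.

Lemma widen_varX j : widen_var (mX j) = mX (lift y j).
Proof. by rewrite /widen_var mmapX mmap1U. Qed.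

Lemma of_polyC c : of_poly c%:P = widen_var c.
Proof. by rewrite /of_poly /= map_polyC /= /horner_eval hornerC. Qed.

Lemma of_polyX : of_poly 'X = mX y.
Proof. by rewrite /of_poly /= map_polyX /= /horner_eval hornerX. Qed.

Lemma to_polyK : cancel to_poly of_poly.
Proof.
apply: (@mpoly_rmorph_ext _ _ _ (of_poly \o to_poly) idfun) => [a|i] /=.
  by rewrite to_polyC of_polyC widen_varC.
rewrite to_polyX /split_var; case: unliftP => [j ->|->].
  by rewrite of_polyC widen_varX.
by rewrite of_polyX.
Qed.

Lemma to_poly_widen c : to_poly (widen_var c) = c%:P.
Proof.
apply: (@mpoly_rmorph_ext _ _ _ (to_poly \o widen_var) polyC) => [a|j] /=.
  by rewrite widen_varC to_polyC.
by rewrite widen_varX to_polyX /split_var liftK.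
Qed.

Lemma of_polyK : cancel of_poly to_poly.
Proof.
move=> q; rewrite -{2}[q]coefK poly_def -[q in LHS]coefK poly_def.
rewrite !rmorph_sum; apply: eq_bigr => i _.
rewrite -mul_polyC !rmorphM !rmorphXn /= of_polyC to_poly_widen of_polyX.
by rewrite to_polyX /split_var unlift_none.
Qed.

Lemma mderiv_widen c : mderiv y (widen_var c) = 0.
Proof.
have deriv0M (p q : poly_in n.+1 C) :
    mderiv y p = 0 -> mderiv y q = 0 -> mderiv y (p * q) = 0.
  by move=> dp dq; rewrite mderivM dp dq mul0r mulr0 addr0.
rewrite /widen_var /mmap raddf_sum; apply: big1 => m _.
apply: (deriv0M); first exact: mderivC.
rewrite /mmap1; elim/big_ind: _ => [||j _]; first by rewrite -mpolyC1 mderivC.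
  exact: deriv0M.
elim: (m j) => [|k IHk]; first by rewrite expr0 -mpolyC1 mderivC.
rewrite exprS; apply: deriv0M => //.
by rewrite mderivX mnm1E eq_sym (negbTE (neq_lift _ _)) scale0r.
Qed.

Lemma size_to_poly_gt1 p : mderiv y p != 0 -> (1 < size (to_poly p))%N.
Proof.
apply: contraNltn => /size1_polyC pE.
by rewrite -[p]to_polyK pE of_polyC mderiv_widen.
Qed.

Lemma meval_to_poly (v : 'I_n.+1 -> C) p :
  meval v p = (map_poly (meval (v \o lift y)) (to_poly p)).[v y].
Proof.
pose ev := [eta horner_eval (v y) \o map_poly (meval (v \o lift y)) \o to_poly].
apply: (@mpoly_rmorph_ext _ _ _ (meval v)
  (horner_eval (v y) \o map_poly (meval (v \o lift y)) \o to_poly)) => [a|i] /=.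
  by rewrite mevalC to_polyC map_polyC /= mevalC /horner_eval hornerC.
rewrite mevalXU to_polyX /split_var; case: unliftP => [j ->|->].
  by rewrite map_polyC /= mevalXU /horner_eval hornerC.
by rewrite map_polyX /horner_eval hornerX.
Qed.

Lemma of_polyD : {morph of_poly : p q / p + q}.
Proof. exact: rmorphD. Qed.

Lemma to_poly_multiplicative : multiplicative0 to_poly.
Proof. by split; [exact: rmorph0|exact: rmorph1|exact: rmorphM]. Qed.

Lemma of_poly_multiplicative : multiplicative0 of_poly.
Proof. by split; [exact: rmorph0|exact: rmorph1|exact: rmorphM]. Qed.

End LastVariable.
Opaque to_poly of_poly widen_var.

Lemma mpoly_ufd n : ufd (poly_in n C).
Proof.
elim: n => [|n IHn]; last first.
  exact: (ufd_iso (to_poly_multiplicative ord_max)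
    (of_poly_multiplicative ord_max) (to_polyK _) (of_polyK _) (poly_ufd IHn)).
have unit0 (p : poly_in 0 C) : p != 0 -> p \is a GRing.unit.
  move=> p0; apply/mpoly_unitP; exists (mcoeff mnm0 p).
    by apply: contraNneq p0 => p0; rewrite -[p]mpolyKC p0 mpolyC0.
  by rewrite mpolyKC.
split; first by exists (fun _ => 0%N) => // a a0 _; exact: unit0.
by move=> p [p0 /negP[]]; exact: unit0.
Qed.

Lemma meval_eq0 n (p : poly_in n C) : (forall v, meval v p = 0) -> p = 0.
Proof.
elim: n p => [|n IHn] p p0.
  by have := p0 (fun _ => 0); rewrite -[p]mpolyKC mevalC => ->; rewrite mpolyC0.
apply: (can_inj (to_polyK ord_max)); rewrite rmorph0.
apply/polyP => i; rewrite coef0; apply: IHn => w.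
set q := map_poly (meval w) (to_poly ord_max p).
have -> : meval w (to_poly ord_max p)`_i = q`_i by rewrite coef_map.
suff -> : q = 0 by rewrite coef0.
apply: contrapT => /eqP q0.
(* The first [size q] natural numbers are distinct in C and all are roots of q, one more than its
   degree allows. *)
pose s := [seq k%:R | k <- iota 0 (size q)] : seq C.
suff: (size s < size q)%N by rewrite size_map size_iota ltnn.
apply: max_poly_roots => //.
  apply/allP => x _; apply/rootP.
  pose v i := if unlift ord_max i is Some j then w j else x.
  rewrite -(p0 v) (meval_to_poly ord_max) /v unlift_none.
  congr (_.[_]); apply: eq_map_poly => c; apply: meval_eq => j /=.
  by rewrite liftK.
rewrite map_inj_uniq ?iota_uniq // => j k /eqP; rewrite eqr_nat => /eqP//.
Qed.

Lemma meval_neq0 n (p : poly_in n C) : p != 0 -> exists v, meval v p != 0.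
Proof.
move=> p0; apply: contrapT => /forallNP nv; case/eqP: p0.
by apply: meval_eq0 => v; have /negP := nv v; rewrite negbK => /eqP.
Qed.

Lemma irred_mderiv n (f : poly_in n C) : irred f -> exists y, mderiv y f != 0.
Proof.
move=> [f0 fU _]; apply: contrapT => /forallNP nd; move/negP: fU; apply.
have fE : f = mpolyC n (mcoeff mnm0 f).
  by apply: mderiv_eq0_const => i; have /negP := nd i; rewrite negbK => /eqP.
apply/mpoly_unitP; exists (mcoeff mnm0 f) => //.
by apply: contraNneq f0 => c0; rewrite fE c0 mpolyC0.
Qed.

Lemma msize_mderiv n (p : poly_in n C) y : p != 0 ->
  (mmeasure mdeg (mderiv y p) < mmeasure mdeg p)%N.
Proof.
move=> p0; have [->|dp0] := eqVneq (mderiv y p) 0.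
  by rewrite mmeasure0 lt0n mmeasure_poly_eq0.
rewrite -(mlead_deg dp0).
have /msize_mdeg_lt : mnm_add (mlead (mderiv y p)) (mnm1 y) \in msupp p.
  have := mlead_supp dp0; rewrite !mcoeff_msupp mcoeff_mderiv.
  by apply: contraNneq => ->; rewrite mul0rn.
by rewrite mdegD mdeg1 addn1.
Qed.

Lemma dvdr_msize n (p q : poly_in n C) : dvdr p q ->
  (mmeasure mdeg q < mmeasure mdeg p)%N -> q = 0.
Proof.
move=> [s ->]; have [->|s0] := eqVneq s 0; first by rewrite mul0r.
have [->|p0] := eqVneq p 0; first by rewrite mulr0.
rewrite msizeM // => lt.
have : mmeasure mdeg s != 0%N by rewrite mmeasure_poly_eq0.
move: lt; set a := mmeasure _ p; set b := mmeasure _ s; move: a b => a b. lia.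
Qed.

Lemma not_dvdr_mderiv n (f : poly_in n C) y : mderiv y f != 0 ->
  ~ dvdr f (mderiv y f).
Proof.
move=> fy /dvdr_msize dvd; case/eqP: (fy); apply: dvd; apply: msize_mderiv.
by apply: contraNneq fy => ->; rewrite mderiv0.
Qed.

(** Bezout in the variable y over the ring of the other variables; c plays the role of the resultant
    of f and g. *)
Lemma irred_elimination n (f g : poly_in n.+1 C) y :
  irred f -> mderiv y f != 0 -> ~ dvdr f g ->
  exists2 c : poly_in n C, c != 0 &
    exists a b, widen_var y c = a * f + b * g.
Proof.
move=> f_irr fy fg.
have [c c0 [a [b cE]]] := irred_bezout_iso (to_poly_multiplicative y)
  (of_poly_multiplicative y) (@of_polyD _ y) (to_polyK y) (of_polyK y)
  (mpoly_ufd n) f_irr (size_to_poly_gt1 fy) fg.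
by exists c => //; exists a, b; rewrite -cE of_polyC.
Qed.

(** Take the eliminant c in (f, g) and a point w of the other variables with c(w) nonzero: above w,
    a zero of f cannot be a zero of g. *)
Lemma irred_nullstellensatz n (f g : poly_in n C) : irred f -> ~ dvdr f g ->
  exists v, meval v f = 0 /\ meval v g != 0.
Proof.
case: n f g => [|n] f g f_irr fg.
  by have [[]] := irred_mderiv f_irr.
have [y fy] := irred_mderiv f_irr.
have [c c0 [a [b cE]]] := irred_elimination f_irr fy fg.
set F := to_poly y f; have sF : (1 < size F)%N := size_to_poly_gt1 fy.
(* The leading coefficient must survive at w too, so that f keeps its positive degree in y and has a
   root there. *)
have /meval_neq0[w] : c * lead_coef F != 0.
  by rewrite mulf_neq0 // lead_coef_eq0 -size_poly_gt0 ltnW.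
rewrite mevalM mulf_eq0 negb_or => /andP[cw lw].
have /closed_rootP[x /rootP x0] : size (map_poly (meval w) F) != 1%N.
  by rewrite size_map_poly_id0 // neq_ltn sF orbT.
pose v i := if unlift y i is Some j then w j else x.
have vlift : v \o lift y =1 w by move=> j; rewrite /v /= liftK.
have vy : v y = x by rewrite /v unlift_none.
have evE p : meval v p = (map_poly (meval w) (to_poly y p)).[x].
  rewrite (meval_to_poly y) vy; congr (_.[_]); apply: eq_map_poly => q.
  exact: meval_eq.
exists v; have fv : meval v f = 0 by rewrite evE.
split=> //; apply: contraNneq cw => gv.
have := congr1 (meval v) cE; rewrite mevalD !mevalM fv gv !mulr0 addr0.
by rewrite evE to_poly_widen map_polyC hornerC => ->.
Qed.

(** Taylor expansion at p: every iterated derivative of s lies in S and so vanishes at p. Induction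
    on the degree makes s constant, with value 0. *)
Lemma mderiv_stable_eq0 n (S : poly_in n C -> Prop) (p : 'I_n -> C) :
  (forall s i, S s -> S (mderiv i s)) -> (forall s, S s -> meval p s = 0) ->
  forall s, S s -> s = 0.
Proof.
move=> Sd Sp s; have [k] := ubnP (mmeasure mdeg s).
elim: k s => // k IHk s sk Ss; apply: contrapT => /eqP s0.
have ds i : mderiv i s = 0.
  by apply: IHk (Sd _ i Ss); rewrite (leq_trans (msize_mderiv i s0)).
have sE := mderiv_eq0_const ds.
by case/eqP: s0; move: (Sp s Ss); rewrite sE mevalC => ->; rewrite mpolyC0.
Qed.

End MPoly.

(** * Closed logarithmic one-forms *)

Section Residue.
Context {n : nat} {C : numClosedFieldType}.
Implicit Types (f a b k s t : poly_in n.+1 C).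

(* A derivation killing f, hence tangent to the hypersurface f = 0. *)
Definition tangent_deriv f (y l : 'I_n.+1) s :=
  mderiv y f * mderiv l s - mderiv l f * mderiv y s.

Lemma tangent_derivM f y l s t : tangent_deriv f y l (s * t) =
  tangent_deriv f y l s * t + s * tangent_deriv f y l t.
Proof. by rewrite /tangent_deriv !mderivM; ring. Qed.

Lemma tangent_derivD f y l s t : tangent_deriv f y l (s + t) =
  tangent_deriv f y l s + tangent_deriv f y l t.
Proof. by rewrite /tangent_deriv !mderivD; ring. Qed.

Lemma tangent_deriv_self f y l : tangent_deriv f y l f = 0.
Proof. by rewrite /tangent_deriv mulrC subrr. Qed.

(** The extra factor m replaces the exponent j - 1, so that j = 0 is covered by the same formula. *)
Lemma tangent_derivX f y l m j : tangent_deriv f y l (m ^+ j) * m =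
  j%:R * tangent_deriv f y l m * m ^+ j.
Proof.
elim: j => [|j IHj].
  by rewrite expr0 /tangent_deriv -mpolyC1 !mderivC; ring.
rewrite exprS tangent_derivM mulrDl -[m * _ * m]mulrA IHj -natr1; ring.
Qed.

(* If the rational function a / b is constant to first order along f = 0, it is
   constant there: the ideal of all s with (f_y b)^j s in (f, a - c b) is
   stable under the tangent derivations, so its elements free of the variable
   y vanish, and elimination forces f to divide a - c b. *)
Lemma locally_constant_ratio f a b y : irred f -> mderiv y f != 0 ->
  ~ dvdr f b ->
  (forall l, dvdr f (b * tangent_deriv f y l a - a * tangent_deriv f y l b)) ->
  exists c, dvdr f (a - mpolyC _ c * b).
Proof.
move=> f_irr fy fb dab; have primef := (mpoly_ufd n.+1).2 f f_irr.
have [|p [fp]] := @irred_nullstellensatz C n.+1 f (mderiv y f * b) f_irr.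
  by move=> /primef[/(not_dvdr_mderiv fy)|].
rewrite mevalM mulf_eq0 negb_or => /andP[fyp bp].
exists (meval p a / meval p b); set c := mpolyC _ _; set d := a - c * b.
have dp : meval p d = 0 by rewrite mevalB mevalM mevalC mulfVK // subrr.
have ddb l : dvdr f (b * tangent_deriv f y l d - d * tangent_deriv f y l b).
  have := dab l; congr (dvdr f _).
  by rewrite /d /tangent_deriv !(mderivB, mderiv_mulC); ring.
apply: contrapT => fd.
have [c0 c00 [al0 [be0 c0E]]] := irred_elimination f_irr fy fd.
pose m := mderiv y f * b.
pose J s := exists j al be, m ^+ j * s = al * f + be * d.
pose S s := J s /\ mderiv y s = 0.
have /(_ (widen_var y c0)) : forall s, S s -> s = 0.
  apply: (@mderiv_stable_eq0 _ _ S p) => [s l [[j [al [be E]]] sy]|].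
    split; last by rewrite mderiv_comm sy mderiv0.
    have [q qE] := ddb l.
    have := congr1 (tangent_deriv f y l) E.
    rewrite tangent_derivD !tangent_derivM tangent_deriv_self mulr0 addr0.
    have tX := tangent_derivX f y l m j.
    have -> : tangent_deriv f y l s = mderiv y f * mderiv l s.
      by rewrite /tangent_deriv sy mulr0 subr0.
    move: (tangent_deriv f y l) qE tX => t qE tX tE.
    (* The derivation t applied to m^j s = al f + be d yields m^j f_y times the l-th derivative of
       s. A factor b rewrites t d modulo f and d, a factor m absorbs t (m^j); together with f_y they
       raise the exponent by 2. *)
    exists j.+2, (b * (m * t al + mderiv y f * be * q - j%:R * t m * al)),
      (b * (m * t be + mderiv y f * be * t b - j%:R * t m * be)).
    have bE : b * t d = q * f + d * t b by rewrite -qE subrK.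
    have -> : m ^+ j.+2 * mderiv l s =
        b * m * (m ^+ j * (mderiv y f * mderiv l s)).
      by rewrite !exprS /m; ring.
    have -> : m ^+ j * (mderiv y f * mderiv l s) =
        t al * f + (t be * d + be * t d) - t (m ^+ j) * s by rewrite -tE; ring.
    have -> : b * m * (t al * f + (t be * d + be * t d) - t (m ^+ j) * s) =
        b * (m * t al * f + m * t be * d + mderiv y f * be * (b * t d) -
        t (m ^+ j) * m * s) by rewrite /m; ring.
    rewrite tX bE -[_ * m ^+ j * s]mulrA E; ring.
  move=> s [[j [al [be E]]] _]; have := congr1 (meval p) E.
  rewrite mevalD !mevalM rmorphXn /= mevalM fp dp !mulr0 addr0 => /eqP.
  by rewrite mulf_eq0 expf_eq0 mulf_eq0 (negbTE fyp) (negbTE bp) andbF /= => /eqP.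
move=> wc0; case/eqP: c00.
suff : to_poly y (widen_var y c0) = 0.
  by rewrite to_poly_widen => /eqP; rewrite polyC_eq0 => /eqP.
rewrite wc0 ?rmorph0 //; split; last exact: mderiv_widen.
by exists 0%N, al0, be0; rewrite expr0 mul1r.
Qed.

(** Closedness of eta / Delta read modulo f makes eta proportional to df along f = 0. The factor
    eta_y / (k f_y) is the residue, and the remaining part of closedness makes it constant along f =
    0. *)
Lemma closed_form_residue (Delta : poly_in n.+1 C)
    (eta : 'I_n.+1 -> poly_in n.+1 C) f k :
  irred f -> Delta = k * f -> ~ dvdr f k ->
  (forall l m, Delta * (mderiv l (eta m) - mderiv m (eta l)) =
     mderiv l Delta * eta m - mderiv m Delta * eta l) ->
  exists c, forall l, dvdr f (eta l - mpolyC _ c * (k * mderiv l f)).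
Proof.
move=> f_irr DE fk closed; have primef := (mpoly_ufd n.+1).2 f f_irr.
have f0 : f != 0 by case: f_irr.
have [y fy] := irred_mderiv f_irr.
have sE l : exists s, mderiv l f * eta y - mderiv y f * eta l = s * f /\
    k * (mderiv l (eta y) - mderiv y (eta l)) =
      mderiv l k * eta y - mderiv y k * eta l + k * s.
  have := closed l y; rewrite DE !mderivM => E.
  have /primef[//|[s s_E]] : dvdr f (k * (mderiv l f * eta y - mderiv y f * eta l)).
    exists (k * (mderiv l (eta y) - mderiv y (eta l)) -
            (mderiv l k * eta y - mderiv y k * eta l)).
    rewrite mulrBl.
    have -> : k * (mderiv l (eta y) - mderiv y (eta l)) * f =
        k * f * (mderiv l (eta y) - mderiv y (eta l)) by ring.
    by rewrite E; ring.
  exists s; split=> //; apply: (mulfI f0).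
  have -> : f * (k * (mderiv l (eta y) - mderiv y (eta l))) =
     k * f * (mderiv l (eta y) - mderiv y (eta l)) by ring.
  rewrite E; have -> : f * (mderiv l k * eta y - mderiv y k * eta l + k * s) =
    f * (mderiv l k * eta y - mderiv y k * eta l) + k * (s * f) by ring.
  by rewrite -s_E; ring.
have [||c cE] := @locally_constant_ratio f (eta y) (mderiv y f * k) y f_irr fy.
- by move=> /primef[/(not_dvdr_mderiv fy)|].
- move=> l; have [s [R1 R3]] := sE l.
  have := congr1 (mderiv y) R1; rewrite mderivB !mderivM => R2.
  exists ((mderiv y (mderiv y f) * k + mderiv y f * mderiv y k) * s -
          mderiv y f * k * mderiv y s).
  rewrite /tangent_deriv !mderivM.
  apply/eqP; rewrite -subr_eq0; apply/eqP.
  move: R1 R2 R3; rewrite -(mderiv_comm y l f).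
  set fl := mderiv l f; set fY := mderiv y f; set fly := mderiv l fY; set fyy := mderiv y fY.
  set e := eta y; set el := eta l; set ely := mderiv y el.
  set eyl := mderiv l e; set eyy := mderiv y e.
  set ky := mderiv y k; set kl := mderiv l k; set sy := mderiv y s.
  move=> R1 R2 R3.
  (* Elimination of second-order terms: closedness divided by f, the y-derivative of the
     proportionality relation, and that relation itself, with multipliers chosen so that the sum is
     the desired identity. Each bracket vanishes. *)
  transitivity (fY ^+ 2 * (k * (eyl - ely) - (kl * e - ky * el + k * s))
    - fY * k * (fly * e + fl * eyy - (fyy * el + fY * ely) - (sy * f + s * fY))
    + (fyy * k + fY * ky) * (fl * e - fY * el - s * f)).
    ring.
  by rewrite R1 R2 R3; ring.
(* Proportionality to df carries the congruence from the index y to every l, because f does not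
   divide f_y. *)
exists c => l; have [s [R1 _]] := sE l.
have /primef[/(not_dvdr_mderiv fy)//|//] :
   dvdr f (mderiv y f * (eta l - mpolyC n.+1 c * (k * mderiv l f))).
have -> : mderiv y f * (eta l - mpolyC n.+1 c * (k * mderiv l f)) =
    mderiv l f * (eta y - mpolyC n.+1 c * (mderiv y f * k)) -
    (mderiv l f * eta y - mderiv y f * eta l) by ring.
by rewrite R1; apply: dvdrB; apply: dvdr_mull => //; exact: dvdrr.
Qed.

(** Over the denominator Delta, [k i * mderiv l (f i)] is the l-th coefficient of df_i / f_i. The
    lemma is a partial fraction expansion in which the degree bound excludes a polynomial part. *)
Lemma closed_log_form (Delta : poly_in n.+1 C)
    (eta : 'I_n.+1 -> poly_in n.+1 C) (r : nat)
    (f k : 'I_r -> poly_in n.+1 C) :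
  Delta != 0 -> (forall i, irred (f i)) -> (forall i, Delta = k i * f i) ->
  (forall i, ~ dvdr (f i) (k i)) ->
  (forall i j, i != j -> ~ dvdr (f i) (f j)) ->
  (forall q, irred q -> dvdr q Delta -> exists i, dvdr (f i) q) ->
  (forall l, (mmeasure mdeg (eta l) < mmeasure mdeg Delta)%N) ->
  (forall l m, Delta * (mderiv l (eta m) - mderiv m (eta l)) =
     mderiv l Delta * eta m - mderiv m Delta * eta l) ->
  exists c : 'I_r -> C, forall l,
    eta l = \sum_i mpolyC _ (c i) * (k i * mderiv l (f i)).
Proof.
move=> D0 f_irr DE fk fdiff fact sz closed.
have primef i := (mpoly_ufd n.+1).2 _ (f_irr i).
have /choice[c cP] i : exists c, forall l,
    dvdr (f i) (eta l - mpolyC _ c * (k i * mderiv l (f i))).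
  exact: (closed_form_residue (f_irr i) (DE i) (fk i) closed).
exists c => l; apply/eqP; rewrite -subr_eq0; apply/eqP.
set zeta := _ - _.
have f_zeta i : dvdr (f i) zeta.
  rewrite /zeta (bigD1 i) //= opprD addrA; apply: dvdrB => //.
  apply: dvdr_sum => j ji; apply: dvdr_mull; apply: dvdr_mulr.
  have /primef[//|/fdiff[]] : dvdr (f i) (k j * f j).
    by rewrite -DE (DE i); apply: dvdr_mull; exact: dvdrr.
  by rewrite eq_sym.
apply: (@dvdr_msize _ _ Delta).
  (* Delta is squarefree: an irreducible factor q is a multiple of some f i, so q * q dividing Delta
     would leave a factor f i in k i. *)
  apply: (squarefree_dvdr (mpoly_ufd n.+1)) => // q q_irr qD.
    have [i [u qE]] := fact q q_irr qD; case=> d dE; case: (fk i).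
    exists (d * u * u); apply: (@mulIf _ (f i)); first by case: (f_irr i).
    by rewrite -DE dE qE; ring.
  have [i fq] := fact q q_irr qD; apply: (dvdr_trans _ (f_zeta i)).
  exact: (irred_dvdr (f_irr i)).
have lt_sz (I : Type) (s : seq I) (F : I -> poly_in n.+1 C) (m : nat) : (0 < m)%N ->
    (forall i, (mmeasure mdeg (F i) < m)%N) ->
    (mmeasure mdeg (\sum_(i <- s) F i) < m)%N.
  move=> m0 Fm; elim/big_ind: _ => [|u v um vm|i _]; rewrite ?mmeasure0 //.
  by rewrite (leq_ltn_trans (mmeasureD_le _ _ _)) // gtn_max um.
have D_gt0 : (0 < mmeasure mdeg Delta)%N by rewrite lt0n mmeasure_poly_eq0.
rewrite (leq_ltn_trans (mmeasureD_le _ _ _)) // gtn_max sz mmeasureN /=.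
apply: lt_sz => // i.
have [->|cf0] := eqVneq (mpolyC _ (c i) * (k i * mderiv l (f i))) 0.
  by rewrite mmeasure0.
move: cf0; rewrite !mulf_eq0 !negb_or mpolyC_eq0 => /and3P[ci0 ki0 fl0].
have fi0 : f i != 0 by case: (f_irr i).
rewrite mul_mpolyC mmeasureZ // (DE i) !msizeM //.
have := msize_mderiv l fi0.
have : mmeasure mdeg (k i) != 0%N by rewrite mmeasure_poly_eq0.
have : mmeasure mdeg (mderiv l (f i)) != 0%N by rewrite mmeasure_poly_eq0.
move: (mmeasure mdeg (k i)) (mmeasure _ (f i)) (mmeasure _ (mderiv _ _)); lia.
Qed.

End Residue.

(** * Linear frames and their discriminant *)

Section FractionFree.
Context {P : idomainType}.

Lemma fraction_repr (x : {fraction P}) :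
  exists a b : P, b != 0 /\ x * FracField.tofrac b = FracField.tofrac a.
Proof.
elim/generic_quotient.quotW: x => x; exists (frac x).1, (frac x).2; split.
  exact: denom_ratioP.
unlock FracField.tofrac; rewrite -[LHS]FracField.pi_mul.
apply/generic_quotient.eqmodP; rewrite /= FracField.equivfE /FracField.mulf /=.
rewrite !numden_Ratio ?(oner_neq0, mulr1, mul1r, denom_ratioP) //.
by rewrite mulrC.
Qed.

(** A kernel vector over the fraction field is multiplied by q, the product of the denominators of
    its entries. *)
Lemma fraction_free_kernel N m (A : 'M[P]_(N, m)) :
  (\rank (map_mx (@FracField.tofrac P) A) < m)%N ->
  exists2 a : 'cV[P]_m, a != 0 & A *m a = 0.
Proof.
set F := map_mx _ A => rk.
have [u u0 uF] : exists2 u : 'rV_m, u != 0 & u *m F^T = 0.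
  have : kermx F^T != 0 by rewrite kermx_eq0 /row_free mxrank_tr neq_ltn rk.
  by case/rowV0Pn => u /sub_kermxP uF u0; exists u.
have /choice[a] j : exists a, a.2 != 0 /\
    u 0 j * FracField.tofrac a.2 = FracField.tofrac a.1 :> {fraction P}.
  by have [a [b ab]] := fraction_repr (u 0 j); exists (a, b).
move=> aP; pose q := \prod_j (a j).2.
have q0 : q != 0 by apply/prodf_neq0 => j _; have [] := aP j.
pose v := \col_j ((a j).1 * \prod_(i | i != j) (a i).2).
have vE j : FracField.tofrac (v j 0) = FracField.tofrac q * u 0 j.
  have -> : q = (a j).2 * \prod_(i | i != j) (a i).2 by rewrite /q (bigD1 j).
  by rewrite mxE !tofracM -(aP j).2; ring.
have inj : injective (@FracField.tofrac P) by move=> x y /eqP; rewrite tofrac_eq => /eqP.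
exists v.
  have [j uj] : exists j, u 0 j != 0 by apply/rV0Pn.
  apply: contraNneq uj => v0; have := vE j.
  by rewrite v0 mxE tofrac0 => /esym/eqP; rewrite mulf_eq0 tofrac_eq0 (negbTE q0).
apply/matrixP => i k; rewrite ord1 !mxE; apply: inj; rewrite tofrac0 rmorph_sum /=.
under eq_bigr => j _ do rewrite tofracM vE.
have /matrixP/(_ 0 i) := uF; rewrite !mxE => uFi.
transitivity (FracField.tofrac q * \sum_j u 0 j * F^T j i); last by rewrite uFi mulr0.
by rewrite mulr_sumr; apply: eq_bigr => j _; rewrite !mxE; ring.
Qed.

Lemma det0_kernel N (A : 'M[P]_N) : \det A = 0 ->
  exists2 a : 'cV[P]_N, a != 0 & A *m a = 0.
Proof.
move=> A0; apply: fraction_free_kernel.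
rewrite ltn_neqAle rank_leq_row andbT; apply/negP => /eqP full.
have : map_mx (@FracField.tofrac P) A \in unitmx by rewrite -row_free_unit /row_free full.
by rewrite unitmxE det_map_mx A0 rmorph0 unitr0.
Qed.

End FractionFree.

Section LinearFrame.
Context {C : numClosedFieldType} {n m : nat}.
Variable B : 'I_m -> 'M[C]_n.+1.
Local Notation P := (poly_in n.+1 C).

Definition poly_mx : 'M[C]_n.+1 -> 'M[P]_n.+1 := map_mx (@mpolyC n.+1 C).

Definition generic_point : 'cV[P]_n.+1 := \col_i mpolyX _ (mnm1 i).

(** Saito's matrix, with the fields as columns. The number m of fields stays free because the
    equality m = n.+1 is proved with the help of this matrix. *)
Definition frame : 'M[P]_(n.+1, m) :=
  \matrix_(a, j) (poly_mx (B j) *m generic_point) a 0.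

Lemma poly_fun_frame v a j : poly_fun (frame a j) v = (B j *m v) a 0.
Proof.
rewrite /poly_fun !mxE rmorph_sum /=; apply: eq_bigr => b _.
by rewrite !mxE mevalM mevalC mevalXU.
Qed.

Lemma frame_eval v : map_mx (fun p => poly_fun p v) frame = \matrix_(a, j) (B j *m v) a 0.
Proof. by apply/matrixP => a j; rewrite mxE poly_fun_frame [RHS]mxE. Qed.

End LinearFrame.

(** * Zero sets of irreducible polynomials *)

Section PolyFun.
Context {C : numClosedFieldType} {n : nat}.
Implicit Types (p q : poly_in n C) (v : 'cV[C]_n).

Lemma poly_fun0 v : poly_fun (0 : poly_in n C) v = 0. Proof. exact: meval0. Qed.
Lemma poly_funC c v : poly_fun (mpolyC n c) v = c. Proof. exact: mevalC. Qed.
Lemma poly_funX i v : poly_fun (mpolyX C (mnm1 i)) v = v i 0.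
Proof. exact: mevalXU. Qed.
Lemma poly_funD p q v : poly_fun (p + q) v = poly_fun p v + poly_fun q v.
Proof. exact: mevalD. Qed.
Lemma poly_funB p q v : poly_fun (p - q) v = poly_fun p v - poly_fun q v.
Proof. exact: mevalB. Qed.
Lemma poly_funM p q v : poly_fun (p * q) v = poly_fun p v * poly_fun q v.
Proof. exact: mevalM. Qed.
Lemma poly_fun_sum (I : Type) (s : seq I) (Q : pred I) (F : I -> poly_in n C) v :
  poly_fun (\sum_(i <- s | Q i) F i) v = \sum_(i <- s | Q i) poly_fun (F i) v.
Proof. exact: rmorph_sum. Qed.
Lemma poly_fun_det N (A : 'M[poly_in n C]_N) v :
  poly_fun (\det A) v = \det (map_mx (fun p => poly_fun p v) A).
Proof. by rewrite /poly_fun -det_map_mx. Qed.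
Lemma poly_fun_adj N (A : 'M[poly_in n C]_N) v :
  map_mx (fun p => poly_fun p v) (\adj A) = \adj (map_mx (fun p => poly_fun p v) A).
Proof. by rewrite /poly_fun -map_mx_adj. Qed.

Lemma poly_fun_col (w : 'I_n -> C) p : poly_fun p (\col_i w i) = meval w p.
Proof. by apply: meval_eq => i; rewrite /vec_coord mxE. Qed.

Lemma poly_fun_eq0 p : (forall v, poly_fun p v = 0) -> p = 0.
Proof. by move=> p0; apply: meval_eq0 => w; rewrite -poly_fun_col. Qed.

Lemma poly_fun_neq0 p : p != 0 -> exists v, poly_fun p v != 0.
Proof. by move=> /meval_neq0[w]; rewrite -poly_fun_col; exists (\col_i w i). Qed.

Lemma irred_zero_set_sub p q : irred p ->
  (forall v, poly_fun p v = 0 -> poly_fun q v = 0) -> dvdr p q.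
Proof.
move=> p_irr pq; apply: contrapT => /(irred_nullstellensatz p_irr)[w [pw qw]].
by case/eqP: qw; rewrite -poly_fun_col pq // poly_fun_col.
Qed.

Lemma dvdr_zero_set p q v : dvdr p q -> poly_fun p v = 0 -> poly_fun q v = 0.
Proof. by move=> [s ->] pv; rewrite poly_funM pv mulr0. Qed.

(** If neither closed set contains p = 0, each has an equation that p does not divide. By primality
    p does not divide their product, and the Nullstellensatz gives a point of p = 0 outside both
    sets. *)
Lemma irred_zero_set_irreducible p : irred p ->
  zariski_irreducible (@vec_coord C n) [set v | poly_fun p v = 0].
Proof.
move=> p_irr; have [p0 pU _] := p_irr.
have point q : ~ dvdr p q -> exists v, poly_fun p v = 0 /\ poly_fun q v != 0.
  move=> /(irred_nullstellensatz p_irr)[w]; rewrite -!poly_fun_col => ?.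
  by exists (\col_i w i).
split.
  have [|v [pv _]] := point 1; last by exists v.
  by move/dvdr_unit => /(_ (unitr1 _)); apply/negP.
move=> _ _ [S1 ->] [S2 ->] cover; apply: contrapT => /not_orP[nS1 nS2].
have outside S : ~ [set v | poly_fun p v = 0] `<=` zero_locus (@vec_coord C n) S ->
    exists2 q, S q & ~ dvdr p q.
  move=> nS; apply: contrapT => nex; apply: nS => v /= pv q Sq.
  apply: (@dvdr_zero_set p) => //; apply: contrapT => npq.
  by apply: nex; exists q.
have [q1 S1q1 pq1] := outside _ nS1; have [q2 S2q2 pq2] := outside _ nS2.
have [|v [pv]] := point (q1 * q2).
  by move=> /((mpoly_ufd n).2 _ p_irr)[].
rewrite poly_funM mulf_eq0 negb_or => /andP[/eqP q1v /eqP q2v].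
by case: (cover v pv) => [/(_ _ S1q1)|/(_ _ S2q2)].
Qed.

(** For maximality: an irreducible closed set Z inside Delta = 0 lies in q = 0 for one irreducible
    q. If Z contains p = 0, then p divides q, so p and q are associated. *)
Lemma irred_factor_component (Delta p : poly_in n C) : Delta != 0 ->
  irred p -> dvdr p Delta ->
  irreducible_component (@vec_coord C n) [set v | poly_fun Delta v = 0]
    [set v | poly_fun p v = 0].
Proof.
move=> D0 p_irr pD.
have closed_zero q : zariski_closed (@vec_coord C n) [set v | poly_fun q v = 0].
  by exists [set q]; apply/seteqP; split=> [v /= qv _ ->|v zv] //; exact: zv.
split=> //; first exact: irred_zero_set_irreducible.
  by move=> v /=; exact: dvdr_zero_set.
move=> Z Zclosed [[v0 Zv0] Zirr] pZ ZD.
have main (a : poly_in n C) : a != 0 -> Z `<=` [set v | poly_fun a v = 0] ->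
    exists2 q, irred q & Z `<=` [set v | poly_fun q v = 0].
  move=> a0; elim/(ufd_ind (@mpoly_ufd C n)): a / a0 => [a aU|q a q_irr a0 IHa] Za.
    have := Za _ Zv0; move/mpoly_unitP: aU => [c c0 ->] /=.
    by rewrite poly_funC => /eqP; rewrite (negbTE c0).
  have [|Zq|/IHa//] := Zirr _ _ (closed_zero q) (closed_zero a).
    by move=> v /Za /= /eqP; rewrite poly_funM mulf_eq0 => /orP[]/eqP; [left|right].
  by exists q.
have [q q_irr Zq] := main _ D0 ZD.
have pq : dvdr p q by apply: irred_zero_set_sub => // v /pZ/Zq.
apply/seteqP; split=> // v /Zq /=; apply: dvdr_zero_set.
exact: irred_dvdr.
Qed.

End PolyFun.

(** * The basic relative invariants as the prime factors of an equation of D *)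

Section BasicInvariants.
Context {C : numClosedFieldType} {n : nat}.
Variables (D : set 'cV[C]_n.+1) (r : nat) (f : 'I_r -> poly_in n.+1 C).
Variable Delta : poly_in n.+1 C.
Hypotheses (Delta0 : Delta != 0) (DE : D = [set v | poly_fun Delta v = 0]).
Hypothesis fP : basic_relative_invariants D f.

Lemma basic_invariant_irred i : irred (f i).
Proof. by have [f_irr _ _] := fP; exact: f_irr. Qed.

Lemma basic_invariant_dvdr i : dvdr (f i) Delta.
Proof.
have [_ _ comp] := fP; have [_ +] := comp [set v | poly_fun (f i) v = 0].
move=> /(_ (ex_intro _ i erefl))[_ _ sub _].
by apply: (irred_zero_set_sub (basic_invariant_irred i)) => v /sub; rewrite DE.
Qed.

Lemma basic_invariant_neq i j : i != j -> ~ dvdr (f i) (f j).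
Proof.
move=> ij fij; have [_ inj _] := fP; case/eqP: ij; apply: inj.
apply/seteqP; split=> v /=; apply: dvdr_zero_set => //.
by apply: irred_dvdr fij; exact: basic_invariant_irred.
Qed.

Lemma basic_invariant_factor q : irred q -> dvdr q Delta -> exists i, dvdr (f i) q.
Proof.
move=> q_irr qD; have [_ _ comp] := fP.
have := irred_factor_component Delta0 q_irr qD; rewrite -DE => /comp[i qE].
exists i; apply: (irred_zero_set_sub (basic_invariant_irred i)) => v fv.
by have : [set v | poly_fun q v = 0] v by rewrite qE.
Qed.

End BasicInvariants.

Section Scaling.
Context {C : numClosedFieldType} {n : nat}.
Implicit Types (p : poly_in n C).

(** For fixed lambda, p(lambda x) and chi(lambda) p(x) agree as functions, hence coefficient by
    coefficient. *)
Lemma msupp_scaling p (chi : C -> C) :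
  (forall lambda v, lambda != 0 ->
     poly_fun p (lambda *: v) = chi lambda * poly_fun p v) ->
  forall m, m \in msupp p -> forall lambda, lambda != 0 ->
    chi lambda = lambda ^+ mdeg m.
Proof.
move=> scale k kp lambda l0.
pose q := \sum_(m <- msupp p) (mcoeff m p * lambda ^+ mdeg m) *: mpolyX C m.
have qE : q = chi lambda *: p.
  apply/eqP; rewrite -subr_eq0; apply/eqP/poly_fun_eq0 => v.
  rewrite poly_funB -mul_mpolyC poly_funM poly_funC -scale //.
  apply/eqP; rewrite subr_eq0 [in X in _ == X](mpolyE p) /q !poly_fun_sum.
  apply/eqP; apply: eq_bigr => m _.
  rewrite -!mul_mpolyC !poly_funM !poly_funC -mulrA; congr (_ * _).
  rewrite /poly_fun !mevalX mdegE -prodrXr -big_split /=.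
  by apply: eq_bigr => i _; rewrite /vec_coord !mxE exprMn.
have := congr1 (mcoeff k) qE; rewrite mcoeffZ /q raddf_sum /=.
rewrite (bigD1_seq k) ?msupp_uniq //= mcoeffZ mcoeffX eqxx mulr1 big1 => [|m mk].
  rewrite addr0 mulrC => /mulIf -> //; by rewrite -mcoeff_msupp.
by rewrite mcoeffZ mcoeffX (negbTE mk) mulr0.
Qed.

Lemma tdeg_scaling p (chi : C -> C) : p != 0 ->
  (forall lambda v, lambda != 0 ->
     poly_fun p (lambda *: v) = chi lambda * poly_fun p v) ->
  forall lambda, lambda != 0 -> chi lambda = lambda ^+ tdeg p.
Proof.
move=> p0 scale lambda l0; rewrite /tdeg -(mlead_deg p0) /=.
by apply: (msupp_scaling scale) => //; exact: mlead_supp.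
Qed.

Lemma exp2_inj (i j : nat) : 2%:R ^+ i = 2%:R ^+ j :> C -> i = j.
Proof. by rewrite -!natrX => /eqP; rewrite eqr_nat => /eqP/expnI; apply. Qed.

Lemma msize_scaling p d : p != 0 ->
  (forall lambda v, lambda != 0 ->
     poly_fun p (lambda *: v) = lambda ^+ d * poly_fun p v) ->
  mmeasure mdeg p = d.+1.
Proof.
move=> p0 scale; rewrite -(mlead_deg p0); congr _.+1; apply: exp2_inj.
by rewrite -(msupp_scaling scale) ?pnatr_eq0 //; exact: mlead_supp.
Qed.

End Scaling.

(** * The Maurer-Cartan equation with denominators cleared *)

Section MaurerCartan.
Context {C : numClosedFieldType} {n : nat}.
Variables (B : 'I_n.+1 -> 'M[C]_n.+1) (phi : 'I_n.+1 -> C).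
Local Notation P := (poly_in n.+1 C).
Local Notation M := (frame B).
Local Notation Delta := (\det M).
Local Notation polymx := (poly_mx (C := C) (n := n)).
Local Notation gp := (generic_point (C := C) (n := n)).

(* The closed one-form with value phi j on the j-th field of the frame,
   multiplied by the determinant of the frame. *)
Definition frame_form (l : 'I_n.+1) : P :=
  \sum_j mpolyC _ (phi j) * \adj M j l.

Lemma frame_scaling lambda (v : 'cV[C]_n.+1) :
  map_mx (fun p => poly_fun p (lambda *: v)) M =
  lambda *: map_mx (fun p => poly_fun p v) M.
Proof.
apply/matrixP => a j; rewrite [LHS]mxE [RHS]mxE [X in _ * X]mxE.
by rewrite !poly_fun_frame -scalemxAr mxE.
Qed.

Lemma det_frame_scaling lambda (v : 'cV[C]_n.+1) :
  poly_fun Delta (lambda *: v) = lambda ^+ n.+1 * poly_fun Delta v.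
Proof. by rewrite !poly_fun_det frame_scaling detZ. Qed.

Lemma msize_det_frame : Delta != 0 -> mmeasure mdeg Delta = n.+2.
Proof. by move=> D0; apply: msize_scaling => // l v _; exact: det_frame_scaling. Qed.

Lemma frame_form_scaling l lambda (v : 'cV[C]_n.+1) :
  poly_fun (frame_form l) (lambda *: v) = lambda ^+ n * poly_fun (frame_form l) v.
Proof.
rewrite /frame_form !poly_fun_sum mulr_sumr; apply: eq_bigr => j _.
rewrite !poly_funM !poly_funC mulrCA; congr (_ * _).
have E u : poly_fun (\adj M j l) u = \adj (map_mx (fun p => poly_fun p u) M) j l.
  by rewrite -poly_fun_adj [RHS]mxE.
by rewrite !E frame_scaling adjZ [LHS]mxE.
Qed.

Lemma msize_frame_form l : Delta != 0 ->
  (mmeasure mdeg (frame_form l) < mmeasure mdeg Delta)%N.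
Proof.
move=> D0; rewrite msize_det_frame //.
have [->|f0] := eqVneq (frame_form l) 0; first by rewrite mmeasure0.
by rewrite (@msize_scaling _ _ _ n) // => a v _; exact: frame_form_scaling.
Qed.

Lemma frame_formP j : \sum_l frame_form l * M l j = mpolyC _ (phi j) * Delta.
Proof.
transitivity (\sum_i mpolyC n.+1 (phi i) * (\adj M *m M) i j).
  under eq_bigr => l _ do rewrite /frame_form mulr_suml.
  rewrite exchange_big; apply: eq_bigr => i _ /=.
  by rewrite [in RHS]mxE mulr_sumr; apply: eq_bigr => l _; rewrite mulrA.
rewrite mul_adj_mx (bigD1 j) //= !mxE eqxx mulr1n big1 ?addr0 // => i ij.
by rewrite !mxE (negbTE ij) mulr0n mulr0.
Qed.

Hypothesis bracket : forall i j, exists2 g : 'I_n.+1 -> C,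
  B i *m B j - B j *m B i = \sum_k g k *: B k & \sum_k g k * phi k = 0.

Let dmx l N1 N2 (A : 'M[P]_(N1, N2)) := map_mx (mderiv l) A.

Let dmxM l N1 N2 N3 (A : 'M[P]_(N1, N2)) (A' : 'M[P]_(N2, N3)) :
  dmx l (A *m A') = dmx l A *m A' + A *m dmx l A'.
Proof.
apply/matrixP => i j; rewrite !mxE raddf_sum -big_split /=.
by apply: eq_bigr => k _; rewrite !mxE mderivM.
Qed.

Let phirow : 'rV[P]_n.+1 := \row_j mpolyC _ (phi j).
(* the linear field of the Lie algebra whose value at the generic point is
   Delta times the l-th coordinate vector *)
Let X l : 'M[P]_n.+1 := \sum_j \adj M j l *: polymx (B j).
Let e l : 'cV[P]_n.+1 := delta_mx l 0.

Let frame_col j : col j M = polymx (B j) *m gp.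
Proof. by apply/matrixP => a b; rewrite ord1 !mxE. Qed.

Let col_mulmx N1 N2 N3 (A : 'M[P]_(N1, N2)) (A' : 'M[P]_(N2, N3)) j :
  col j (A *m A') = A *m col j A'.
Proof. by apply/matrixP => i k; rewrite !mxE; apply: eq_bigr => s _; rewrite mxE. Qed.

Let scalemxE N1 N2 c (A : 'M[P]_(N1, N2)) i j : (c *: A) i j = c * A i j.
Proof. by rewrite mxE. Qed.

Let X_gp l : X l *m gp = Delta *: e l.
Proof.
rewrite /X mulmx_suml.
transitivity (M *m col l (\adj M)).
  apply/matrixP => a b; rewrite ord1 summxE [RHS]mxE; apply: eq_bigr => j _.
  by rewrite -scalemxAl -frame_col !mxE mulrC.
rewrite -col_mulmx mul_mx_adj; apply/matrixP => a b.
by rewrite ord1 !mxE eqxx andbT mulr_natr.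
Qed.

Let dX l : dmx l gp = e l.
Proof.
apply/matrixP => a b; rewrite ord1 !mxE mderivX mnm1E eqxx andbT.
have [->|al] := eqVneq a l; last by rewrite scale0r.
rewrite scale1r (_ : mnm_sub _ _ = mnm0) ?mpolyX0 //.
by apply/mnmP => i; rewrite mnmBE subnn mnm0E.
Qed.

Let dpolymx l (A : 'M[C]_n.+1) : dmx l (polymx A) = 0.
Proof. by apply/matrixP => a b; rewrite !mxE mderivC. Qed.

Let dframe_adj l m : col m (dmx l M *m \adj M) = X m *m e l.
Proof.
rewrite /X mulmx_suml col_mulmx; apply/matrixP => a b.
rewrite ord1 summxE mxE; apply: eq_bigr => j _.
have -> : dmx l M a j = (polymx (B j) *m e l) a 0.
  have := dmxM l (polymx (B j)) gp; rewrite dpolymx mul0mx add0r dX => <-.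
  by rewrite [LHS]mxE [M _ _]mxE [RHS]mxE.
by rewrite -scalemxAl !mxE mulrC.
Qed.

(** The coefficients [\adj M] factor out of the matrix products, so the commutator expands in the
    brackets of the B i. Pairing with [phirow *m \adj M] turns B k at the generic point into phi k
    times Delta, and phi kills brackets. *)
Let bracket_X l m :
  (phirow *m \adj M *m (X m *m X l - X l *m X m) *m gp) 0 0 = 0.
Proof.
have -> : X m *m X l - X l *m X m = \sum_i \sum_j
    (\adj M i m * \adj M j l) *: polymx (B i *m B j - B j *m B i).
  rewrite /X mulmx_suml [X in _ - X]mulmx_suml.
  rewrite [X in _ - X](eq_bigr (fun j => \sum_i (\adj M i m * \adj M j l) *:
     polymx (B j *m B i))); last first.
    move=> j _; rewrite mulmx_sumr; apply: eq_bigr => i _.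
    by rewrite -scalemxAl -scalemxAr scalerA /polymx map_mxM mulrC.
  rewrite [X in _ - X]exchange_big -sumrB; apply: eq_bigr => i _ /=.
  rewrite mulmx_sumr -sumrB; apply: eq_bigr => j _.
  by rewrite -scalemxAl -scalemxAr scalerA /polymx map_mxB -map_mxM scalerBr.
rewrite mulmx_sumr mulmx_suml summxE big1 // => i _.
rewrite mulmx_sumr mulmx_suml summxE big1 // => j _.
rewrite -scalemxAr -scalemxAl mxE.
suff -> : (phirow *m \adj M *m polymx (B i *m B j - B j *m B i) *m gp) 0 0 = 0.
  by rewrite mulr0.
have [g -> gphi] := bracket i j.
have -> : polymx (\sum_k g k *: B k) = \sum_k mpolyC _ (g k) *: polymx (B k).
  by rewrite /poly_mx raddf_sum; apply: eq_bigr => k _;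
     apply/matrixP => a b; rewrite !mxE; exact: mpolyCM.
rewrite mulmx_sumr mulmx_suml summxE.
transitivity (\sum_k mpolyC n.+1 (g k * phi k) * Delta); last first.
  by rewrite -mulr_suml -rmorph_sum gphi rmorph0 mul0r.
apply: eq_bigr => k _; rewrite -scalemxAr -scalemxAl mxE -mulmxA -frame_col.
rewrite -mulmxA -col_mulmx mul_adj_mx rmorphM -mulrA; congr (_ * _).
rewrite mxE (bigD1 k) //= !mxE eqxx mulr1n big1 ?addr0 // => s sk.
by rewrite !mxE (negbTE sk) mulr0n mulr0.
Qed.

(** Differentiating [M *m \adj M = Delta%:M] expresses Delta times the a-th derivative of the b-th
    coefficient through X b applied to e a. Replacing Delta e a by X a at the generic point reduces
    the symmetry in a and b to the vanishing of phi on brackets. *)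
Lemma frame_form_closed l m : Delta != 0 ->
  Delta * (mderiv l (frame_form m) - mderiv m (frame_form l)) =
  mderiv l Delta * frame_form m - mderiv m Delta * frame_form l.
Proof.
move=> D0.
have etaE a : frame_form a = (phirow *m \adj M) 0 a.
  by rewrite mxE; apply: eq_bigr => j _; rewrite [phirow _ _]mxE.
have main a b : Delta * mderiv a (frame_form b) =
    mderiv a Delta * frame_form b - (phirow *m \adj M *m (X b *m e a)) 0 0.
  have := dmxM a M (\adj M); rewrite mul_mx_adj => /(congr1 (mulmx (\adj M))).
  rewrite mulmxDr [in X in _ = _ + X]mulmxA mul_adj_mx mul_scalar_mx.
  have -> : dmx a (Delta%:M : 'M[P]_n.+1) = (mderiv a Delta)%:M :> 'M[P]_n.+1.
    by apply/matrixP => i j; rewrite !mxE mderivMn.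
  rewrite mul_mx_scalar => /(congr1 (mulmx phirow))/matrixP/(_ 0 b).
  rewrite mulmxDr [RHS]mxE -!scalemxAr !scalemxE -etaE => ->.
  have -> : (phirow *m dmx a (\adj M)) 0 b = mderiv a (frame_form b).
    rewrite etaE; have := dmxM a phirow (\adj M).
    have -> : dmx a phirow = 0 by apply/matrixP => i j; rewrite !mxE mderivC.
    by rewrite mul0mx add0r => <-; rewrite [LHS]mxE.
  rewrite -dframe_adj -col_mulmx !mulmxA.
  by rewrite [in X in _ - X]mxE addrAC subrr add0r.
have gpE a b : Delta * (phirow *m \adj M *m (X a *m e b)) 0 0 =
    (phirow *m \adj M *m (X a *m X b) *m gp) 0 0.
  by rewrite -scalemxE !scalemxAr -X_gp !mulmxA.
have XX : (phirow *m \adj M *m (X m *m e l)) 0 0 =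
          (phirow *m \adj M *m (X l *m e m)) 0 0.
  apply: (mulfI D0); rewrite !gpE; apply/eqP; rewrite -subr_eq0; apply/eqP.
  by rewrite -[RHS](bracket_X l m) mulmxBr mulmxBl [RHS]mxE [X in _ = _ + X]mxE.
by rewrite mulrBr !main XX; ring.
Qed.

End MaurerCartan.

(** * Differentiation along curves *)

Section Convergence.
Context {K : numFieldType} {T : Type} {F : set_system T} {FF : Filter F}.

Lemma cvg_bigD (I : Type) (s : seq I) (f : I -> T -> K) (l : I -> K) :
  (forall i, f i t @[t --> F] --> l i) ->
  (\sum_(i <- s) f i t) @[t --> F] --> \sum_(i <- s) l i.
Proof.
move=> fl; elim: s => [|i s IHs].
  by rewrite big_nil; under eq_fun do rewrite big_nil; exact: cvg_cst.
by rewrite big_cons; under eq_fun do rewrite big_cons; exact: cvgD.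
Qed.

Lemma cvg_bigM (I : Type) (s : seq I) (f : I -> T -> K) (l : I -> K) :
  (forall i, f i t @[t --> F] --> l i) ->
  (\prod_(i <- s) f i t) @[t --> F] --> \prod_(i <- s) l i.
Proof.
move=> fl; elim: s => [|i s IHs].
  by rewrite big_nil; under eq_fun do rewrite big_nil; exact: cvg_cst.
by rewrite big_cons; under eq_fun do rewrite big_cons; exact: cvgM.
Qed.

Lemma cvg_pow (f : T -> K) (l : K) k : f t @[t --> F] --> l ->
  (f t ^+ k) @[t --> F] --> l ^+ k.
Proof.
move=> fl; elim: k => [|k IHk].
  by rewrite expr0; under eq_fun do rewrite expr0; exact: cvg_cst.
by rewrite exprS; under eq_fun do rewrite exprS; exact: cvgM.
Qed.

Lemma cvg_mxP m n (f : T -> 'M[K]_(m, n)) (l : 'M[K]_(m, n)) :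
  f t @[t --> F] --> l <-> forall i j, f t i j @[t --> F] --> l i j.
Proof.
split=> [fl i j|fl].
  by apply: (cvg_comp f (fun M : 'M[K]_(m, n) => M i j) fl); exact: coord_continuous.
move=> A [P lP PA].
have : \forall t \near F, forall ij : 'I_m * 'I_n, P ij.1 ij.2 (f t ij.1 ij.2).
  by apply: filter_forall => -[i j]; exact: (fl i j _ (lP i j)).
by apply: filterS => t Pt; apply: PA => i j; exact: (Pt (i, j)).
Qed.

Lemma cvg_mulmx m n p (f : T -> 'M[K]_(m, n)) (g : T -> 'M[K]_(n, p))
    (a : 'M[K]_(m, n)) (b : 'M[K]_(n, p)) :
  f t @[t --> F] --> a -> g t @[t --> F] --> b ->
  (f t *m g t) @[t --> F] --> a *m b.
Proof.
move=> /cvg_mxP fa /cvg_mxP gb; apply/cvg_mxP => i j.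
rewrite mxE; under eq_fun do rewrite mxE.
by apply: cvg_bigD => k; apply: cvgM.
Qed.

Lemma cvg_det n (f : T -> 'M[K]_n) (a : 'M[K]_n) : f t @[t --> F] --> a ->
  (\det (f t)) @[t --> F] --> \det a.
Proof.
move=> /cvg_mxP fa; apply: cvg_bigD => s.
by apply: cvgM; [exact: cvg_cst|apply: cvg_bigM => i].
Qed.

Lemma cvg_meval n (x : T -> 'I_n -> K) (y : 'I_n -> K) (p : mpoly n K) :
  (forall i, x t i @[t --> F] --> y i) ->
  (meval (x t) p) @[t --> F] --> meval y p.
Proof.
move=> xy; rewrite mevalE; under eq_fun do rewrite mevalE.
apply: cvg_bigD => m; apply: cvgM; first exact: cvg_cst.
by apply: cvg_bigM => i; apply: cvg_pow.
Qed.

End Convergence.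

Section Differentiation.
Context {K : numFieldType}.
Implicit Types (V W : normedModType K).

Lemma cvg_at_unique {W} (T : Type) (F : set_system T) {FF : ProperFilter F}
  (f : T -> W) (a b : W) : f t @[t --> F] --> a -> f t @[t --> F] --> b -> a = b.
Proof. by apply: cvg_unique; exact: norm_hausdorff. Qed.

Lemma is_derive_cvg {V W} (f : V -> W) a v d : is_derive a v f d <->
  (h^-1 *: (f (h *: v + a) - f a)) @[h --> (0 : K)^'] --> d.
Proof.
split=> [[fav <-]|fd]; first exact: fav.
by split; [apply/cvg_ex; exists d|exact: (cvg_lim (@norm_hausdorff _ _) fd)].
Qed.

Lemma is_derive_curve {W} (c : K -> W) w : is_derive (0 : K) (1 : K) c w <->
  (h^-1 *: (c h - c 0)) @[h --> (0 : K)^'] --> w.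
Proof.
rewrite is_derive_cvg.
suff -> : (fun h : K => h^-1 *: (c (h *: 1 + 0) - c 0)) =
  (fun h => h^-1 *: (c h - c 0)) by [].
by apply/funext => h; rewrite addr0 [h *: _]mulr1.
Qed.

Lemma is_derive_unique {V W} (f : V -> W) a v d1 d2 :
  is_derive a v f d1 -> is_derive a v f d2 -> d1 = d2.
Proof. by move=> [_ <-] [_ <-]. Qed.

Lemma is_derive_mx {V} m n (f : V -> 'M[K]_(m, n)) a v d :
  is_derive a v f d <-> forall i j, is_derive a v (fun x => f x i j) (d i j).
Proof.
rewrite is_derive_cvg cvg_mxP; split=> fd i j.
  by apply/is_derive_cvg; have := fd i j; under eq_fun do rewrite !mxE.
by have /is_derive_cvg := fd i j; under [X in X @ _ --> _ -> _]eq_fun do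
  rewrite -[_ *: _]/(_ * _); under [X in _ -> X @ _ --> _]eq_fun do rewrite !mxE.
Qed.

Lemma differentiable_mx {V} m n (f : V -> 'M[K]_(m, n)) a :
  (forall i j, differentiable (fun x => f x i j) a) -> differentiable f a.
Proof.
move=> df.
have -> : f = \sum_(i < m) \sum_(j < n) (fun x => f x i j *: delta_mx i j).
  apply/funext => x; rewrite fct_sumE [LHS]matrix_sum_delta.
  by apply: eq_bigr => i _; rewrite fct_sumE.
by do 2![apply: differentiable_sum => ?]; apply: differentiableZl.
Qed.

Lemma is_derive_comp_curve {V W} (c : K -> V) w (h : V -> W) :
  is_derive (0 : K) (1 : K) c w -> differentiable h (c 0) ->
  is_derive (0 : K) (1 : K) (h \o c) ('D_w h (c 0)).
Proof.
move=> [dc cw] dh; have dc' : differentiable c 0 by apply/derivable1_diffP.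
have dhc : differentiable (h \o c) 0 by exact: differentiable_comp.
split; first exact/derivable1_diffP.
by rewrite deriveE // diff_comp //= deriveE // -[in RHS]cw deriveE.
Qed.

Lemma derive_along_constant_curve {V W} (c : K -> V) w (h : V -> W) a :
  is_derive (0 : K) (1 : K) c w -> differentiable h (c 0) ->
  (\forall t \near (0 : K), h (c t) = a) -> 'D_w h (c 0) = 0.
Proof.
move=> dc dh ha; apply: is_derive_unique (is_derive_comp_curve dc dh) _.
by apply: near_eq_is_derive (is_derive_cst a _ _); apply: filterS ha => t /= ->.
Qed.

Lemma is_derive_line {V} (v w : V) :
  is_derive (0 : K) (1 : K) (fun t => v + t *: w) w.
Proof.
apply/is_derive_curve; apply: cvg_near_cst.
near=> h; rewrite scale0r addr0 addrAC subrr add0r scalerA mulVf ?scale1r //.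
by near: h; exact: nbhs_dnbhs_neq.
Unshelve. all: by end_near. Qed.

Lemma is_derive_mulmx_curve m n p (c : K -> 'M[K]_(m, n)) (d : K -> 'M[K]_(n, p)) c' d' :
  is_derive (0 : K) (1 : K) c c' -> is_derive (0 : K) (1 : K) d d' ->
  is_derive (0 : K) (1 : K) (fun t => c t *m d t) (c' *m d 0 + c 0 *m d').
Proof.
move=> dc dd; apply/is_derive_mx => i j.
have -> : (fun t => (c t *m d t) i j) =
    \sum_(k < n) (fun t => c t i k * d t k j).
  by apply/funext => t; rewrite mxE fct_sumE.
have -> : (c' *m d 0 + c 0 *m d') i j =
   \sum_(k < n) (c 0 i k *: d' k j + d 0 k j *: c' i k).
  rewrite !mxE -big_split; apply: eq_bigr => k _ /=.
  by rewrite addrC; congr (_ + _); rewrite mulrC.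
apply: is_derive_sum => k.
apply: is_deriveM; first by move/is_derive_mx : dc.
by move/is_derive_mx : dd.
Qed.

Lemma is_derive_cst_curve {W} (w : W) : is_derive (0 : K) (1 : K) (fun=> w) 0.
Proof. exact: is_derive_cst. Qed.

Lemma is_derive_curve_scale {W} (c : K -> W) w a : is_derive (0 : K) (1 : K) c w ->
  is_derive (0 : K) (1 : K) (fun t => c (a * t)) (a *: w).
Proof.
move=> dc; pose l (t : K) : K := 0 + t *: a.
have dl : is_derive (0 : K) (1 : K) l a by exact: is_derive_line.
have c0 : differentiable c (l 0).
  by rewrite /l add0r scale0r; apply/derivable1_diffP; case: dc.
have E : 'D_a c (l 0) = a *: w.
  rewrite deriveE //; rewrite /l add0r scale0r in c0 *.
  by rewrite -{1}[a]mulr1 [LHS]linearZ -deriveE //; case: dc => _ ->.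
have := is_derive_comp_curve dl c0; rewrite E.
by have -> : c \o l = fun t => c (a * t) by apply/funext => t; rewrite /l /= add0r mulrC.
Qed.

End Differentiation.

Section PolyDifferential.
Context {C : numClosedFieldType} {n : nat}.
Implicit Types (p : poly_in n C) (v w : 'cV[C]_n).

Lemma poly_fun_differentiable p v : differentiable (poly_fun p) v.
Proof.
have coord i : differentiable (fun u : 'cV[C]_n => u i 0) v.
  exact: differentiable_coord.
elim/mpolyind: p => [|c m p _ _ IHp].
  have -> : poly_fun (0 : poly_in n C) = cst 0 by apply/funext => u; exact: poly_fun0.
  exact: differentiable_cst.
have -> : poly_fun (c *: mpolyX C m + p) =
   (fun u : 'cV[C]_n => c * \prod_i u i 0 ^+ m i) + poly_fun p.
  apply/funext => u; rewrite poly_funD -mul_mpolyC poly_funM poly_funC.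
  by rewrite /poly_fun mevalX.
apply: differentiableD => //.
apply: (@differentiableZ _ _ _ (fun u : 'cV[C]_n => \prod_i u i 0 ^+ m i) c).
elim: (index_enum _) => [|i s IHs].
  by under eq_fun do rewrite big_nil; exact: differentiable_cst.
under eq_fun do rewrite big_cons.
apply: differentiableM => //; elim: (m i) => [|k IHk].
  by under eq_fun do rewrite expr0; exact: differentiable_cst.
by under eq_fun do rewrite exprS; exact: differentiableM.
Qed.

(** Both sides are derivations in p, so constants and coordinates decide. *)
Lemma derive_poly_fun p v w :
  'D_w (poly_fun p) v = \sum_i poly_fun (mderiv i p) v * w i 0.
Proof.
have dp q := poly_fun_differentiable q v.
pose S q := 'D_w (poly_fun q) v = \sum_i poly_fun (mderiv i q) v * w i 0.
have SC c : S (mpolyC n c).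
  rewrite /S; have -> : poly_fun (mpolyC n c) = cst c.
    by apply/funext => u; exact: poly_funC.
  rewrite derive_cst big1 // => i _; by rewrite mderivC poly_fun0 mul0r.
have SD q s : S q -> S s -> S (q + s).
  move=> Sq Ss; rewrite /S; have -> : poly_fun (q + s) = poly_fun q + poly_fun s.
    by apply/funext => u; exact: poly_funD.
  rewrite deriveD; [|exact: diff_derivable..].
  rewrite Sq Ss -big_split; apply: eq_bigr => i _.
  by rewrite mderivD poly_funD mulrDl.
have SM q s : S q -> S s -> S (q * s).
  move=> Sq Ss; rewrite /S; have -> : poly_fun (q * s) = poly_fun q * poly_fun s.
    by apply/funext => u; exact: poly_funM.
  rewrite deriveM; [|exact: diff_derivable..].
  rewrite Sq Ss /GRing.scale /= !mulr_sumr -big_split; apply: eq_bigr => i _ /=.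
  by rewrite mderivM poly_funD !poly_funM; ring.
have SX i : S (mpolyX C (mnm1 i)).
  rewrite /S; have -> : poly_fun (mpolyX C (mnm1 i)) = fun u : 'cV[C]_n => u i 0.
    by apply/funext => u; exact: poly_funX.
  have -> : 'D_w (fun u : 'cV[C]_n => u i 0) v = w i 0.
    apply: (@derive_val _ _ _ v w); apply/is_derive_cvg; apply: cvg_near_cst.
    near=> h; rewrite !mxE addrK -[_ *: _]/(_ * _) mulrA mulVf ?mul1r //.
    by near: h; exact: nbhs_dnbhs_neq.
  rewrite (bigD1 i) //= big1 => [|j ji].
    rewrite mderivX mnm1E eqxx scale1r addr0 (_ : mnm_sub _ _ = mnm0).
      by rewrite mpolyX0 -mpolyC1 poly_funC mul1r.
    by apply/mnmP => k; rewrite mnmBE subnn mnm0E.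
  by rewrite mderivX mnm1E eq_sym (negbTE ji) scale0r poly_fun0 mul0r.
have SXm m : S (mpolyX C m).
  rewrite mpolyXE_id; elim/big_ind: _ => // [|i _]; first by rewrite -mpolyC1.
  by elim: (m i) => [|k IHk]; rewrite ?expr0 -?mpolyC1 // exprS; exact: SM.
rewrite -/(S p); elim/mpolyind: p => [|c m p _ _ IHp]; first by rewrite -mpolyC0.
by apply: SD => //; rewrite -mul_mpolyC; exact: SM.
Unshelve. all: by end_near. Qed.

End PolyDifferential.

(** * The matrix exponential *)

Section ComplexConvergence.
Context {R : realType}.
Local Notation C := (Cplx R).
Local Notation nrm := (@Normc.normc R).
Local Notation "x %:C" := (real_complex R x : C).

Lemma norm_normc (z : C) : `|z| = (nrm z)%:C.
Proof. by []. Qed.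

Lemma normc_ge0 (z : C) : 0 <= nrm z.
Proof. by case: z => a b /=; exact: sqrtr_ge0. Qed.

Lemma normcD (z w : C) : nrm (z + w) <= nrm z + nrm w.
Proof. exact: le_normcD. Qed.

Lemma normc_opp (z : C) : nrm (- z) = nrm z.
Proof. exact: normcN. Qed.

Lemma normcBC (z w : C) : nrm (z - w) = nrm (w - z).
Proof. by rewrite -normc_opp opprB. Qed.

Lemma normc_triangle (y x z : C) : nrm (x - z) <= nrm (x - y) + nrm (y - z).
Proof. by rewrite -[X in X - z](subrK y) -addrA; exact: normcD. Qed.

Lemma normc_real (x : R) : nrm x%:C = `|x|.
Proof. by rewrite /= expr0n addr0 sqrtr_sqr. Qed.

Lemma normc_sum (I : Type) (s : seq I) (F : I -> C) (G : I -> R) :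
  (forall i, nrm (F i) <= G i) -> nrm (\sum_(i <- s) F i) <= \sum_(i <- s) G i.
Proof.
move=> FG; elim/big_ind2: _ => [|x1 y1 x2 y2 xy1 xy2|i _ //].
  by rewrite Normc.normc0.
exact: le_trans (normcD _ _) (lerD xy1 xy2).
Qed.

(** The norm of C takes values in C itself, but a positive complex number is real, so real bounds e
    suffice. *)
Lemma cvg_normcP (T : Type) (F : set_system T) {FF : Filter F} (f : T -> C) (l : C) :
  f t @[t --> F] --> l <->
  forall e : R, 0 < e -> \forall t \near F, nrm (l - f t) < e.
Proof.
split=> [/cvgrPdist_lt fl e e0|fl].
  have := fl e%:C; rewrite ltcR => /(_ e0); apply: filterS => t.
  by rewrite norm_normc ltcR.
apply/cvgrPdist_lt => -[e i]; rewrite ltcE /= => /andP[/eqP -> e0].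
by have := fl e e0; apply: filterS => t; rewrite norm_normc -[Complex e 0]/(e%:C) ltcR.
Qed.

Lemma cvg_real_complex (x : nat -> R) (l : R) :
  x @ \oo --> l -> ((x k)%:C : C) @[k --> \oo] --> (l%:C : C).
Proof.
move=> /cvgrPdist_lt xl; apply/cvg_normcP => e e0.
have := xl e e0; apply: filterS => k.
by rewrite -rmorphB normc_real.
Qed.

Lemma complex_cvgn_series (u : nat -> C) (a : nat -> R) :
  (forall k, nrm (u k) <= a k) -> cvgn (series a) -> cvgn (series u).
Proof.
move=> ua ca.
have part (v : nat -> R) : (forall k, `|v k| <= a k) -> cvgn (series v).
  move=> va; apply: normed_cvg; apply: series_le_cvg va ca => k.
    exact: normr_ge0.
  exact: le_trans (normc_ge0 _) (ua k).
have ReIm (z : C) : `|complex.Re z| <= nrm z /\ `|complex.Im z| <= nrm z.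
  case: z => x y /=; rewrite -!sqrtr_sqr !ler_sqrt ?addr_ge0 ?sqr_ge0 //.
  by rewrite lerDl lerDr !sqr_ge0.
have /cvg_ex[x xP] := part (fun k => complex.Re (u k))
  (fun k => le_trans (ReIm (u k)).1 (ua k)).
have /cvg_ex[y yP] := part (fun k => complex.Im (u k))
  (fun k => le_trans (ReIm (u k)).2 (ua k)).
apply/cvg_ex; exists (x%:C + (Complex 0 1 : C) * y%:C).
have -> : series u = (fun N => (series (fun k => complex.Re (u k)) N)%:C +
    (Complex 0 1 : C) * (series (fun k => complex.Im (u k)) N)%:C).
  apply/funext => N; rewrite !seriesEnat /= !rmorph_sum mulr_sumr -big_split.
  by apply: eq_bigr => k _; rewrite /= -complexE.
apply: cvgD; first exact: cvg_real_complex.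
by apply: cvgM; [exact: cvg_cst|exact: cvg_real_complex].
Qed.

Lemma complex_series_tail (u : nat -> C) (a : nat -> R) N :
  (forall k, nrm (u k) <= a k) -> cvgn (series a) ->
  nrm (limn (series u) - series u N) <= limn (series a) - series a N.
Proof.
move=> ua ca; have cu := complex_cvgn_series ua ca.
have a_ge0 k : 0 <= a k := le_trans (normc_ge0 _) (ua k).
apply/ler_addgt0Pr => e e0.
have /cvg_normcP/(_ e e0) near_e := cu.
near \oo => M.
have NM : (N <= M)%N by near: M; exists N.
apply: le_trans (normc_triangle (series u M) _ _) _; rewrite addrC.
apply: lerD; last by apply: ltW; near: M.
rewrite sub_series_geq //.
apply: le_trans (normc_sum _ ua) _.
rewrite -sub_series_geq // lerB // nondecreasing_cvgn_le //.
apply/nondecreasing_seqP => k; rewrite -subr_ge0 sub_series_geq //.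
by rewrite big_nat1.
Unshelve. all: by end_near. Qed.

Lemma cvg_normc_le (T : Type) (F : set_system T) {FF : ProperFilter F}
  (f : T -> C) (l : C) (b : R) :
  f t @[t --> F] --> l -> (\forall t \near F, nrm (f t) <= b) -> nrm l <= b.
Proof.
move=> /cvg_normcP fl fb; apply/ler_addgt0Pr => e e0.
near F => t; rewrite -[l](subrK (f t)) addrC.
apply: le_trans (normcD _ _) _; rewrite addrC [b + e]addrC.
apply: lerD; first by apply: ltW; near: t; exact: fl.
by near: t.
Unshelve. all: by end_near. Qed.

(** Dominated convergence for series: both tails beyond a fixed N are below e / 3 by the majorant a,
    and the finite head converges term by term. *)
Lemma tannery (T : Type) (F : set_system T) {FF : ProperFilter F}
  (u : T -> nat -> C) (l : nat -> C) (a : nat -> R) :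
  (\forall t \near F, forall k, nrm (u t k) <= a k) -> cvgn (series a) ->
  (forall k, u t k @[t --> F] --> l k) ->
  limn (series (u t)) @[t --> F] --> limn (series l).
Proof.
move=> ua ca ul.
have la k : nrm (l k) <= a k.
  by apply: (cvg_normc_le (ul k)); apply: filterS ua => t.
apply/cvg_normcP => e e0.
have e3 : 0 < e / 3 by rewrite divr_gt0.
have [N _ /(_ N (leqnn _)) aN] : \forall N \near \oo, limn (series a) - series a N < e / 3.
  have /cvgrPdist_lt/(_ _ e3) := ca.
  by apply: filterS => N; apply: le_lt_trans; exact: ler_norm.
have sN : series (u t) N @[t --> F] --> series l N.
  rewrite seriesEnat /=; apply: (@cvg_bigD C T F _ _ _ (fun k t => u t k)).
  exact: ul.
have /cvg_normcP/(_ _ e3) near_sN := sN.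
near=> t.
have uta : forall k, nrm (u t k) <= a k by near: t.
apply: le_lt_trans (normc_triangle (series l N) _ _) _.
have -> : e = e / 3 + (e / 3 + e / 3) by field.
apply: ltrD; first exact: le_lt_trans (complex_series_tail N la ca) aN.
apply: le_lt_trans (normc_triangle (series (u t) N) _ _) _.
apply: ltrD; first by near: t.
by rewrite normcBC; exact: le_lt_trans (complex_series_tail N uta ca) aN.
Unshelve. all: by end_near. Qed.

Lemma limn_series_finite (u : nat -> C) N :
  (forall k, (N <= k)%N -> u k = 0) -> limn (series u) = series u N.
Proof.
move=> u0; apply/cvg_lim; first exact: norm_hausdorff.
apply: cvg_near_cst; exists N => //= M NM; apply/eqP.
rewrite -subr_eq0 sub_series_geq // big_nat_cond big1 // => k.
by rewrite andbT => /andP[/u0].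
Qed.

End ComplexConvergence.

Section MatrixExponential.
Context {R : realType} {n : nat}.
Local Notation C := (Cplx R).
Local Notation gl := 'M[C]_n.+1.
Local Notation nrm := (@Normc.normc R).
Implicit Types (X A : gl) (x : R).

(** An entrywise bound; each matrix product costs a factor n.+1, so the exponential series is
    dominated by the real one at n.+1 times x. *)
Definition entry_bound X x := forall i j, nrm (X i j) <= x.

Lemma entry_boundM X A x y : entry_bound X x -> entry_bound A y ->
  entry_bound (X *m A) (n.+1%:R * (x * y)).
Proof.
move=> Xx Ay i j; rewrite mxE.
apply: le_trans (normc_sum _ (G := fun=> x * y) _) _ => [k|].
  by rewrite Normc.normcM ler_pM // normc_ge0.
by rewrite sumr_const card_ord mulr_natl.
Qed.

Lemma entry_boundX X x k : entry_bound X x -> 0 <= x ->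
  entry_bound (X ^+ k) ((n.+1%:R * x) ^+ k).
Proof.
move=> Xx x0; elim: k => [|k IHk i j].
  move=> i j; rewrite !expr0 mxE.
  by case: (i == j); rewrite ?mulr1n ?mulr0n ?Normc.normc1 ?Normc.normc0 // ler01.
by rewrite exprS exprS -mulrA; apply: entry_boundM.
Qed.

Lemma entry_bound_exists X : exists2 x, 0 <= x & entry_bound X x.
Proof.
exists (\sum_i \sum_j nrm (X i j)).
  by apply: sumr_ge0 => i _; apply: sumr_ge0 => j _; exact: normc_ge0.
move=> i j; rewrite (bigD1 i) //= (bigD1 j) //= -addrA lerDl.
by rewrite addr_ge0 //; do ?[apply: sumr_ge0 => ? _]; exact: normc_ge0.
Qed.

Definition exp_term X (i j : 'I_n.+1) (k : nat) : C := (k`!%:R)^-1 * (X ^+ k) i j.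

Lemma exp_term_bound X x i j k : entry_bound X x -> 0 <= x ->
  nrm (exp_term X i j k) <= exp_coeff (n.+1%:R * x) k.
Proof.
move=> Xx x0; rewrite /exp_term Normc.normcM /exp_coeff /= mulrC.
have -> : nrm (k`!%:R^-1) = k`!%:R^-1 :> R.
  rewrite Normc.normcV; congr _^-1.
  by rewrite -(rmorph_nat (real_complex R)) normc_real ger0_norm.
by rewrite ler_wpM2r ?invr_ge0 //; exact: entry_boundX.
Qed.

Lemma expmxE X i j : expmx X i j = limn (series (exp_term X i j)).
Proof.
have [x x0 Xx] := entry_bound_exists X.
have cvg_ij s t : series (exp_term X s t) @ \oo --> limn (series (exp_term X s t)).
  apply: (@complex_cvgn_series R _ (exp_coeff (n.+1%:R * x))).
    by move=> k; exact: exp_term_bound.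
  exact: is_cvg_series_exp_coeff.
have : series (fun k => (k`!%:R : C)^-1 *: X ^+ k) @ \oo -->
    (\matrix_(s, t) limn (series (exp_term X s t)) : gl).
  apply/cvg_mxP => s t; rewrite mxE.
  suff -> : (fun N => series (fun k => (k`!%:R : C)^-1 *: X ^+ k) N s t) =
     series (exp_term X s t) by exact: cvg_ij.
  apply/funext => N; rewrite !seriesEnat /= summxE; apply: eq_bigr => k _.
  by rewrite mxE.
move=> /(cvg_lim (@norm_hausdorff _ _)); rewrite /expmx => ->.
by rewrite mxE.
Qed.

Lemma is_derive_expmx X : is_derive (0 : C) (1 : C) (fun t => expmx (t *: X)) X.
Proof.
have [x x0 Xx] := entry_bound_exists X.
apply/is_derive_curve/cvg_mxP => i j.
(* The difference quotient as a series: the term of index 0 cancels against the identity and each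
   other term loses one factor h. As h tends to 0 only index 1 survives, and |h| <= 1 gives the
   majorant. *)
pose v (h : C) k : C := if k is k'.+1 then h ^+ k' * exp_term X i j k else 0.
pose l k : C := if k == 1%N then X i j else 0.
have vl : limn (series (v h)) @[h --> (0 : C)^'] --> limn (series l).
  apply: (@tannery R _ _ _ v l (exp_coeff (n.+1%:R * x))).
  - near=> h => -[|k]; rewrite /v; first by rewrite Normc.normc0 exp_coeff_ge0 // mulr_ge0.
    apply: le_trans (exp_term_bound i j k.+1 Xx x0).
    rewrite Normc.normcM -[leRHS]mul1r ler_wpM2r ?normc_ge0 //.
    have h1 : nrm h <= 1.
      have : `|h| <= 1 by near: h; exact: dnbhs0_le.
      by rewrite norm_normc -(rmorph1 (real_complex R)) lecR.
    elim: k => [|k IHk]; first by rewrite expr0 Normc.normc1.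
    by rewrite exprS Normc.normcM mulr_ile1 ?normc_ge0.
  - exact: is_cvg_series_exp_coeff.
  - move=> [|[|k]]; rewrite /v /l.
    + exact: cvg_cst.
      have -> : (fun h : C => h ^+ 0 * exp_term X i j 1) = (fun=> X i j).
        by apply/funext => h; rewrite expr0 mul1r /exp_term expr1 invr1 mul1r.
      exact: cvg_cst.
    have : (h ^+ k.+1 * exp_term X i j k.+2) @[h --> (0 : C)^'] -->
        (0 ^+ k.+1 * exp_term X i j k.+2 : C).
      apply: cvgM; last exact: cvg_cst.
      have idc : (h : C) @[h --> (0 : C)^'] --> (0 : C) by exact: nbhs_dnbhs.
      exact: cvg_pow.
    by rewrite expr0n mul0r.
have lE : limn (series l) = X i j.
  rewrite (@limn_series_finite R _ 2); last by move=> [|[|k]].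
  by rewrite seriesEnat /= !big_nat_recl // big_geq // /l /= add0r addr0.
have exp0E : limn (series (exp_term 0 i j)) = (1 : gl) i j.
  rewrite (@limn_series_finite R _ 1) => [|[//|k] _]; last first.
    by rewrite /exp_term expr0n mxE mulr0.
  by rewrite seriesEnat /= big_nat1 /exp_term expr0 fact0 invr1 mul1r.
have vE (h : C) : h != 0 -> limn (series (v h)) =
    h^-1 * (limn (series (exp_term (h *: X) i j)) - (1 : gl) i j).
  move=> h0; apply: cvg_lim; first exact: norm_hausdorff.
  have cX : cvgn (series (exp_term (h *: X) i j)).
    have [y y0 hXy] := entry_bound_exists (h *: X).
    apply: (@complex_cvgn_series R _ (exp_coeff (n.+1%:R * y))).
      by move=> k; exact: exp_term_bound.
    exact: is_cvg_series_exp_coeff.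
  have main : (h^-1 * (series (exp_term (h *: X) i j) N - (1 : gl) i j))
      @[N --> \oo] --> h^-1 * (limn (series (exp_term (h *: X) i j)) - (1 : gl) i j).
    by apply: cvgM; [exact: cvg_cst|apply: cvgB; [exact: cX|exact: cvg_cst]].
  apply: cvg_trans main; apply: near_eq_cvg; exists 1%N => // -[//|N] _ /=.
  rewrite !seriesEnat /= !big_nat_recl //= add0r.
  rewrite {1}/exp_term expr0 fact0 invr1 mul1r addrC addKr mulr_sumr.
  apply: eq_bigr => k _; rewrite /exp_term exprZn mxE [h ^+ k.+1]exprS.
  by move: (k.+1`!%:R^-1) ((X ^+ k.+1) i j) (h ^+ k) => a b c; field.
rewrite lE in vl; apply: cvg_trans vl; apply: near_eq_cvg.
near=> h; have h0 : h != 0 by near: h; exact: nbhs_dnbhs_neq.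
have subE (a : C) (P Q : gl) : (a *: (P - Q)) i j = a * (P i j - Q i j).
  by rewrite !mxE.
rewrite subE scale0r (vE h h0); congr (_ * (_ - _)).
  exact: esym (expmxE _ _ _).
exact: etrans (esym exp0E) (esym (expmxE _ _ _)).
Unshelve. all: by end_near. Qed.

Lemma cvg_invn : (k%:R^-1 : C) @[k --> \oo] --> (0 : C).
Proof.
apply/cvg_normcP => e e0; near=> k.
rewrite sub0r normc_opp Normc.normcV -(rmorph_nat (real_complex R)) normc_real.
rewrite ger0_norm //; have k0 : (0 < k)%N by near: k; exists 1%N.
rewrite invf_plt ?posrE ?ltr0n //.
by near: k; exact: nbhs_infty_gtr.
Unshelve. all: by end_near. Qed.

(** Euler's limit. It turns first-order information on a curve into an exponential. *)
Lemma expmx_limit (A : nat -> gl) X :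
  (k%:R *: A k) @[k --> \oo] --> X -> ((1 + A k) ^+ k) @[k --> \oo] --> expmx X.
Proof.
move=> /cvg_mxP AX; apply/cvg_mxP => i j; rewrite expmxE.
have [x x0 Xx] := entry_bound_exists X.
pose u (k s : nat) : C := 'C(k, s)%:R * (A k ^+ s) i j.
have uE k : ((1 + A k) ^+ k) i j = limn (series (u k)).
  rewrite (@limn_series_finite R _ k.+1) => [|s ks]; last first.
    by rewrite /u bin_small // mul0r.
  rewrite exprDn_comm; last exact/commr_sym/commr1.
  rewrite seriesEnat /= big_mkord summxE; apply: eq_bigr => s _.
  by rewrite expr1n mul1r mulmxnE /u mulr_natl.
under eq_fun do rewrite uE.
(* The ratio of the binomial term to the exponential term at k A_k; it lies in [0, 1] and tends to
   1, as the dominated limit requires. *)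
pose w (k s : nat) : C := (k ^_ s)%:R / k%:R ^+ s.
have uw k s : (0 < k)%N -> u k s = w k s * exp_term (k%:R *: A k) i j s.
  move=> k0; have kC : k%:R != 0 :> C by rewrite pnatr_eq0 -lt0n.
  rewrite /u /w /exp_term exprZn mxE -bin_ffact natrM.
  have f0 : s`!%:R != 0 :> C by rewrite pnatr_eq0 -lt0n fact_gt0.
  have ks0 : k%:R ^+ s != 0 :> C by rewrite expf_neq0.
  by field; rewrite f0 ks0.
have wlim s : w k s @[k --> \oo] --> (1 : C).
  elim: s => [|s IHs].
    by rewrite /w; under eq_fun do rewrite expr0 invr1 mulr1 ffactn0; exact: cvg_cst.
  have : (w k s * (1 - s%:R * k%:R^-1)) @[k --> \oo] --> (1 * (1 - s%:R * 0) : C).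
    apply: cvgM; first exact: IHs.
    apply: cvgB; first exact: cvg_cst.
    by apply: cvgM; [exact: cvg_cst|exact: cvg_invn].
  rewrite mulr0 subr0 mul1r => w1; apply: cvg_trans w1; apply: near_eq_cvg.
  near=> k; have sk : (s < k)%N by near: k; exists s.+1.
  have kC : k%:R != 0 :> C by rewrite pnatr_eq0 -lt0n (leq_ltn_trans _ sk).
  rewrite /w ffactnSr natrM natrB ?(ltnW sk) // exprS.
  have ks0 : k%:R ^+ s != 0 :> C by rewrite expf_neq0.
  by field; rewrite kC ks0.
have w_le1 k s : nrm (w k s) <= 1.
  rewrite /w -natrX -(rmorph_nat (real_complex R)) -(rmorph_nat (real_complex R)).
  rewrite -fmorphV -rmorphM normc_real ger0_norm ?divr_ge0 //.
  have [->|k0] := posnP (k ^ s)%N; first by rewrite invr0 mulr0 ler01.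
  rewrite ler_pdivrMr ?ltr0n // mul1r ler_nat; elim: s {k0} => [//|s IHs].
  by rewrite ffactnSr expnSr leq_mul // leq_subr.
apply: (@tannery R _ _ _ u _ (exp_coeff (n.+1%:R * (x + 1)))).
- near=> k => s; have k0 : (0 < k)%N by near: k; exists 1%N.
  have Ax : entry_bound (k%:R *: A k) (x + 1).
    move=> a b; rewrite -[X in nrm X](subrK (X a b)).
    apply: le_trans (normcD _ _) _; rewrite addrC lerD // normcBC.
    move: a b; near: k; apply: filter_forall => a; apply: filter_forall => b.
    have /cvg_normcP/(_ 1 ltr01) := AX a b.
    by apply: filterS => k /ltW.
  rewrite uw // Normc.normcM -[leRHS]mul1r ler_pM ?normc_ge0 //.
  by apply: exp_term_bound => //; rewrite addr_ge0.
- exact: is_cvg_series_exp_coeff.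
- move=> s; have : (w k s * exp_term (k%:R *: A k) i j s) @[k --> \oo] -->
      1 * exp_term X i j s.
    apply: cvgM; first exact: wlim.
    apply: cvgM; first exact: cvg_cst.
    suff : ((k%:R *: A k) ^+ s) @[k --> \oo] --> X ^+ s by move/cvg_mxP.
    elim: s => [|s IHs].
      by rewrite expr0; under eq_fun do rewrite expr0; exact: cvg_cst.
    rewrite exprS; under eq_fun do rewrite exprS.
    by apply: cvg_mulmx; [exact/cvg_mxP|exact: IHs].
  rewrite mul1r => wl; apply: cvg_trans wl; apply: near_eq_cvg.
  by near=> k; rewrite uw //; near: k; exists 1%N.
Unshelve. all: by end_near. Qed.

Lemma expmx_flow (g : C -> gl) X : g 0 = 1 -> is_derive (0 : C) (1 : C) g X ->
  (g (k%:R^-1) ^+ k) @[k --> \oo] --> expmx X.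
Proof.
move=> g0 /is_derive_curve dg; pose A k := g (k%:R^-1) - 1.
have : (k%:R *: A k) @[k --> \oo] --> X.
  have k_dnbhs : (k%:R^-1 : C) @[k --> \oo] --> (0 : C)^'.
    move=> U [e /= e0 eU]; have /cvgrPdist_lt/(_ _ e0) := cvg_invn.
    move=> [N _ NU]; exists N.+1 => // k Nk; apply: eU; first exact: NU (ltnW Nk).
    by rewrite invr_eq0 pnatr_eq0 -lt0n (leq_ltn_trans _ Nk).
  have := cvg_comp _ _ k_dnbhs dg; apply: cvg_trans; apply: near_eq_cvg.
  by near=> k; rewrite /= invrK g0.
by move/expmx_limit; under eq_fun do rewrite addrC subrK.
Unshelve. all: by end_near. Qed.

Lemma expmx0 : expmx (0 : gl) = 1.
Proof.
apply: (@cvg_at_unique C gl nat \oo _ (fun=> 1)); last exact: cvg_cst.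
have := @expmx_limit (fun=> 0) 0; under eq_fun do rewrite scaler0.
move=> /(_ (cvg_cst _)); under eq_fun do rewrite addr0 expr1n; exact.
Qed.

(** With Y = X / k, the product of the k-th powers of 1 + Y and 1 - Y is the k-th power of 1 - Y^2.
    As k Y^2 tends to 0, Euler's limit gives exp 0. *)
Lemma expmxN X : expmx X *m expmx (- X) = 1.
Proof.
have invX : (k%:R^-1 *: X) @[k --> \oo] --> (0 : gl).
  by rewrite -(scale0r X); apply: cvgZ; [exact: cvg_invn|exact: cvg_cst].
have limX Y : (k%:R *: (k%:R^-1 *: Y)) @[k --> \oo] --> (Y : gl).
  apply: cvg_near_cst; exists 1%N => // k k0 /=.
  by rewrite scalerA divff ?scale1r // pnatr_eq0 -lt0n.
have E1 := expmx_limit (limX X); have E2 := expmx_limit (limX (- X)).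
apply: (@cvg_at_unique C gl nat \oo _ _ _ _ (cvg_mulmx E1 E2)).
have h0 : (k%:R *: - ((k%:R^-1 *: X) *m (k%:R^-1 *: X))) @[k --> \oo] --> (0 : gl).
  have : (- (X *m (k%:R^-1 *: X))) @[k --> \oo] --> (- (X *m 0) : gl).
    by apply: cvgN; apply: cvg_mulmx; [exact: cvg_cst|exact: invX].
  rewrite mulmx0 oppr0; apply: cvg_trans; apply: near_eq_cvg.
  exists 1%N => // k k0; rewrite scalerN -scalemxAl scalerA divff ?scale1r //.
  by rewrite pnatr_eq0 -lt0n.
have := expmx_limit h0; rewrite expmx0.
apply: cvg_trans; apply: near_eq_cvg; near=> k.
set Y := _ *: X; have -> : k%:R^-1 *: - X = - Y by rewrite /Y scalerN.
have cYY : GRing.comm (1 + Y) (1 - Y).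
  apply: commrB; first exact: commr1.
  by apply/commr_sym/commrD; [exact: commr1|exact: commr_refl].
rewrite -[(1 + Y) ^+ k *m _]/(_ * _) -exprMn_comm //; congr (_ ^+ _).
by rewrite mulrDl mul1r mulrBr mulr1 addrA subrK.
Unshelve. all: by end_near. Qed.

Lemma expmx_unit X : expmx X \in unitmx.
Proof. exact: (mulmx1_unit (expmxN X)).1. Qed.

End MatrixExponential.

(** * The Lie algebra as the set of velocities of curves in G *)

Section TangentCurves.
Context {K : numFieldType}.

Lemma curve_near {W : normedModType K} (c : K -> W) w (A : set W) :
  is_derive (0 : K) (1 : K) c w -> nbhs (c 0) A -> \forall t \near (0 : K), A (c t).
Proof.
move=> [dc _] cA; have : {for 0, continuous c}.
  by apply/differentiable_continuous/derivable1_diffP.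
exact.
Qed.

Lemma cvg_linear_mx m n p q (f : {linear 'M[K]_(m, n) -> 'M[K]_(p, q)})
    (T : Type) (F : set_system T) {FF : Filter F} (M : T -> 'M[K]_(m, n)) (l : 'M[K]_(m, n)) :
  M t @[t --> F] --> l -> f (M t) @[t --> F] --> f l.
Proof.
move=> /cvg_mxP Ml; apply/cvg_mxP => a b.
have fE N : f N a b = \sum_i \sum_j N i j * f (delta_mx i j) a b.
  rewrite {1}(matrix_sum_delta N) linear_sum summxE; apply: eq_bigr => i _.
  by rewrite linear_sum summxE; apply: eq_bigr => j _; rewrite linearZ mxE.
rewrite fE; under eq_fun do rewrite fE.
apply: cvg_bigD => i; apply: cvg_bigD => j.
by apply: cvgM; [exact: Ml|exact: cvg_cst].
Qed.

(** The projection onto U is continuous and fixes the difference quotients, hence their limit. *)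
Lemma derive_in_subspace m n (U : {vspace 'M[K]_(m, n)}) (c : K -> 'M[K]_(m, n)) w :
  is_derive (0 : K) (1 : K) c w -> (\forall t \near (0 : K), c t \in U) -> w \in U.
Proof.
move=> /is_derive_curve dc cU; have c0U : c 0 \in U := nbhs_singleton cU.
have dp := @cvg_linear_mx m n m n (projv U) _ _ _ _ _ dc.
suff -> : w = projv U w by exact: memv_proj.
suff E : (h^-1 *: (c h - c 0)) @[h --> (0 : K)^'] --> projv U w.
  exact: cvg_at_unique dc E.
have eqp : {near (0 : K)^', (fun h => projv U (h^-1 *: (c h - c 0))) =1
    (fun h => h^-1 *: (c h - c 0))}.
  have := nbhs_dnbhs cU; apply: filterS => h ch /=.
  by rewrite projv_id // memvZ // memvB.
by move=> A /dp; exact: (near_eq_cvg eqp).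
Qed.

End TangentCurves.

Section LieAlgebra.
Context {R : realType} {n : nat}.
Local Notation C := (Cplx R).
Local Notation gl := 'M[C]_n.+1.
Variable G : set gl.
Hypothesis groupG : linear_algebraic_group G.

(** Differentiability at 0 alone is recorded: it is what Euler's limit consumes, and it passes to
    products, rescalings and conjugates of curves. *)
Definition tangent_at_one (X : gl) := exists g : C -> gl,
  [/\ g 0 = 1, \forall t \near (0 : C), G (g t) & is_derive (0 : C) (1 : C) g X].

Lemma group_expr g k : G g -> G (g ^+ k).
Proof.
move=> Gg; elim: k => [|k IHk]; first by rewrite expr0; exact: lag_one.
by rewrite exprS; apply: lag_mul.
Qed.

Lemma group_limit (g : nat -> gl) (l : gl) : l \in unitmx ->
  g k @[k --> \oo] --> l -> (\forall k \near \oo, G (g k)) -> G l.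
Proof.
move=> lU /cvg_mxP gl_ gG; have [A [[S ->] GE]] := lag_closed groupG.
have inG h : G h <-> zero_locus (@mx_coord C n.+1) S h /\ h \in unitmx by rewrite GE.
apply/inG; split=> // p Sp.
have lim_p : meval (mx_coord (g k)) p @[k --> \oo] --> meval (mx_coord l) p.
  apply: cvg_meval => i; rewrite /mx_coord.
  case/mxvec_indexP: i => a b; rewrite mxvecE.
  by under eq_fun do rewrite mxvecE; exact: gl_.
have lim_0 : meval (mx_coord (g k)) p @[k --> \oo] --> (0 : C).
  by apply: cvg_near_cst; apply: filterS gG => k /inG[/(_ _ Sp)].
exact: cvg_at_unique lim_p lim_0.
Qed.

Lemma tangentZ a X : tangent_at_one X -> tangent_at_one (a *: X).
Proof.
move=> [g [g0 gG dg]]; exists (fun t => g (a * t)); split.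
- by rewrite mulr0.
- have nG := @curve_near C C _ a (fun s => G (g s)) (is_derive_line (0 : C) a).
  have : \forall t \near (0 : C), G (g (0 + t *: a)).
    by apply: nG; rewrite scale0r addr0.
  by apply: filterS => t; rewrite add0r mulrC.
- exact: is_derive_curve_scale.
Qed.

Lemma tangentD X Y : tangent_at_one X -> tangent_at_one Y -> tangent_at_one (X + Y).
Proof.
move=> [g [g0 gG dg]] [h [h0 hG dh]]; exists (fun t => g t *m h t); split.
- by rewrite g0 h0 mul1mx.
- by apply: filterS2 gG hG => t; exact: lag_mul.
- by have := is_derive_mulmx_curve dg dh; rewrite g0 h0 mul1mx mulmx1.
Qed.

Lemma tangent_conj g X : G g -> tangent_at_one X ->
  tangent_at_one (g *m X *m invmx g).
Proof.
move=> Gg [c [c0 cG dc]]; exists (fun t => g *m c t *m invmx g); split.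
- by rewrite c0 mulmx1 mulmxV //; exact: lag_unit Gg.
- apply: filterS cG => t Gct; apply: lag_mul => //; last exact: lag_inv.
  exact: lag_mul.
- have d1 := is_derive_mulmx_curve (is_derive_cst_curve g) dc.
  have := is_derive_mulmx_curve d1 (is_derive_cst_curve (invmx g)).
  by rewrite mul0mx add0r mulmx0 addr0.
Qed.

(** exp(tX) is the limit of the powers g(1/k)^k in G, and G is closed among invertible matrices.
    Sums and conjugates, awkward for exponentials, become products and conjugates of curves. *)
Lemma tangent_lie X : tangent_at_one X <-> lie_algebra G X.
Proof.
split=> [tX t|lieX]; last first.
  exists (fun t => expmx (t *: X)); split.
  - by rewrite scale0r; exact: expmx0.
  - by apply: filterE => t; exact: lieX.
  - exact: is_derive_expmx.
have [g [g0 gG dg]] := tangentZ t tX.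
apply: (group_limit (expmx_unit _) (expmx_flow g0 dg)).
have : \forall k \near \oo, G (g k%:R^-1) by exact: (@cvg_invn R _ gG).
by apply: filterS => k; exact: group_expr.
Qed.

Lemma lie_lincomb (I : Type) (s : seq I) (c : I -> C) (X : I -> gl) :
  (forall i, lie_algebra G (X i)) -> lie_algebra G (\sum_(i <- s) c i *: X i).
Proof.
move=> lieX; apply/tangent_lie; elim: s => [|i s IHs].
  rewrite big_nil; exists (fun=> 1); split=> //; last exact: is_derive_cst_curve.
  by apply: filterE => t; exact: lag_one.
rewrite big_cons; apply: tangentD => //; apply: tangentZ.
by apply/tangent_lie.
Qed.

Lemma lie_conj g X : G g -> lie_algebra G X ->
  lie_algebra G (g *m X *m invmx g).
Proof. by move=> Gg /tangent_lie tX; apply/tangent_lie; exact: tangent_conj. Qed.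

(** U is the image of L under the differential of psi at phi(1), injective because phi inverts psi.
    This bounds the dimension of the Lie algebra from below; the logarithmic basis bounds it from
    above. *)
Lemma submanifold_lie d : complex_submanifold d G ->
  exists2 U : {vspace gl}, \dim U = d & forall X, X \in U -> lie_algebra G X.
Proof.
move=> /(_ 1 (lag_one groupG)) [U [W [phi [psi [L [[oU oW U1] phiP psiP [dphi dpsi] [dL SL]]]]]]].
have [Wq psiq] := phiP 1 U1; set q := phi 1 in Wq psiq.
have qL : q \in L by apply/SL => //; exact: lag_one.
pose f : {linear gl -> gl} := 'd psi q.
have dcurve w : is_derive (0 : C) (1 : C) (fun t => psi (q + t *: w)) (f w).
  have dl := is_derive_line q w.
  have dp : differentiable psi (q + 0 *: w) by rewrite scale0r addr0; exact: dpsi.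
  have E : 'D_w psi (q + 0 *: w) = f w.
    by rewrite scale0r addr0; exact: (deriveE w (dpsi q Wq)).
  by have := is_derive_comp_curve dl dp; rewrite E; exact.
have nearW w : \forall t \near (0 : C), W (q + t *: w).
  apply: (curve_near (is_derive_line q w)); rewrite scale0r addr0.
  exact: open_nbhs_nbhs.
exists (linfun f @: L)%VS.
  rewrite limg_dim_eq //; apply/eqP; rewrite -subv0; apply/subvP => w.
  rewrite memv_cap memv_ker lfunE /= => /andP[_ /eqP fw0].
  rewrite memv0; apply/eqP.
  have d1 : is_derive (0 : C) (1 : C) (fun t => phi (psi (q + t *: w))) ('D_(f w) phi 1).
    have := @is_derive_comp_curve _ _ _ _ _ phi (dcurve w).
    by rewrite scale0r addr0 psiq; apply; exact: dphi.
  have d2 : is_derive (0 : C) (1 : C) (fun t => phi (psi (q + t *: w))) w.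
    apply: near_eq_is_derive (is_derive_line q w).
    by apply: filterS (nearW w) => t /psiP[].
  rewrite (is_derive_unique d2 d1) fw0 derive0 //.
move=> X /memv_imgP[w wL ->]; apply/tangent_lie.
exists (fun t => psi (q + t *: w)); rewrite lfunE; split.
- by rewrite scale0r addr0.
- apply: filterS (nearW w) => t /psiP[Upsi psiK]; apply/(SL _ Upsi).
  by rewrite psiK memvD // memvZ.
- exact: dcurve.
Qed.

Lemma is_derive_expmx_mul X (v : 'cV[C]_n.+1) :
  is_derive (0 : C) (1 : C) (fun t => expmx (t *: X) *m v) (X *m v).
Proof.
apply: is_derive_eq
  (is_derive_mulmx_curve (is_derive_expmx X) (is_derive_cst_curve v)) _.
by move: (expmx _) => E; rewrite mulmx0 addr0.
Qed.

Lemma xiE X (v : 'cV[C]_n.+1) : xi X v = X *m v.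
Proof. rewrite /xi derive1E; by case: (is_derive_expmx_mul X v) => _ E; exact: E. Qed.

End LieAlgebra.

(** * Linear logarithmic vector fields *)

Section LogarithmicFields.
Context {C : numClosedFieldType} {n : nat}.
Local Notation V := 'cV[C]_n.+1.
Local Notation gl := 'M[C]_n.+1.
Implicit Types (D : set V) (p v w : V) (X : gl).

Lemma holomorphic_poly_fun (q : poly_in n.+1 C) p : holomorphic_at (poly_fun q) p.
Proof. by apply: filterE => v; exact: poly_fun_differentiable. Qed.

Lemma poly_fun_mderiv (q : poly_in n.+1 C) i v :
  poly_fun (mderiv i q) v = 'D_(delta_mx i 0) (poly_fun q) v.
Proof.
rewrite derive_poly_fun (bigD1 i) //= mxE !eqxx mulr1 big1 ?addr0 // => j ji.
by rewrite mxE (negbTE ji) mulr0.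
Qed.

Lemma near_near (T : topologicalType) (p : T) (A : set T) :
  (\forall v \near p, A v) -> \forall v \near p, \forall u \near v, A u.
Proof. by move=> /nbhs_interior. Qed.

Lemma poly_fun_near0 (q : poly_in n.+1 C) p :
  (\forall v \near p, poly_fun q v = 0) -> q = 0.
Proof.
apply: (@mderiv_stable_eq0 _ _ (fun s => \forall v \near p, poly_fun s v = 0)
  (vec_coord p)) => [s i /near_near|s sp].
  apply: filterS => v sv; rewrite poly_fun_mderiv.
  have -> : 'D_(delta_mx i 0) (poly_fun s) v = 'D_(delta_mx i 0) (cst 0) v.
    exact: near_eq_derive.
  exact: derive_cst.
exact: (nbhs_singleton sp).
Qed.

Lemma poly_fun_near_neq0 (q : poly_in n.+1 C) p :
  poly_fun q p != 0 -> \forall v \near p, poly_fun q v != 0.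
Proof.
move=> qp0; have qp : `|poly_fun q p| > 0 by rewrite normr_gt0.
have /cvgrPdist_lt/(_ _ qp) := differentiable_continuous (poly_fun_differentiable q p).
by apply: filterS => v; apply: contraTneq => ->; rewrite subr0 ltxx.
Qed.

Lemma differentiable_linear_field X v : differentiable (fun u : V => X *m u) v.
Proof.
apply: differentiable_mx => i j.
have -> : (fun u : V => (X *m u) i j) = (poly_fun (\sum_k mpolyC _ (X i k) * mpolyX C (mnm1 k))).
  apply/funext => u; rewrite mxE poly_fun_sum; apply: eq_bigr => k _.
  by rewrite poly_funM poly_funC poly_funX ord1.
exact: poly_fun_differentiable.
Qed.

(** At a point v of D near p, the germ h vanishes along the curve through v in D, so its derivative
    in the direction eta v is 0. *)
Lemma log_vf_curves D p (eta : V -> V) : holomorphic_at eta p ->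
  (\forall v \near p, D v -> exists c : C -> V,
     [/\ c 0 = v, is_derive (0 : C) (1 : C) c (eta v) &
       \forall t \near (0 : C), D (c t)]) ->
  log_vf_at D p eta.
Proof.
move=> heta curves; split=> // h [hh /near_near hD].
apply: filterS3 hh hD curves => v dh hDv curve Dv.
have [c [c0 dc cD]] := curve Dv; rewrite /vf_apply -c0.
rewrite -c0 in dh hDv.
apply: (@derive_along_constant_curve C V C c _ h 0); first by rewrite c0.
  exact: dh.
have := @curve_near C V c _ _ dc hDv.
by apply: filterS2 cD => t Dct; exact.
Qed.

Lemma linear_log_curves D p X :
  (forall v, D v -> exists c : C -> V,
     [/\ c 0 = v, is_derive (0 : C) (1 : C) c (X *m v) &
       \forall t \near (0 : C), D (c t)]) ->
  log_vf_at D p (fun v => X *m v).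
Proof.
move=> curves; apply: log_vf_curves.
  by apply: filterE => v; exact: differentiable_linear_field.
by apply: filterE => v; exact: curves.
Qed.

Section Basis.
Variables (D : set V) (m : nat) (B : 'I_m -> gl).
Hypothesis basisB : linear_log_basis D B.

(** Linear terms at the origin are compared: at h w both sides carry a factor h, and after dividing
    by it the limit h -> 0 replaces the holomorphic coefficients by their values at 0. *)
Lemma linear_log_span X : log_vf_at D 0 (fun v => X *m v) ->
  exists a : 'I_m -> C, X = \sum_i a i *: B i.
Proof.
move=> logX; have [_ gen _] := basisB 0.
have [a [hola XE]] := gen _ logX; exists (fun i => a i 0).
have cont i : a i w @[w --> (0 : V)] --> a i 0.
  by apply: differentiable_continuous; exact: nbhs_singleton (hola i).
suff ptw w : X *m w = (\sum_i a i 0 *: B i) *m w.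
  by apply/matrixP => i j; have := ptw (delta_mx j 0);
     rewrite -!colE => /colP/(_ i); rewrite !mxE.
have line : (h *: w) @[h --> (0 : C)^'] --> (0 : V).
  have dl := is_derive_line (0 : V) w.
  have : (0 + h *: w) @[h --> (0 : C)] --> (0 + (0 : C) *: w : V).
    move=> A; exact: (@curve_near C V (fun t => 0 + t *: w) w A dl).
  rewrite scale0r addr0 => l A /l /nbhs_dnbhs; apply: filterS => h /=.
  by rewrite add0r.
have lim1 : (\sum_i a i (h *: w) *: (B i *m w)) @[h --> (0 : C)^'] -->
    (\sum_i a i 0 *: B i) *m w.
  rewrite mulmx_suml; apply/cvg_mxP => s t; rewrite summxE.
  under eq_fun do rewrite summxE.
  apply: (@cvg_bigD C C ((0 : C)^') _ 'I_m _
    (fun i h => (a i (h *: w) *: (B i *m w)) s t)) => i.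
  rewrite -scalemxAl mxE; under eq_fun do rewrite mxE.
  apply: cvgM; last exact: cvg_cst.
  by apply: (cvg_comp (fun h : C => h *: w) (a i) line); exact: cont.
suff lim2 : (\sum_i a i (h *: w) *: (B i *m w)) @[h --> (0 : C)^'] --> X *m w.
  exact: cvg_at_unique lim2 lim1.
apply: cvg_near_cst; near=> h.
have h0 : h != 0 by near: h; exact: nbhs_dnbhs_neq.
have : X *m (h *: w) = \sum_i a i (h *: w) *: (B i *m (h *: w)).
  by near: h; exact: (line _ XE).
rewrite -scalemxAr => /(congr1 (fun u => h^-1 *: u)).
rewrite scalerA mulVf // scale1r => ->; rewrite scaler_sumr.
apply: eq_bigr => i _; rewrite -scalemxAr !scalerA; congr (_ *: _).
by rewrite mulrAC mulVf // mul1r.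
Unshelve. all: by end_near. Qed.

Lemma poly_relation (a : 'cV[poly_in n.+1 C]_m) : frame B *m a = 0 -> a = 0.
Proof.
move=> Ba0; have [_ _ freeB] := basisB 0.
apply/colP => i; rewrite mxE; apply: (@poly_fun_near0 _ 0).
apply: (freeB (fun i => poly_fun (a i 0))) => [j|].
  exact: holomorphic_poly_fun.
apply: filterE => v; apply/matrixP => s t; rewrite ord1 summxE mxE.
have /matrixP/(_ s 0)/(congr1 (fun q => poly_fun q v)) := Ba0.
rewrite !mxE poly_fun0 poly_fun_sum => E; rewrite -[RHS]E; apply: eq_bigr => j _.
by rewrite poly_funM poly_fun_frame mxE mulrC.
Qed.

(** More than n.+1 columns satisfy a nontrivial polynomial relation, which contradicts freeness at
    the origin. *)
Lemma linear_log_basis_le : (m <= n.+1)%N.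
Proof.
rewrite leqNgt; apply/negP => mN.
have [|a a0 Ba0] := @fraction_free_kernel (poly_in n.+1 C) _ _ (frame B).
  exact: leq_ltn_trans (rank_leq_row _) mN.
by case/eqP: a0; exact: poly_relation.
Qed.

Lemma linear_log_basis_free (c : 'I_m -> C) : \sum_i c i *: B i = 0 ->
  forall i, c i = 0.
Proof.
move=> cB i; have : frame B *m (\col_i mpolyC n.+1 (c i)) = 0.
  apply/matrixP => s t; rewrite ord1 mxE [RHS]mxE; apply: poly_fun_eq0 => v.
  rewrite poly_fun_sum; have := congr1 (fun A => (A *m v) s 0) cB.
  rewrite mul0mx [RHS]mxE mulmx_suml summxE => E; rewrite -[RHS]E; apply: eq_bigr => j _.
  rewrite poly_funM poly_fun_frame -scalemxAl [RHS]mxE mulrC; congr (_ * _).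
  by rewrite mxE poly_funC.
move=> /poly_relation/colP/(_ i); rewrite !mxE => /eqP.
by rewrite mpolyC_eq0 => /eqP.
Qed.

End Basis.

Lemma det_frame_neq0 D (B : 'I_n.+1 -> gl) : linear_log_basis D B ->
  \det (frame B) != 0.
Proof.
move=> basisB; apply/eqP => /det0_kernel[a a0 Ba].
by case/eqP: a0; exact: (poly_relation basisB).
Qed.

(** Were the determinant nonzero at p, the fields would span all directions near p. The polynomials
    vanishing on D near p would be stable under all partial derivatives, hence zero, while D has a
    nonzero equation. *)
Lemma log_basis_det0 D (B : 'I_n.+1 -> gl) p : linear_log_basis D B ->
  zariski_closed (@vec_coord C n.+1) D -> D != setT -> D p ->
  poly_fun (\det (frame B)) p = 0.
Proof.
move=> basisB [S DE] DT Dp; apply: contrapT => /eqP Dp0.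
have [s0 Ss0 s00] : exists2 s, S s & s != 0.
  apply: contrapT => nS; case/eqP: DT; rewrite DE; apply/seteqP; split=> // v _ s Ss.
  have [->|s0] := eqVneq s 0; first exact: meval0.
  by case: nS; exists s.
pose vanish (q : poly_in n.+1 C) := \forall v \near p, D v -> poly_fun q v = 0.
case/eqP: s00; apply: (@mderiv_stable_eq0 _ _ vanish (vec_coord p)); last 1 first.
- by apply: filterE => v; rewrite DE => /(_ _ Ss0).
- move=> q k qD; have logB j : \forall v \near p, D v ->
      vf_apply (fun v => B j *m v) (poly_fun q) v = 0.
    have [log _ _] := basisB p; have [_] := log j; apply.
    by split=> //; exact: holomorphic_poly_fun.
  have det_near : \forall v \near p, poly_fun (\det (frame B)) v != 0.
    exact: poly_fun_near_neq0.
  have := @filter_forall _ _ _ _ _ logB.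
  move=> /(_ _); apply: filterS2 det_near => v detv logv Dv.
  pose dq : 'rV[C]_n.+1 := \row_i poly_fun (mderiv i q) v.
  pose M := map_mx (fun s : poly_in n.+1 C => poly_fun s v) (frame B).
  have MU : M \in unitmx by rewrite unitmxE unitfE -poly_fun_det.
  have dqM : dq *m M = 0.
    apply/matrixP => a j; rewrite !mxE; have := logv j Dv.
    rewrite /vf_apply derive_poly_fun => E; rewrite -[RHS]E; apply: eq_bigr => i _.
    by rewrite [dq _ _]mxE [M _ _]mxE poly_fun_frame.
  have : dq = 0 by rewrite -[dq](mulmxK MU) dqM mul0mx.
  by move/rowP/(_ k); rewrite !mxE.
- by move=> q qD; exact: (nbhs_singleton qD Dp).
Qed.

End LogarithmicFields.

Lemma mem_span_ord (K : fieldType) (vT : vectType K) m (B : 'I_m -> vT) X :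
  X \in <<[tuple B i | i < m]>>%VS <-> exists c : 'I_m -> K, X = \sum_i c i *: B i.
Proof.
split=> [/coord_span XE|[c ->]].
  exists (fun i => coord [tuple B i | i < m] i X); rewrite {1}XE.
  by apply: eq_bigr => i _; rewrite -tnth_nth tnth_mktuple.
apply: rpred_sum => i _; apply: rpredZ; apply: memv_span.
by apply/tnthP; exists i; rewrite tnth_mktuple.
Qed.

(** * The Lie algebra and the discriminant of a linear free divisor *)

Section GroupAction.
Context {R : realType} {n : nat}.
Local Notation C := (Cplx R).
Local Notation V := 'cV[C]_n.+1.
Local Notation gl := 'M[C]_n.+1.
Variables (G : set gl) (D : set V).
Hypothesis GD : defines_linear_free_divisor G D.

Let groupG := dlfd_group GD.

Lemma group_orbitP g v : G g -> (~ D v) <-> ~ D (g *m v).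
Proof.
have [v0 orbit] := dlfd_orbit GD => Gg.
have inO u : ~ D u <-> exists2 h, G h & h *m v0 = u.
  by rewrite -[~ D u]/((~` D) u) orbit.
split=> /inO[h Gh hE]; apply/inO.
  by exists (g *m h); [exact: lag_mul|rewrite -mulmxA hE].
exists (invmx g *m h); first by apply: lag_mul => //; exact: lag_inv.
by rewrite -mulmxA hE mulKmx //; exact: lag_unit Gg.
Qed.

Lemma group_stable g v : G g -> D v -> D (g *m v).
Proof. by move=> /(group_orbitP v)[_ H] Dv; apply: contrapT => /H. Qed.

Lemma group_transitive v w : ~ D v -> ~ D w -> exists2 g, G g & g *m v = w.
Proof.
have [v0 orbit] := dlfd_orbit GD.
rewrite -[~ D v]/((~` D) v) -[~ D w]/((~` D) w) orbit => -[h Gh <-] [k Gk <-].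
exists (k *m invmx h); first by apply: lag_mul => //; exact: lag_inv.
by rewrite -mulmxA mulKmx //; exact: lag_unit Gh.
Qed.

Lemma lie_log X p : lie_algebra G X -> log_vf_at D p (fun v => X *m v).
Proof.
move=> /(tangent_lie groupG)[g [g0 gG dg]]; apply: linear_log_curves => v Dv.
exists (fun t => g t *m v); split.
- by rewrite g0 mul1mx.
- have := is_derive_mulmx_curve dg (is_derive_cst_curve v).
  by rewrite mulmx0 addr0.
- by apply: filterS gG => t Gt; exact: group_stable.
Qed.

Lemma lfd_lie_basis : exists2 B : 'I_n.+1 -> gl, linear_log_basis D B &
  forall X, lie_algebra G X <-> exists c : 'I_n.+1 -> C, X = \sum_i c i *: B i.
Proof.
have [_ _ _ [m [B basisB]]] := dlfd_lfd GD.
pose W := <<[tuple B i | i < m]>>%VS.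
have lieW X : lie_algebra G X -> X \in W.
  by move=> /lie_log/(linear_log_span basisB)/mem_span_ord.
have [U dU lieU] := submanifold_lie groupG (dlfd_dim GD).
have UW : (U <= W)%VS by apply/subvP => X /lieU; exact: lieW.
have dW : (\dim W <= m)%N by rewrite (leq_trans (dim_span _)) // size_tuple.
have mN := linear_log_basis_le basisB.
(* The chain n.+1 = dim U <= dim W <= m <= n.+1 collapses to equalities. *)
have Em : m = n.+1.
  by apply/eqP; rewrite eqn_leq mN /= -dU (leq_trans (dimvS UW)).
move: B basisB @W lieW UW dW mN; rewrite Em => B basisB W lieW UW dW _.
have WU : W = U by apply/esym/eqP; rewrite eqEdim UW dU.
exists B => // X; split=> [/lie_log/(linear_log_span basisB)//|/mem_span_ord XW].
by apply: lieU; rewrite -WU.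
Qed.

Section LieBasis.
Variable B : 'I_n.+1 -> gl.
Hypotheses (basisB : linear_log_basis D B)
  (lieB : forall X, lie_algebra G X <-> exists c : 'I_n.+1 -> C, X = \sum_i c i *: B i).
Local Notation Delta := (\det (frame B)).

(** For the converse inclusion: if Delta vanishes at v outside D, a nonzero X of the Lie algebra
    kills v. Some w outside D has Delta(w) nonzero, and g w = v with g in G; the conjugate of X by
    the inverse of g kills w, where the B i are independent, so X = 0. *)
Lemma lfd_discriminant : D = [set v | poly_fun Delta v = 0].
Proof.
have D0 := det_frame_neq0 basisB; have [_ DT _ _] := dlfd_lfd GD.
have DD v : D v -> poly_fun Delta v = 0.
  exact: log_basis_det0 (dlfd_open GD) DT.
apply/seteqP; split=> [v /DD//|v /= Dv0]; apply: contrapT => nDv.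
have [w Dw0] := poly_fun_neq0 D0.
have nDw : ~ D w by move=> /DD w0; rewrite w0 eqxx in Dw0.
have [g Gg gw] := group_transitive nDw nDv.
have kerM u (c : 'cV[C]_n.+1) :
    map_mx (fun s : poly_in n.+1 C => poly_fun s u) (frame B) *m c =
    (\sum_i c i 0 *: B i) *m u.
  rewrite frame_eval mulmx_suml; apply/matrixP => a b.
  rewrite ord1 mxE summxE; apply: eq_bigr => j _.
  by rewrite -scalemxAl [RHS]mxE mxE mulrC.
have : \det (map_mx (fun s : poly_in n.+1 C => poly_fun s v) (frame B))^T == 0.
  by rewrite det_tr -poly_fun_det Dv0.
move=> /det0P[c' c0 cM].
have {c' c0 cM}[c c0 cM] : exists2 c : 'cV[C]_n.+1, c != 0 &
    map_mx (fun s : poly_in n.+1 C => poly_fun s v) (frame B) *m c = 0.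
  exists c'^T; first by rewrite -(inj_eq (@trmx_inj _ _ _)) trmxK trmx0.
  by apply: trmx_inj; rewrite trmx_mul trmxK cM trmx0.
rewrite kerM in cM; set X := \sum_i _ in cM.
have lieX : lie_algebra G X by apply/lieB; exists (fun i => c i 0).
have ginv := lag_inv groupG Gg; have gU := lag_unit groupG Gg.
have invgK : invmx (invmx g) = g by rewrite invmxK.
have := lie_conj groupG ginv lieX; rewrite invgK => /lieB[d dE].
have dw : (\sum_i d i *: B i) *m w = 0.
  by rewrite -dE -!mulmxA gw cM mulmx0.
pose dc : 'cV[C]_n.+1 := \col_i d i.
have dc0 : dc = 0.
  have MU : map_mx (fun s : poly_in n.+1 C => poly_fun s w) (frame B) \in unitmx.
    by rewrite unitmxE unitfE -poly_fun_det.
  rewrite -(mulKmx MU dc) kerM (_ : \sum_i _ = \sum_i d i *: B i) ?dw ?mulmx0 //.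
  by apply: eq_bigr => i _; rewrite mxE.
have X0 : X = 0.
  have : invmx g *m X *m g = 0.
    rewrite dE big1 // => i _; have /colP/(_ i) := dc0.
    by rewrite !mxE => ->; rewrite scale0r.
  move=> /(congr1 (mulmx g)); rewrite -mulmxA mulKVmx // mulmx0.
  by move=> /(congr1 (fun Y => Y *m invmx g)); rewrite mulmxK // mul0mx.
case/eqP: c0; apply/colP => i; rewrite [RHS]mxE.
exact: (linear_log_basis_free basisB X0).
Qed.

Lemma lie_one : lie_algebra G 1%:M.
Proof.
apply/lieB; apply: (linear_log_span basisB); apply: linear_log_curves => v.
rewrite lfd_discriminant => /= Dv; exists (fun t => v + t *: v); split.
- by rewrite scale0r addr0.
- by rewrite mul1mx; exact: is_derive_line.
- apply: filterE => t; rewrite -{1}(scale1r v) -scalerDl.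
  by rewrite det_frame_scaling Dv mulr0.
Qed.

(** The bracket is the velocity at 0 of exp(tX) Y exp(-tX), a curve in the Lie algebra, which is a
    subspace stable under conjugation by G. *)
Lemma lie_bracket X Y : lie_algebra G X -> lie_algebra G Y ->
  lie_algebra G (X *m Y - Y *m X).
Proof.
move=> lieX lieY.
have lieW Z : lie_algebra G Z <-> Z \in <<[tuple B i | i < n.+1]>>%VS.
  by rewrite lieB; apply: iff_sym; exact: mem_span_ord.
apply/lieW.
have dX := is_derive_expmx X.
have dNX : is_derive (0 : C) (1 : C) (fun t => expmx (- (t *: X))) (- X).
  have -> : (fun t : C => expmx (- (t *: X))) = (fun t => expmx (t *: - X)).
    by apply/funext => t; congr expmx; exact/esym/scalerN.
  exact: is_derive_expmx.
have dc := is_derive_mulmx_curve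
  (is_derive_mulmx_curve dX (is_derive_cst_curve Y)) dNX.
have E0 : expmx (0 *: X) = 1 by rewrite scale0r; exact: expmx0.
have E0' : expmx (- (0 *: X)) = 1 by rewrite scale0r oppr0; exact: expmx0.
have E : (X *m Y + expmx (0 *: X) *m 0) *m expmx (- (0 *: X)) +
    expmx (0 *: X) *m Y *m - X = X *m Y - Y *m X.
  by rewrite E0 E0' mulmx0 addr0 mulmx1 mul1mx mulmxN.
rewrite -E; clear E E0 E0'.
apply: (derive_in_subspace dc); apply: filterE => t; apply/lieW.
have Gt : G (expmx (t *: X)) := lieX t.
have -> : expmx (- (t *: X)) = invmx (expmx (t *: X)).
  have := congr1 (mulmx (invmx (expmx (t *: X)))) (expmxN (t *: X)).
  by rewrite (mulKmx (expmx_unit _)) mulmx1.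
exact: lie_conj.
Qed.

End LieBasis.

End GroupAction.

(** * Reducedness of the discriminant *)

Section LineRestriction.
Context {C : numClosedFieldType} {n : nat}.
Implicit Types (f g : poly_in n C) (x w : 'I_n -> C).

Definition line_poly x w : poly_in n C -> {poly C} :=
  mmap (@polyC C) (fun i => (x i)%:P + w i *: 'X).
HB.instance Definition _ x w := GRing.RMorphism.on (line_poly x w).

Lemma line_polyC x w c : line_poly x w (mpolyC n c) = c%:P.
Proof. by rewrite /line_poly mmapC. Qed.

Lemma line_polyX x w i : line_poly x w (mpolyX C (mnm1 i)) = (x i)%:P + w i *: 'X.
Proof. by rewrite /line_poly mmapX mmap1U. Qed.

Lemma horner_line_poly x w f t :
  (line_poly x w f).[t] = meval (fun i => x i + w i * t) f.
Proof.
apply: (@mpoly_rmorph_ext _ _ _ (horner_eval t \o line_poly x w)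
  (meval (fun i => x i + w i * t))) => [c|i] /=.
  by rewrite line_polyC /horner_eval hornerC mevalC.
by rewrite line_polyX /horner_eval !hornerE mevalXU.
Qed.

Lemma deriv_line_poly x w f :
  (line_poly x w f)^`() = \sum_i w i *: line_poly x w (mderiv i f).
Proof.
pose S g := (line_poly x w g)^`() = \sum_i w i *: line_poly x w (mderiv i g).
have SC c : S (mpolyC n c).
  rewrite /S line_polyC derivC big1 // => i _.
  by rewrite mderivC rmorph0 scaler0.
have SD g h : S g -> S h -> S (g + h).
  move=> Sg Sh; rewrite /S rmorphD /= derivD Sg Sh -big_split.
  by apply: eq_bigr => i _; rewrite mderivD rmorphD scalerDr.
have SM g h : S g -> S h -> S (g * h).
  move=> Sg Sh; rewrite /S rmorphM /= derivM Sg Sh mulr_suml mulr_sumr -big_split.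
  apply: eq_bigr => i _; rewrite mderivM rmorphD !rmorphM scalerDr /=.
  by rewrite scalerAl scalerAr.
have SX i : S (mpolyX C (mnm1 i)).
  rewrite /S line_polyX derivD derivC add0r derivZ derivX (bigD1 i) //=.
  rewrite big1 => [|j ji].
    rewrite mderivX mnm1E eqxx scale1r addr0 (_ : mnm_sub _ _ = mnm0).
      by rewrite mpolyX0 rmorph1.
    by apply/mnmP => k; rewrite mnmBE subnn mnm0E.
  by rewrite mderivX mnm1E eq_sym (negbTE ji) scale0r rmorph0 scaler0.
have SXm m : S (mpolyX C m).
  rewrite mpolyXE_id; elim/big_ind: _ => // [|i _]; first by rewrite -mpolyC1.
  by elim: (m i) => [|k IHk]; rewrite ?expr0 -?mpolyC1 // exprS; exact: SM.
rewrite -/(S f); elim/mpolyind: f => [|c m f _ _ IHf]; first by rewrite -mpolyC0.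
by apply: SD => //; rewrite -mul_mpolyC; exact: SM.
Qed.

(** A bound independent of the line, so that the estimate on small roots is uniform along a family
    of parallel lines. *)
Lemma size_line_poly x w f : (size (line_poly x w f) <= mmeasure mdeg f)%N.
Proof.
rewrite /line_poly /mmap; apply: leq_trans (size_sum _ _ _) _.
apply/bigmax_leqP_seq => m mf _; apply: leq_trans (msize_mdeg_lt mf).
rewrite mul_polyC; apply: leq_trans (size_scale_leq _ _) _.
rewrite mdegE /mmap1; elim/big_rec2: _ => [|i k p _ pk]; first by rewrite size_poly1.
have sz1 : (size ((x i)%:P + w i *: 'X)%R <= 2)%N.
  apply: leq_trans (size_polyD _ _) _; rewrite geq_max size_polyC.
  rewrite (leq_trans (leq_b1 _)) //=; apply: leq_trans (size_scale_leq _ _) _.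
  by rewrite size_polyX.
have szX : (size (((x i)%:P + w i *: 'X) ^+ m i)%R <= (m i).+1)%N.
  elim: (m i) => [|j IHj]; first by rewrite expr0 size_poly1.
  rewrite exprS; apply: leq_trans (size_polyMleq _ _) _; rewrite -subn1 leq_subLR.
  by apply: leq_trans (leq_add sz1 IHj) _; rewrite !addnS !addSn.
apply: leq_trans (size_polyMleq _ _) _; rewrite -subn1 leq_subLR.
by apply: leq_trans (leq_add szX pk) _; rewrite !addnS !addSn.
Qed.

End LineRestriction.

(** * Curves on a hypersurface from small roots *)

Section SmallRoot.
Context {C : numClosedFieldType}.

Lemma prod_XsubC_coef01 (s : seq C) : (forall r, r \in s -> r != 0) ->
  (\prod_(r <- s) ('X - r%:P))`_1 =
  - (\prod_(r <- s) ('X - r%:P))`_0 * \sum_(r <- s) r^-1.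
Proof.
elim: s => [|r s IHs] s0; first by rewrite !big_nil coef1 mulr0.
rewrite !big_cons !mulrBl !coefB !coefXM !coefCM /= IHs; last first.
  by move=> x xs; apply: s0; rewrite inE xs orbT.
have r0 : r != 0 by apply: s0; rewrite inE eqxx.
by field.
Qed.

(* p'(0) / p(0) is minus the sum of the inverses of the roots of p. *)
Lemma small_root (p : {poly C}) : p`_1 != 0 ->
  exists2 u, root p u & `|u| * `|p`_1| <= (size p)%:R * `|p`_0|.
Proof.
move=> p1; have [p0|p0] := eqVneq p`_0 0.
  exists 0; first by rewrite rootE horner_coef0 p0.
  by rewrite p0 !normr0 mul0r mulr0.
have pn0 : p != 0 by apply: contraNneq p1 => ->; rewrite coef0.
have [s pE] := closed_field_poly_normal p.
have s0 r : r \in s -> r != 0.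
  move=> rs; apply: contraNneq p0 => r0; rewrite -horner_coef0 -rootE pE.
  by rewrite rootZ ?lead_coef_eq0 // root_prod_XsubC -r0.
have size_s : size p = (size s).+1.
  by rewrite pE size_scale ?lead_coef_eq0 // size_prod_XsubC.
apply: contrapT => nroot.
have lt_root r : r \in s -> (size p)%:R * `|p`_0| <= `|r| * `|p`_1|.
  move=> rs; apply: ltW; rewrite real_ltNge ?realM ?realn ?normr_real //.
  apply/negP => le; apply: nroot; exists r => //.
  by rewrite pE rootZ ?lead_coef_eq0 // root_prod_XsubC.
have p10 : p`_1 = - p`_0 * \sum_(r <- s) r^-1.
  have := prod_XsubC_coef01 s0; set q := \prod_(r <- s) _ in pE *.
  by move=> q1; rewrite pE !coefZ q1; ring.
have n0 : 0 < `|p`_0| by rewrite normr_gt0.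
have n1 : 0 < `|p`_1| by rewrite normr_gt0.
have sz0 : 0 < (size p)%:R :> C by rewrite ltr0n size_poly_gt0.
(* If no root meets the bound, every inverse root has norm at most k. There are only [size p] - 1 of
   them, so their sum has norm less than [size p] times k, which is |p'(0) / p(0)|. *)
pose k := `|p`_1| / ((size p)%:R * `|p`_0|).
have k0 : 0 < k by rewrite divr_gt0 // mulr_gt0.
have kE : `|p`_0| * ((size p)%:R * k) = `|p`_1|.
  by rewrite /k; field; rewrite !gt_eqF.
have sumE : `|p`_0| * `|\sum_(r <- s) r^-1| = `|p`_1|.
  by rewrite [in RHS]p10 normrM normrN.
have le_sum (s' : seq C) : (forall r, r \in s' -> `|r^-1| <= k) ->
    `|\sum_(r <- s') r^-1| <= (size s')%:R * k.
  elim: s' => [|r s' IHs'] s'k; first by rewrite big_nil normr0 mul0r.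
  rewrite big_cons /= -nat1r mulrDl mul1r.
  apply: le_trans (ler_normD _ _) (lerD (s'k r _) (IHs' _)).
    by rewrite inE eqxx.
  by move=> x xs; apply: s'k; rewrite inE xs orbT.
have : `|\sum_(r <- s) r^-1| < (size p)%:R * k.
  apply: (@le_lt_trans _ _ ((size s)%:R * k)).
    apply: le_sum => r rs; have r0 : 0 < `|r| by rewrite normr_gt0 s0.
    rewrite normfV /k ler_pdivlMr ?mulr_gt0 // ler_pdivrMl //.
    exact: lt_root.
  by rewrite ltr_pM2r // ltr_nat size_s.
by rewrite -(ltr_pM2l n0) kE sumE ltxx.
Qed.

End SmallRoot.

Section TangentCurve.
Context {C : numClosedFieldType} {n : nat}.
Local Notation V := 'cV[C]_n.+1.
Implicit Types (f q : poly_in n.+1 C) (v w : V).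
Local Notation ey y := (delta_mx y 0 : 'cV_n.+1).

(* A root s(t) of f(v + t w + s e_y) of order o(t) exists, because f(v + t w) is
   o(t) while the derivative of f along e_y does not vanish. *)
Lemma hypersurface_curve f v w y : poly_fun f v = 0 ->
  poly_fun (mderiv y f) v != 0 -> 'D_w (poly_fun f) v = 0 ->
  exists c : C -> V, [/\ c 0 = v, is_derive (0 : C) (1 : C) c w &
    \forall t \near (0 : C), poly_fun f (c t) = 0].
Proof.
move=> fv fyv Dfv; pose u (t : C) := v + t *: w.
pose p t := line_poly (vec_coord (u t)) (vec_coord (ey y)) f.
have pE t s : (p t).[s] = poly_fun f (u t + s *: ey y).
  rewrite /p horner_line_poly; apply: meval_eq => i.
  by rewrite /vec_coord [RHS]mxE [X in _ = _ + X]mxE mulrC.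
have p0 t : (p t)`_0 = poly_fun f (u t).
  by rewrite -horner_coef0 pE scale0r addr0.
have p1 t : (p t)`_1 = poly_fun (mderiv y f) (u t).
  have -> : (p t)`_1 = (p t)^`().[0] by rewrite horner_coef0 coef_deriv mulr1n.
  rewrite deriv_line_poly horner_sum (bigD1 y) //= big1 ?addr0 => [|i iy].
    rewrite hornerZ horner_line_poly /vec_coord mxE !eqxx mul1r.
    by apply: meval_eq => i; rewrite mulr0 addr0.
  by rewrite hornerZ /vec_coord mxE (negbTE iy) mul0r.
pose d : C := (mmeasure mdeg f)%:R.
(* The roots are picked separately for each t; the bound alone gives s(0) = 0 and s(t) = o(t). [d]
   dominates the size of p t for all t. *)
have /choice[s sP] t : exists s, (p t)`_1 != 0 ->
    (p t).[s] = 0 /\ `|s| * `|(p t)`_1| <= d * `|(p t)`_0|.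
  have [->|pt1] := eqVneq (p t)`_1 0; first by exists 0.
  have [s ps le_s] := small_root pt1; exists s => _; split; first exact/rootP.
  apply: le_trans le_s _; apply: ler_wpM2r => //.
  by rewrite ler_nat; exact: size_line_poly.
have u0 : u 0 = v by rewrite /u scale0r addr0.
have s0 : s 0 = 0.
  have [|_] := sP 0; first by rewrite p1 u0.
  rewrite p0 p1 u0 fv normr0 mulr0 pmulr_lle0 ?normr_gt0 // normr_le0.
  by move/eqP.
have du : is_derive (0 : C) (1 : C) u w := is_derive_line v w.
have near1 : \forall t \near (0 : C), poly_fun (mderiv y f) (u t) != 0.
  apply: (@curve_near C V u w (fun x => poly_fun (mderiv y f) x != 0) du).
  by rewrite u0; exact: poly_fun_near_neq0.
exists (fun t => u t + s t *: ey y); split.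
- by rewrite u0 s0 scale0r addr0.
- apply/is_derive_curve.
  have su : (h^-1 * s h) @[h --> (0 : C)^'] --> (0 : C).
    have du' : differentiable (poly_fun f) (u 0) by exact: poly_fun_differentiable.
    have := is_derive_comp_curve du du'.
    rewrite u0 Dfv => /is_derive_curve fu0.
    have b_gt0 : 0 < `|poly_fun (mderiv y f) v| by rewrite normr_gt0.
    have d_ge0 : 0 <= d by rewrite ler0n.
    have d1_gt0 : 0 < d + 1 by rewrite ltr_wpDl.
    apply/cvgrPdist_le => e e0.
    (* Chosen so that d k is at most e times half of |f_y(v)|, itself a lower bound for |f_y| near
       v; d + 1 keeps the denominator positive. *)
    pose k := e * (`|poly_fun (mderiv y f) v| / 2) / (d + 1).
    have k0 : 0 < k by rewrite divr_gt0 // mulr_gt0 // divr_gt0.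
    have /cvgrPdist_le/(_ _ k0) near_k := fu0.
    have b2_gt0 : 0 < `|poly_fun (mderiv y f) v| / 2 by rewrite divr_gt0.
    have near_b : \forall t \near (0 : C),
        `|poly_fun (mderiv y f) v - poly_fun (mderiv y f) (u t)| <
        `|poly_fun (mderiv y f) v| / 2.
      apply: (@curve_near C V u w (fun x => `|poly_fun (mderiv y f) v -
        poly_fun (mderiv y f) x| < `|poly_fun (mderiv y f) v| / 2) du).
      rewrite u0; have := differentiable_continuous
        (poly_fun_differentiable (mderiv y f) v).
      by move=> /cvgrPdist_lt/(_ _ b2_gt0).
    near=> h; rewrite sub0r normrN.
    have h0 : h != 0 by near: h; exact: nbhs_dnbhs_neq.
    have fyh : poly_fun (mderiv y f) (u h) != 0.
      by near: h; exact: nbhs_dnbhs near1.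
    have [|_] := sP h; first by rewrite p1.
    rewrite p0 p1 => le_s.
    have b_le : `|poly_fun (mderiv y f) v| / 2 <= `|poly_fun (mderiv y f) (u h)|.
      have : `|poly_fun (mderiv y f) v - poly_fun (mderiv y f) (u h)| <
        `|poly_fun (mderiv y f) v| / 2 by near: h; exact: nbhs_dnbhs near_b.
      move=> /ltW lt_b; have := ler_normD (poly_fun (mderiv y f) (u h))
        (poly_fun (mderiv y f) v - poly_fun (mderiv y f) (u h)).
      rewrite addrC subrK => /le_trans/(_ (lerD (lexx _) lt_b)).
      by rewrite -lerBlDr {1}(splitr `|poly_fun (mderiv y f) v|) addrK.
    have k_le : `|h^-1| * `|poly_fun f (u h)| <= k.
      have : `|0 - h^-1 *: (poly_fun f (u h) - poly_fun f (u 0))| <= k.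
        by near: h; exact: near_k.
      by rewrite sub0r normrN u0 fv subr0 normrM.
    rewrite normrM -(ler_pM2r b2_gt0).
    apply: (@le_trans _ _ (`|h^-1| * (`|s h| * `|poly_fun (mderiv y f) (u h)|))).
      by rewrite -mulrA ler_wpM2l // ler_wpM2l.
    apply: (@le_trans _ _ (`|h^-1| * (d * `|poly_fun f (u h)|))).
      by rewrite ler_wpM2l.
    rewrite mulrCA; apply: (@le_trans _ _ (d * k)); first by rewrite ler_wpM2l.
    rewrite /k mulrA ler_pdivrMr // mulrC ler_wpM2l //.
      by rewrite ltW // mulr_gt0.
    by rewrite lerDl.
  have lim : (w + (h^-1 * s h) *: ey y) @[h --> (0 : C)^'] --> w + (0 : C) *: ey y.
    by apply: cvgD; [exact: cvg_cst|apply: cvgZ => //; exact: cvg_cst].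
  rewrite scale0r addr0 in lim; apply: cvg_trans lim; apply: near_eq_cvg.
  near=> h; have h0 : h != 0 by near: h; exact: nbhs_dnbhs_neq.
  rewrite u0 s0 scale0r addr0 /u -[v + _ + _]addrA [v + _]addrC addrK.
  by rewrite scalerDr !scalerA mulVf // scale1r.
- apply: filterS near1 => t; rewrite -p1 => /sP[ps _].
  by rewrite -pE.
Unshelve. all: by end_near. Qed.

End TangentCurve.

Section SaitoCriterion.
Context {C : numClosedFieldType} {n : nat}.
Local Notation V := 'cV[C]_n.+1.
Local Notation gl := 'M[C]_n.+1.
Local Notation P := (poly_in n.+1 C).

Lemma irred_power_factor (a q : P) : a != 0 -> irred q ->
  exists k e, a = k * q ^+ e /\ ~ dvdr q k.
Proof.
move=> a0 q_irr; have [m] := ubnP (mmeasure mdeg a).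
elim: m a a0 => // m IHm a a0 am.
have [[b aE]|qa] := pselect (dvdr q a); last first.
  by exists a, 0%N; rewrite expr0 mulr1.
have b0 : b != 0 by apply: contraNneq a0 => b0; rewrite aE b0 mul0r.
have q0 : q != 0 by case: q_irr.
have [|k [e [bE qk]]] := IHm b b0.
  rewrite -ltnS (leq_trans _ am) // ltnS aE msizeM //.
  have : mmeasure mdeg q != 1%N.
    apply/eqP => q1; have [_ /negP qU _] := q_irr; apply: qU.
    have [y qy] := irred_mderiv q_irr; have := msize_mderiv y q0.
    by rewrite q1 ltnS leqn0 mmeasure_poly_eq0 (negbTE qy).
  have : mmeasure mdeg q != 0%N by rewrite mmeasure_poly_eq0.
  have : mmeasure mdeg b != 0%N by rewrite mmeasure_poly_eq0.
  by move: (mmeasure _ q) (mmeasure _ b) => s1 s2; lia.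
by exists k, e.+1; split=> //; rewrite aE bE exprSr mulrA.
Qed.

(* Fields tangent to q = 0, independent away from q_y q = 0. *)
Definition tangent_frame (q : P) (y : 'I_n.+1) : 'M[P]_n.+1 :=
  \matrix_(a, l) if l == y then q *+ (a == y) else
    mderiv y q *+ (a == l) - mderiv l q *+ (a == y).

(** Column y is q times a coordinate vector. Deleting row and column y removes all entries - q_l and
    leaves the scalar matrix q_y. *)
Lemma det_tangent_frame q y : \det (tangent_frame q y) = q * mderiv y q ^+ n.
Proof.
rewrite (expand_det_col _ y) (bigD1 y) //= big1 ?addr0 => [|a ay].
  rewrite mxE !eqxx mulr1n; congr (_ * _); rewrite /cofactor exprD -expr2 sqrr_sign mul1r.
  rewrite -det_scalar; congr (\det _); apply/matrixP => i j; rewrite !mxE.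
  rewrite [lift y j == y]eq_sym (negbTE (neq_lift _ _)).
  rewrite [lift y i == y]eq_sym (negbTE (neq_lift _ _)) mulr0n subr0.
  by rewrite (inj_eq (@lift_inj _ y)).
by rewrite mxE eqxx (negbTE ay) mulr0n mul0r.
Qed.

Lemma tangent_frame_deriv q y l v : poly_fun q v = 0 ->
  'D_(\col_a poly_fun (tangent_frame q y a l) v) (poly_fun q) v = 0.
Proof.
move=> qv; rewrite derive_poly_fun.
under eq_bigr => a _ do rewrite mxE.
have [ly|ly] := eqVneq l y.
  apply: big1 => a _; rewrite mxE ly eqxx.
  case: (a == y); last by rewrite mulr0n poly_fun0 mulr0.
  by rewrite mulr1n qv mulr0.
have E a : poly_fun (tangent_frame q y a l) v =
    poly_fun (mderiv y q) v *+ (a == l) - poly_fun (mderiv l q) v *+ (a == y).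
  rewrite mxE (negbTE ly) poly_funB; congr (_ - _).
    by case: (a == l); rewrite ?mulr1n // !mulr0n poly_fun0.
  by case: (a == y); rewrite ?mulr1n // !mulr0n poly_fun0.
under eq_bigr => a _ do rewrite E mulrBr.
rewrite big_split /= (bigD1 l) //= eqxx mulr1n big1 ?addr0 => [|a al]; last first.
  by rewrite (negbTE al) mulr0n mulr0.
rewrite (bigD1 y) //= eqxx mulr1n big1 ?addr0 => [|a ay]; last first.
  by rewrite (negbTE ay) mulr0n mulr0 oppr0.
by rewrite mulrC subrr.
Qed.

(** Write Delta = k q^e with q not dividing k. Comparing determinants near p gives q q_y^n = k q^e
    det A with A holomorphic. If e >= 2, dividing by q and letting the point tend to p forces q_y(p)
    = 0, against the choice of p. *)
Lemma log_basis_reduced (D : set V) (B : 'I_n.+1 -> gl) (q : P) :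
  linear_log_basis D B -> D = [set v | poly_fun (\det (frame B)) v = 0] ->
  irred q -> ~ dvdr (q * q) (\det (frame B)).
Proof.
move=> basisB DE q_irr qqD; have D0 := det_frame_neq0 basisB.
have primeq := (mpoly_ufd n.+1).2 q q_irr.
have q0 : q != 0 by case: q_irr.
have [k [e [DeltaE qk]]] := irred_power_factor D0 q_irr.
have e2 : (1 < e)%N.
  case: qqD => b bE; rewrite ltnNge; apply/negP => e1; apply: qk.
  move: DeltaE; rewrite bE; case: e e1 => [|[|//]] _.
    by rewrite expr0 mulr1 => <-; exists (b * q); rewrite mulrA.
  by rewrite expr1 mulrA => /(mulIf q0) <-; exists b.
have [y qy] := irred_mderiv q_irr.
have [|p' [qp']] := @irred_nullstellensatz C n.+1 q (mderiv y q * k) q_irr.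
  by move=> /primeq[/(not_dvdr_mderiv qy)|].
pose p : V := \col_i p' i.
rewrite -[meval p' _]poly_fun_col -/p poly_funM mulf_eq0 negb_or => /andP[qyp kp].
have {}qp : poly_fun q p = 0 by rewrite poly_fun_col.
have logT l : log_vf_at D p (fun v => \col_a poly_fun (tangent_frame q y a l) v).
  apply: log_vf_curves.
    apply: filterE => v; apply: differentiable_mx => a b.
    have -> : (fun u : V => (\col_a poly_fun (tangent_frame q y a l) u) a b) =
      poly_fun (tangent_frame q y a l) by apply/funext => u; rewrite mxE.
    exact: poly_fun_differentiable.
  apply: filterS2 (poly_fun_near_neq0 qyp) (poly_fun_near_neq0 kp) => v qyv kv.
  (* Near p the cofactor k has no zero, so D is the hypersurface q = 0 there and contains the curves
     found on it. *)
  rewrite DE /= DeltaE => /eqP; rewrite poly_funM mulf_eq0 (negbTE kv) /=.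
  rewrite /poly_fun rmorphXn /= expf_eq0 => /andP[_ /eqP qv].
  have [c [c0 dc cq]] := hypersurface_curve qv qyv (tangent_frame_deriv y l qv).
  exists c; split=> //; apply: filterS cq => t ct /=.
  rewrite mevalM rmorphXn /= -[meval _ q]/(poly_fun q (c t)) ct expr0n.
  by move: e2; case: (e) => // e' _; rewrite mulr0.
have /choice[A AP] l : exists a : 'I_n.+1 -> V -> C, (forall i, holomorphic_at (a i) p) /\
    \forall v \near p, \col_a poly_fun (tangent_frame q y a l) v =
      \sum_i a i v *: (B i *m v).
  by have [_ gen _] := basisB p; exact: gen (logT l).
pose Amx v : gl := \matrix_(i, l) A l i v.
have detE : \forall v \near p, poly_fun q v * poly_fun (mderiv y q) v ^+ n =
    poly_fun k v * poly_fun q v ^+ e * \det (Amx v).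
  have allT := @filter_forall _ _ _ (nbhs p) (nbhs_filter p) (fun l => (AP l).2).
  apply: filterS allT => v Tv.
  have -> : poly_fun q v * poly_fun (mderiv y q) v ^+ n =
      poly_fun (\det (tangent_frame q y)) v.
    by rewrite det_tangent_frame poly_funM /poly_fun rmorphXn.
  have -> : poly_fun k v * poly_fun q v ^+ e = poly_fun (\det (frame B)) v.
    by rewrite DeltaE poly_funM /poly_fun rmorphXn.
  rewrite !poly_fun_det -det_mulmx; congr (\det _); apply/matrixP => a l.
  have := congr1 (fun u : V => u a 0) (Tv l).
  rewrite /= summxE mxE => E; rewrite mxE E mxE.
  apply: eq_bigr => i _; rewrite mxE mulrC; congr (_ * _); last by rewrite mxE.
  by rewrite [RHS]mxE poly_fun_frame.
(* A line transversal to q = 0 at p, since q_y(p) is nonzero: q does not vanish on it for small t !=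
   0 and can be cancelled. *)
pose c (t : C) : V := p + t *: delta_mx y 0.
have dc : is_derive (0 : C) (1 : C) c (delta_mx y 0) := is_derive_line p _.
have c0 : c 0 = p by rewrite /c scale0r addr0.
have cp : c t @[t --> (0 : C)^'] --> p.
  move=> U; rewrite -{1}c0 => /(curve_near dc); exact: nbhs_dnbhs.
have qc : \forall t \near (0 : C)^', poly_fun q (c t) != 0.
  have dq : differentiable (poly_fun q) (c 0) by exact: poly_fun_differentiable.
  have := is_derive_comp_curve dc dq; rewrite c0 -poly_fun_mderiv => /is_derive_curve.
  have qy0 : 0 < `|poly_fun (mderiv y q) p| by rewrite normr_gt0.
  move=> /cvgrPdist_lt/(_ _ qy0); apply: filterS => t.
  by apply: contraTneq => qct; rewrite /= qct c0 qp subrr scaler0 subr0 ltxx.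
have lim1 : (poly_fun (mderiv y q) (c t) ^+ n) @[t --> (0 : C)^'] -->
    poly_fun (mderiv y q) p ^+ n.
  apply: cvg_pow; apply: (cvg_comp c (poly_fun (mderiv y q)) cp).
  exact: (differentiable_continuous (poly_fun_differentiable _ p)).
have lim2 : (poly_fun k (c t) * poly_fun q (c t) ^+ e.-1 * \det (Amx (c t)))
    @[t --> (0 : C)^'] --> poly_fun k p * poly_fun q p ^+ e.-1 * \det (Amx p).
  apply: cvgM; first apply: cvgM.
  - apply: (cvg_comp c (poly_fun k) cp).
    exact: (differentiable_continuous (poly_fun_differentiable _ p)).
  - apply: cvg_pow; apply: (cvg_comp c (poly_fun q) cp).
    exact: (differentiable_continuous (poly_fun_differentiable _ p)).
  - apply: cvg_det; apply/cvg_mxP => i l; rewrite mxE.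
    under eq_fun do rewrite mxE.
    apply: (cvg_comp c (A l i) cp).
    exact: (differentiable_continuous (nbhs_singleton ((AP l).1 i))).
have : poly_fun (mderiv y q) p ^+ n = poly_fun k p * poly_fun q p ^+ e.-1 * \det (Amx p).
  suff lim3 : (poly_fun k (c t) * poly_fun q (c t) ^+ e.-1 * \det (Amx (c t)))
      @[t --> (0 : C)^'] --> poly_fun (mderiv y q) p ^+ n.
    exact: cvg_at_unique lim3 lim2.
  apply: cvg_trans lim1; apply: near_eq_cvg.
  have near_det := cp _ detE.
  apply: filterS2 qc near_det => t qct /= E; apply: (mulfI qct).
  rewrite E -{1}(prednK (ltnW e2)) exprS; ring.
rewrite qp; case: (e) e2 => [//|[//|e' _]] /=; rewrite expr0n mulr0 mul0r => /eqP.
by rewrite expf_eq0 (negbTE qyp) andbF.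
Qed.

End SaitoCriterion.

(** * Differentials of the characters *)

Lemma near_neq0 {K : numFieldType} (a : K) : a != 0 -> \forall z \near a, z != 0.
Proof.
rewrite -normr_gt0 => a0; have /cvgrPdist_lt/(_ _ a0) := @cvg_id _ (nbhs a).
by apply: filterS => z; apply: contraTneq => ->; rewrite subr0 ltxx.
Qed.

Lemma cvg_horner {K : numFieldType} {T : Type} {F : set_system T} {FF : Filter F}
    (p : {poly K}) (f : T -> K) (l : K) :
  f t @[t --> F] --> l -> p.[f t] @[t --> F] --> p.[l].
Proof.
move=> fl; rewrite horner_coef; under eq_fun do rewrite horner_coef.
by apply: cvg_bigD => i; apply: cvgM; [exact: cvg_cst|exact: cvg_pow].
Qed.

Lemma is_derive_mulr {K : numFieldType} (c : K -> K) w a :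
  is_derive (0 : K) (1 : K) c w -> is_derive (0 : K) (1 : K) (fun t => c t * a) (w * a).
Proof.
move=> dc; apply: (is_derive_curve _ _).2.
have -> : (fun h => h^-1 *: (c h * a - c 0 * a)) =
    (fun h : K => (h^-1 *: (c h - c 0)) * a).
  by apply/funext => h; rewrite -mulrBl -scalerAl.
by apply: cvgM; [exact: (is_derive_curve _ _).1|exact: cvg_cst].
Qed.

Section Characters.
Context {R : realType} {n : nat}.
Local Notation C := (Cplx R).
Local Notation gl := 'M[C]_n.+1.
Local Notation V := 'cV[C]_n.+1.

Lemma expmx_scalar (t : C) : expmx (t *: 1%:M : gl) = (expmx (t *: 1%:M : gl) 0 0)%:M.
Proof.
pose g (s : C) : gl := 1 + s *: (t *: 1%:M).
have g0 : g 0 = 1 by rewrite /g scale0r addr0.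
have dg : is_derive (0 : C) (1 : C) g (t *: 1%:M) := is_derive_line (1 : gl) _.
have /cvg_mxP lim := expmx_flow g0 dg.
have gE k : g k%:R^-1 ^+ k = ((1 + k%:R^-1 * t) ^+ k)%:M.
  by rewrite /g scalerA scalemx1 -[1 in LHS]/(1%:M : gl) -raddfD -rmorphXn.
move: (expmx _) lim => E lim; apply/matrixP => i j; rewrite mxE.
have lim00 := lim 0 0; have limij := lim i j.
have [<-|ij] := eqVneq i j.
  rewrite mulr1n; suff limii : (g k%:R^-1 ^+ k) 0 0 @[k --> \oo] --> E i i.
    exact: cvg_at_unique limii lim00.
  apply: cvg_trans (lim i i); apply: near_eq_cvg; apply: filterE => k /=.
  by rewrite gE !mxE !eqxx.
rewrite mulr0n; suff lim0 : (g k%:R^-1 ^+ k) i j @[k --> \oo] --> (0 : C).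
  exact: cvg_at_unique limij lim0.
by apply: cvg_near_cst; apply: filterE => k; rewrite gE mxE (negbTE ij).
Qed.

Lemma scalar_in_group (G : set gl) (lambda : C) : linear_algebraic_group G ->
  lie_algebra G 1%:M -> lambda != 0 -> G lambda%:M.
Proof.
move=> groupG lie1 l0; have [A [[S ->] GE]] := lag_closed groupG.
have inG h : G h <-> zero_locus (@mx_coord C n.+1) S h /\ h \in unitmx by rewrite GE.
apply/inG; split; last by rewrite unitmxE det_scalar unitfE expf_neq0.
move=> p Sp; pose q := line_poly (fun=> 0) (mx_coord (1%:M : gl)) p.
have qE s : q.[s] = meval (mx_coord (s%:M : gl)) p.
  rewrite horner_line_poly; apply: meval_eq => i; rewrite add0r /mx_coord.
  by case/mxvec_indexP: i => a b; rewrite !mxvecE !mxE mulrnAl mul1r.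
rewrite -qE; have [->|q0] := eqVneq q 0; first by rewrite horner0.
(* A nonzero q has finite order m at 1. But q vanishes at every e t, where e 0 = 1 and e has
   derivative 1 at 0, so these zeros accumulate at 1. *)
have [m [s /implyP/(_ q0) s1 qs]] := multiplicity_XsubC q 1.
pose e (t : C) := expmx (t *: 1%:M : gl) 0 0.
have qe t : q.[e t] = 0.
  have := lie1 t; rewrite expmx_scalar => /inG[/(_ p Sp) qt _].
  by rewrite qE; exact: qt.
have de : is_derive (0 : C) (1 : C) e 1.
  have /is_derive_mx/(_ 0 0) := is_derive_expmx (1%:M : gl).
  by rewrite mxE.
have e0 : e 0 = 1.
  rewrite /e (_ : expmx _ = 1) ?mxE //; rewrite scale0r; exact: expmx0.
have ne : \forall t \near (0 : C)^', e t != 1.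
  have := (is_derive_curve _ _).1 de.
  move=> /cvgrPdist_lt/(_ 1 ltr01); apply: filterS => t.
  by apply: contraTneq => et; rewrite /= et e0 subrr scaler0 subr0 normr1 ltxx.
have ns : \forall t \near (0 : C), s.[e t] != 0.
  apply: (@curve_near C C e 1 (fun z => s.[z] != 0) de); rewrite e0.
  have cs : s.[z] @[z --> (1 : C)] --> s.[1].
    exact: (@cvg_horner C C (nbhs (1 : C)) (nbhs_filter _) s id 1 cvg_id).
  by apply: (cs [set z | z != 0]); exact: near_neq0.
have [t [et st]] : exists t, e t != 1 /\ s.[e t] != 0.
  apply: (@filter_ex _ (0 : C)^'); apply: filterS2 ne (nbhs_dnbhs ns) => t; split=> //.
have /eqP := qe t; rewrite qs hornerM horner_exp hornerXsubC mulf_eq0 (negbTE st).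
by rewrite expf_eq0 subr_eq0 (negbTE et) andbF.
Qed.

(** Where f(v0) is nonzero, chi(exp(tX)) = f(exp(tX) v0) / f(v0). This quotient is differentiable at
    t = 0, which makes [dchar] a true derivative. *)
Lemma derive_character (f : poly_in n.+1 C) (chi : gl -> C) (X : gl) : f != 0 ->
  (forall t v, poly_fun f (expmx (t *: X) *m v) =
    chi (expmx (t *: X)) * poly_fun f v) ->
  forall v, 'D_(X *m v) (poly_fun f) v = dchar chi X * poly_fun f v.
Proof.
move=> f0 fchi; have df v : is_derive (0 : C) (1 : C)
    (fun t => chi (expmx (t *: X)) * poly_fun f v) ('D_(X *m v) (poly_fun f) v).
  pose c (t : C) := expmx (t *: X) *m v.
  have dc : is_derive (0 : C) (1 : C) c (X *m v) := is_derive_expmx_mul X v.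
  have c0 : c 0 = v.
    by rewrite /c scale0r (_ : expmx 0 = 1) ?mul1mx //; exact: expmx0.
  have cf t : chi (expmx (t *: X)) * poly_fun f v = poly_fun f (c t) := esym (fchi t v).
  rewrite (funext cf); clear cf; clearbody c.
  have := is_derive_comp_curve dc (poly_fun_differentiable f (c 0)).
  by rewrite c0.
have [v0 fv0] := poly_fun_neq0 f0.
have dchi : is_derive (0 : C) (1 : C) (fun t => chi (expmx (t *: X))) (dchar chi X).
  rewrite /dchar derive1E; apply: DeriveDef => //.
  have [+ _] := is_derive_mulr (poly_fun f v0)^-1 (df v0).
  by under eq_fun do rewrite (mulfK fv0).
move=> v; apply: (is_derive_unique (df v)); exact: is_derive_mulr dchi.
Qed.

End Characters.

(** * Linear forms on the Lie algebra that vanish on brackets *)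

Section CharacterDifferentials.
Context {R : realType} {n : nat}.
Local Notation C := (Cplx R).
Local Notation gl := 'M[C]_n.+1.
Local Notation V := 'cV[C]_n.+1.
Local Notation P := (poly_in n.+1 C).
Variables (G : set gl) (D : set V) (r : nat) (f : 'I_r -> P) (chi : 'I_r -> gl -> C).
Hypotheses (GD : defines_linear_free_divisor G D) (fP : basic_relative_invariants D f).
Hypothesis fchi : forall i g v, G g ->
  poly_fun (f i) (g *m v) = chi i g * poly_fun (f i) v.

Let f_neq0 i : f i != 0. Proof. by case: (basic_invariant_irred fP i). Qed.

Lemma derive_invariant i X v : lie_algebra G X ->
  'D_(X *m v) (poly_fun (f i)) v = dchar (chi i) X * poly_fun (f i) v.
Proof.
move=> lieX; apply: (derive_character (f_neq0 i)) => t w; apply: fchi.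
exact: lieX.
Qed.

Lemma dchar_eq i X a v : lie_algebra G X -> poly_fun (f i) v != 0 ->
  'D_(X *m v) (poly_fun (f i)) v = a * poly_fun (f i) v -> dchar (chi i) X = a.
Proof. by move=> lieX fv; rewrite derive_invariant // => /(mulIf fv). Qed.

Lemma derive_xi i X v : lie_algebra G X ->
  vf_apply (xi X) (poly_fun (f i)) v = dchar (chi i) X * poly_fun (f i) v.
Proof. by move=> lieX; rewrite /vf_apply xiE; exact: derive_invariant. Qed.

Lemma derive_lincomb (p : P) (I : finType) (c : I -> C) (X : I -> gl) v :
  'D_((\sum_j c j *: X j) *m v) (poly_fun p) v =
  \sum_j c j * 'D_(X j *m v) (poly_fun p) v.
Proof.
rewrite derive_poly_fun; under [RHS]eq_bigr do rewrite derive_poly_fun mulr_sumr.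
rewrite exchange_big; apply: eq_bigr => l _ /=.
rewrite mulmx_suml summxE mulr_sumr; apply: eq_bigr => j _.
by rewrite -scalemxAl mxE mulrCA.
Qed.

(** The exponential of a sum is not a product in general; linearity is read off instead from the
    derivative of f i along X v, linear in X, at a point where f i is nonzero. *)
Lemma dchar_lincomb i (I : finType) (c : I -> C) (X : I -> gl) :
  (forall j, lie_algebra G (X j)) ->
  dchar (chi i) (\sum_j c j *: X j) = \sum_j c j * dchar (chi i) (X j).
Proof.
move=> lieX; have [v fv] := poly_fun_neq0 (f_neq0 i).
have lieS : lie_algebra G (\sum_j c j *: X j) := lie_lincomb (dlfd_group GD) _ c lieX.
apply: (dchar_eq lieS fv).
rewrite derive_lincomb mulr_suml; apply: eq_bigr => j _.
by rewrite (derive_invariant i v (lieX j)) mulrA.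
Qed.

Lemma dchar_one i : lie_algebra G 1%:M -> dchar (chi i) 1%:M = (tdeg (f i))%:R /\
  forall lambda : C, lambda != 0 -> chi i lambda%:M = lambda ^+ tdeg (f i).
Proof.
move=> lie1; have chi_scalar (l : C) : l != 0 -> chi i l%:M = l ^+ tdeg (f i).
  apply: (@tdeg_scaling _ _ (f i) (fun l => chi i l%:M)) => // {}l v l0.
  by rewrite -mul_scalar_mx fchi //; exact: scalar_in_group (dlfd_group GD) lie1 l0.
split=> //; have [v fv] := poly_fun_neq0 (f_neq0 i).
apply: (dchar_eq lie1 fv); rewrite mul1mx.
have dc := is_derive_line v v; have c0 : v + (0 : C) *: v = v by rewrite scale0r addr0.
have dp := poly_fun_differentiable (f i) (v + (0 : C) *: v).
have d1 := is_derive_comp_curve dc dp; rewrite c0 in d1.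
apply: (is_derive_unique d1).
(* Along v + t v the invariant f i is multiplied by the character of the scalar 1 + t, nonzero near
   t = 0, that is by (1 + t) to the degree of f i. *)
have d2 : is_derive (0 : C) (1 : C) (fun t : C => (1 + t * 1) ^+ tdeg (f i))
    (tdeg (f i))%:R.
  have := @is_deriveX C C _ (tdeg (f i)) _ _ _ (is_derive_line (1 : C) (1 : C)).
  rewrite scale0r addr0 expr1n mulr1 -[_ *: (1 : C)]/(_ * 1) mulr1.
  by congr (is_derive _ _ _ _); apply/funext => t; rewrite fctE.
apply: near_eq_is_derive (is_derive_mulr (poly_fun (f i) v) d2).
have near1 : \forall t \near (0 : C), 1 + t * 1 != 0.
  have dl := is_derive_line (1 : C) (1 : C).
  apply: (@curve_near C C _ 1 (fun z => z != 0) dl); rewrite scale0r addr0.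
  by apply: near_neq0; exact: oner_neq0.
apply: filterS near1 => t t1.
rewrite /comp; have -> : v + t *: v = (1 + t * 1)%:M *m v.
  by rewrite mul_scalar_mx mulr1 scalerDl scale1r.
by rewrite fchi ?chi_scalar //; exact: scalar_in_group (dlfd_group GD) lie1 _.
Qed.

Variable B : 'I_n.+1 -> gl.
Hypotheses (basisB : linear_log_basis D B)
  (lieB : forall X, lie_algebra G X <-> exists c : 'I_n.+1 -> C, X = \sum_i c i *: B i).

Local Notation Delta := (\det (frame B)).

Let Delta0 : Delta != 0. Proof. exact: det_frame_neq0 basisB. Qed.
Let DE : D = [set v | poly_fun Delta v = 0].
Proof. exact (lfd_discriminant GD basisB lieB). Qed.

Lemma lie_basis j : lie_algebra G (B j).
Proof.
apply/lieB; exists (fun i => (i == j)%:R); rewrite (bigD1 j) //= eqxx scale1r.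
by rewrite big1 ?addr0 // => i /negbTE->; rewrite scale0r.
Qed.

Lemma invariant_cofactors : exists k : 'I_r -> P,
  (forall i, Delta = k i * f i) /\ (forall i, ~ dvdr (f i) (k i)).
Proof.
have /choice[k kP] i : exists k, Delta = k * f i by exact: basic_invariant_dvdr DE fP i.
exists k; split=> // i [q kE].
apply: (log_basis_reduced basisB DE (basic_invariant_irred fP i)).
by exists q; rewrite (kP i) kE mulrA.
Qed.

Lemma mderiv_frame i j :
  \sum_l mderiv l (f i) * frame B l j = mpolyC n.+1 (dchar (chi i) (B j)) * f i.
Proof.
apply/eqP; rewrite -subr_eq0; apply/eqP/poly_fun_eq0 => v.
rewrite poly_funB poly_fun_sum [in X in _ - X]poly_funM poly_funC.
rewrite -(derive_invariant _ _ (lie_basis j)) derive_poly_fun; apply/eqP.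
by rewrite subr_eq0; apply/eqP/eq_bigr => l _; rewrite poly_funM poly_fun_frame.
Qed.

(** The form sum of c_i df_i / f_i evaluated on the field B j, both sides multiplied by Delta. *)
Lemma log_form_frame (k : 'I_r -> P) (c : 'I_r -> C) j :
  (forall i, Delta = k i * f i) ->
  \sum_l (\sum_i mpolyC n.+1 (c i) * (k i * mderiv l (f i))) * frame B l j =
  mpolyC n.+1 (\sum_i c i * dchar (chi i) (B j)) * Delta.
Proof.
move=> kP; under eq_bigr do rewrite mulr_suml.
have -> : mpolyC n.+1 (\sum_i c i * dchar (chi i) (B j)) =
    \sum_i mpolyC n.+1 (c i * dchar (chi i) (B j)) by exact: raddf_sum.
rewrite exchange_big mulr_suml; apply: eq_bigr => i _ /=.
rewrite mpolyCM (kP i).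
transitivity (mpolyC n.+1 (c i) * k i * \sum_l mderiv l (f i) * frame B l j).
  by rewrite mulr_sumr; apply: eq_bigr => l _; rewrite !mulrA.
rewrite mderiv_frame; ring.
Qed.

Lemma frame_cancel (eta : 'I_n.+1 -> P) :
  (forall j, \sum_l eta l * frame B l j = 0) -> forall l, eta l = 0.
Proof.
move=> eta0 l; pose u : 'rV[P]_n.+1 := \row_l eta l.
have uB : u *m frame B = 0.
  apply/rowP => j; rewrite mxE [RHS]mxE -[RHS](eta0 j).
  by apply: eq_bigr => a _; rewrite mxE.
have : u *m (frame B *m \adj (frame B)) = 0 by rewrite mulmxA uB mul0mx.
rewrite mul_mx_adj => /rowP/(_ l); rewrite mul_mx_scalar !mxE => /eqP.
by rewrite mulf_eq0 (negbTE Delta0) => /eqP.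
Qed.

(** The form sum of c_i df_i / f_i vanishes on the frame, hence is zero. Modulo f i only the i-th
    numerator remains, and f i divides neither k i nor a nonzero derivative of f i, so the residue c
    i is 0. *)
Lemma dchar_independent (c : 'I_r -> C) :
  (forall j, \sum_i c i * dchar (chi i) (B j) = 0) -> forall i, c i = 0.
Proof.
move=> c0 i; have [k [kP kf]] := invariant_cofactors.
apply/eqP/negPn/negP => ci; have f_irr := basic_invariant_irred fP.
have [y fy] := irred_mderiv (f_irr i).
have /frame_cancel/(_ y) : forall j,
    \sum_l (\sum_i mpolyC n.+1 (c i) * (k i * mderiv l (f i))) * frame B l j = 0.
  by move=> j; rewrite (log_form_frame _ _ kP) c0 mpolyC0 mul0r.
rewrite (bigD1 i) //= => /eqP; rewrite addr_eq0 => /eqP E.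
have prime := (mpoly_ufd n.+1).2 (f i) (f_irr i).
have dvd : dvdr (f i) (k i * mderiv y (f i)).
  have -> : k i * mderiv y (f i) =
      mpolyC n.+1 (c i)^-1 * (mpolyC n.+1 (c i) * (k i * mderiv y (f i))).
    by rewrite [RHS]mulrA -mpolyCM mulVf // mpolyC1 mul1r.
  rewrite E; apply: dvdr_mull; apply: dvdrN; apply: dvdr_sum => j ji.
  apply: dvdr_mull; apply: dvdr_mulr.
  have : dvdr (f i) (k j * f j) by rewrite -kP (kP i); apply: dvdr_mull; exact: dvdrr.
  by move/prime => [//|] /(basic_invariant_neq fP (i:=i) (j:=j))[]; rewrite eq_sym.
by case/prime: dvd; [exact: kf|exact: not_dvdr_mderiv].
Qed.

(** Independence says that the matrix of values of the d(chi_i) on the B j has full row rank; the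
    columns of a right inverse are the coordinates of the X j. *)
Lemma dual_basis_exists : exists X : 'I_r -> gl, (forall i, lie_algebra G (X i)) /\
  (forall i j, dchar (chi i) (X j) = (i == j)%:R).
Proof.
pose M : 'M[C]_(r, n.+1) := \matrix_(i, j) dchar (chi i) (B j).
have MF : row_free M.
  apply/row_freeP; apply/row_freeP; rewrite -kermx_eq0; apply/eqP.
  apply/row_matrixP => a; rewrite row0; apply/rowP => i; rewrite [RHS]mxE.
  apply: (@dchar_independent (fun i => row a (kermx M) 0 i)) => j.
  have /sub_kermxP : (row a (kermx M) <= kermx M)%MS by exact: row_sub.
  move=> /rowP/(_ j); rewrite mxE [RHS]mxE => E; rewrite -[RHS]E.
  by apply: eq_bigr => b _; rewrite [M _ _]mxE.
have [Q MQ] := row_freeP MF.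
exists (fun j => \sum_l Q l j *: B l); split=> [j|i j]; first by apply/lieB; exists (Q^~ j).
rewrite (dchar_lincomb _ _ lie_basis).
transitivity ((M *m Q) i j); last by rewrite MQ mxE.
by rewrite mxE; apply: eq_bigr => l _; rewrite mxE mulrC.
Qed.

(* In the coframe dual to the B j, phi is a rational one-form, closed because phi
   kills brackets; its poles on D are simple because Delta is reduced, and its
   low degree leaves only combinations of the d(f i) / f i. *)
Lemma closed_functional (phi : 'I_n.+1 -> C) :
  (forall i j, exists2 g, B i *m B j - B j *m B i = \sum_k g k *: B k &
    \sum_k g k * phi k = 0) ->
  exists c : 'I_r -> C, forall j, phi j = \sum_i c i * dchar (chi i) (B j).
Proof.
move=> bracket; have [k [kP kf]] := invariant_cofactors.
have [c cP] := closed_log_form Delta0 (basic_invariant_irred fP) kP kf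
  (fun i j => basic_invariant_neq fP (i:=i) (j:=j))
  (fun q q_irr => basic_invariant_factor Delta0 DE fP q_irr)
  (fun l => msize_frame_form phi l Delta0)
  (fun l m => frame_form_closed bracket l m Delta0).
exists c => j; have := frame_formP B phi j.
under eq_bigr do rewrite cP.
by rewrite (log_form_frame _ _ kP) => /(mulIf Delta0)/eqP; rewrite mpolyC_eq => /eqP.
Qed.

Lemma in_derived_algebra Z : lie_algebra G Z ->
  (forall i, dchar (chi i) Z = 0) -> derived_algebra (lie_algebra G) Z.
Proof.
move=> lieZ dZ; pose N := #|{: 'I_n.+1 * 'I_n.+1}|; pose Br (q : 'I_N) : gl :=
  let ij := enum_val q in B ij.1 *m B ij.2 - B ij.2 *m B ij.1.
pose U := <<[tuple Br q | q < N]>>%VS.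
suff /mem_span_ord[c ->] : Z \in U.
  exists _, c, (fun q => B (enum_val q).1), (fun q => B (enum_val q).2).
  by split; [move=> q; split; exact: lie_basis|exact: eq_bigr].
suff ZE : Z - projv U Z = 0 by rewrite -[Z](subrK (projv U Z)) ZE add0r memv_proj.
apply/matrixP => a b; rewrite [RHS]mxE.
(* These entries are linear forms vanishing on the span U of the brackets, and together they detect
   whether Z lies in U. *)
pose phi (X : gl) : C := (X - projv U X) a b.
have phi_sum (c : 'I_n.+1 -> C) : phi (\sum_k c k *: B k) = \sum_k c k * phi (B k).
  rewrite /phi linear_sum -sumrB summxE; apply: eq_bigr => k _.
  by rewrite linearZ -scalerBr mxE.
have [i j|c cP] := @closed_functional (fun k => phi (B k)).
  have /lieB[g gE] := lie_bracket GD lieB (lie_basis i) (lie_basis j).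
  exists g => //; rewrite -phi_sum -gE /phi projv_id ?subrr ?mxE //.
  apply/mem_span_ord; exists (fun q => (q == enum_rank (i, j))%:R).
  rewrite (bigD1 (enum_rank (i, j))) //= eqxx scale1r big1 ?addr0.
    by rewrite /Br enum_rankK.
  by move=> q /negbTE->; rewrite scale0r.
have [z ZE] := (lieB Z).1 lieZ; rewrite -/(phi Z) {1}ZE phi_sum.
under eq_bigr do rewrite cP mulr_sumr.
rewrite exchange_big big1 // => i _ /=.
transitivity (c i * dchar (chi i) Z); last by rewrite dZ mulr0.
rewrite ZE (dchar_lincomb _ _ lie_basis) mulr_sumr; apply: eq_bigr => k _.
by rewrite mulrCA.
Qed.

End CharacterDifferentials.

Theorem lemma5p26 (R : realType) (n : nat)
  (G : set 'M[Cplx R]_n.+1) (D : set 'cV[Cplx R]_n.+1)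
  (r : nat) (f : 'I_r -> poly_in n.+1 (Cplx R))
  (chi : 'I_r -> 'M[Cplx R]_n.+1 -> Cplx R) :
  defines_linear_free_divisor G D ->
  basic_relative_invariants D f ->
  (forall i, rational_character G (chi i)) ->
  (forall i g v, G g ->
     poly_fun (f i) (g *m v) = chi i g * poly_fun (f i) v) ->
  [/\ (* I lies in the Lie algebra, C^* I lies in G, xi_I is the Euler field *)
      [/\ lie_algebra G 1%:M,
          forall lambda : Cplx R, lambda != 0 -> G lambda%:M &
          forall v : 'cV[Cplx R]_n.+1, xi 1%:M v = v],
      (* X_1, ..., X_r as required exist *)
      exists X : 'I_r -> 'M[Cplx R]_n.+1,
        (forall i, lie_algebra G (X i)) /\
        (forall i j, dchar (chi i) (X j) = (i == j)%:R),
      (* the two conditions on X_1, ..., X_r are equivalent *)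
      forall X : 'I_r -> 'M[Cplx R]_n.+1, (forall i, lie_algebra G (X i)) ->
        ((forall i j, dchar (chi i) (X j) = (i == j)%:R) <->
         (forall i j v, vf_apply (xi (X i)) (poly_fun (f j)) v =
                        (i == j)%:R * poly_fun (f j) v)),
      forall i,
        [/\ forall v, vf_apply (xi 1%:M) (poly_fun (f i)) v =
                      (tdeg (f i))%:R * poly_fun (f i) v,
            dchar (chi i) 1%:M = (tdeg (f i))%:R &
            forall lambda : Cplx R, lambda != 0 ->
              chi i lambda%:M = lambda ^+ tdeg (f i)] &
      forall X : 'I_r -> 'M[Cplx R]_n.+1, (forall i, lie_algebra G (X i)) ->
        (forall i j, dchar (chi i) (X j) = (i == j)%:R) ->
        derived_algebra (lie_algebra G)
          (1%:M - \sum_j (tdeg (f j))%:R *: X j) /\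
        annihilating_vf f
          (fun v => xi 1%:M v - \sum_j (tdeg (f j))%:R *: xi (X j) v)].

Proof.
move=> GD fP _ fchi; have [B basisB lieB] := lfd_lie_basis GD.
have lie1 := lie_one GD basisB lieB; have groupG := dlfd_group GD.
have f0 i : f i != 0 by case: (basic_invariant_irred fP i).
have d1 i := (dchar_one GD fP fchi i lie1).1.
split.
- split; [exact: lie1|move=> lambda; exact: scalar_in_group groupG lie1|].
  by move=> v; rewrite xiE mul1mx.
- exact (dual_basis_exists GD fP fchi basisB lieB).
- move=> X lieX; split=> [dX i j v|dX i j].
    by rewrite (derive_xi fP fchi _ _ (lieX i)) dX eq_sym.
  have [v fv] := poly_fun_neq0 (f0 i); apply: (mulIf fv).
  by rewrite -(derive_xi fP fchi _ _ (lieX j)) dX eq_sym.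
- move=> i; split; [move=> v|exact: d1|exact: (dchar_one GD fP fchi i lie1).2].
  by rewrite (derive_xi fP fchi _ _ lie1) d1.
move=> X lieX dX; pose Z := 1%:M - \sum_j (tdeg (f j))%:R *: X j.
have lieS := lie_lincomb groupG (index_enum 'I_r) (fun j => (tdeg (f j))%:R) lieX.
(* Z is written as a linear combination indexed by the booleans, so that the lemmas on finite linear
   combinations apply to a difference. *)
pose XZ (b : bool) := if b then 1%:M else \sum_j (tdeg (f j))%:R *: X j.
have lieXZ b : lie_algebra G (XZ b) by case: b; [exact: lie1|exact: lieS].
have ZE : Z = \sum_b (-1) ^+ (~~ b) *: XZ b.
  by rewrite big_bool /= expr0 scale1r expr1 scaleN1r.
have lieZ : lie_algebra G Z by rewrite ZE; exact (lie_lincomb groupG _ _ lieXZ).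
have dZ i : dchar (chi i) Z = 0.
  rewrite ZE (dchar_lincomb GD fP fchi _ _ lieXZ) big_bool /= expr0 expr1 mul1r mulN1r.
  rewrite d1 (dchar_lincomb GD fP fchi _ _ lieX) (bigD1 i) //= dX eqxx mulr1.
  by rewrite big1 ?addr0 ?subrr // => j ji; rewrite dX eq_sym (negbTE ji) mulr0.
split; first exact (in_derived_algebra GD fP fchi basisB lieB lieZ dZ).
have -> : (fun v => xi 1%:M v - \sum_j (tdeg (f j))%:R *: xi (X j) v) =
    (fun v => Z *m v).
  apply/funext => v; rewrite xiE mulmxBl; congr (_ - _); rewrite mulmx_suml.
  by apply: eq_bigr => j _; rewrite xiE scalemxAl.
split=> [p|i v]; first by apply: filterE => v; exact: differentiable_linear_field.
by rewrite /vf_apply (derive_invariant fP fchi _ _ lieZ) dZ mul0r.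
Qed.
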